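(* Let $\widetilde{\mathrm{HH}}^k(M):=\mathrm{HH}^k(M)(-2k)$. Then $$\widetilde{\mathrm{HH}}^k(X)\cong \widetilde{\mathrm{HH}}^{n-k}(X^\vee)^\vee$$ as complexes of $R$-modules, for all $X\in\mathcal{K}^b(\mathbb{S}\mathrm{Bim}_n)$.
   Context: Let $\Bbbk$ be an infinite field of characteristic $\neq 2$ and $R=\Bbbk[x_1,\dots,x_n]$, graded with $\deg x_i=2$. Grading shift: $M(1)_j=M_{j+1}$. For $1\le i\le n-1$ let $R^{(i,i+1)}\subset R$ be the polynomials symmetric in $x_i,x_{i+1}$ and $B_i=R\otimes_{R^{(i,i+1)}}R(1)$. $\mathbb{S}\mathrm{Bim}_n$ is the full subcategory of graded $(R,R)$-bimodules generated by $R,B_1,\dots,B_{n-1}$ under finite direct sums, tensor product $\otimes=\otimes_R$, grading shifts and direct summands; $\mathcal{K}^b(\mathbb{S}\mathrm{Bim}_n)$ is its bounded homotopy category. For a graded bimodule $M$, $\mathrm{HH}^k(M)=\mathrm{Ext}^k_{R\otimes_\Bbbk R}(R,M)$ (graded Ext) is Hochschild cohomology, zero unless $0\le k\le n$. For $M\in\mathbb{S}\mathrm{Bim}_n$ it is a free graded $R$-module of finite rank. For $X\in\mathcal{K}^b(\mathbb{S}\mathrm{Bim}_n)$, $\mathrm{HH}^k(X)$ is the complex of graded $R$-modules obtained by applying $\mathrm{HH}^k$ term-wise. Duals: for $B\in\mathbb{S}\mathrm{Bim}_n$, $B^\vee\in\mathbb{S}\mathrm{Bim}_n$ is the two-sided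 (monoidal) dual of $B$ in $\mathbb{S}\mathrm{Bim}_n$; concretely it is the graded dual $\mathrm{Hom}_{-R}(B,R)$ of $B$ as a right $R$-module (naturally isomorphic to the dual as a left $R$-module), with $(a\phi b)(m)=a\,\phi(bm)$. It satisfies $B_i^\vee\cong B_i$ and $(M\otimes N)^\vee\cong N^\vee\otimes M^\vee$. This contravariant functor is extended to complexes. For a complex $Y$ of finite rank free graded $R$-modules, $Y^\vee=\underline{\mathrm{Hom}}_R(Y,R)$ is the graded dual complex. *)

(* Defs.v *)
From HB Require Import structures.
From mathcomp Require Import all_boot all_order all_algebra fingroup perm.
From mathcomp Require Import generic_quotient ring_quotient.
From mathcomp Require Import boolp functions.
From mathcomp Require Import mpoly.

Set Implicit Arguments.
Unset Strict Implicit.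
Unset Printing Implicit Defensive.

Import Order.TTheory GRing.Theory Num.Theory.
Local Open Scope ring_scope.
Local Open Scope quotient_scope.

Record is_grading (V : zmodType) (H : int -> V -> Prop) : Prop := IsGrading {
  grad0 : forall j, H j 0;
  gradB : forall j u v, H j u -> H j v -> H j (u - v);
  grad_span : forall v, exists2 s : seq V,
    (forall u, u \in s -> exists j, H j u) & v = \sum_(u <- s) u;
  grad_indep : forall (f : int -> V) (s : seq int), uniq s ->
    (forall j, H j (f j)) -> \sum_(j <- s) f j = 0 ->
    forall j : int, j \in s -> f j = 0 }.

(* deg x_i = 2, and 0 is homogeneous of every degree *)
Definition phomog (k : fieldType) (m : nat) (j : int) (p : {mpoly k[m]}) : Prop :=
  forall mm, mm \in msupp p -> Posz (mdeg mm).*2 = j.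

Record gradedMod (k : fieldType) (m : nat) := GradedMod {
  gm_car :> lmodType {mpoly k[m]};
  gm_hom : int -> gm_car -> Prop;
  gm_grading : is_grading gm_hom;
  gm_scale : forall i j p v,
    phomog i p -> gm_hom j v -> gm_hom (i + j) (p *: v) }.

Arguments gm_hom {k m g} j v.

Record ghom (k : fieldType) (m : nat) (M N : gradedMod k m) := GHom {
  gfun :> M -> N;
  gfun_lin : linear gfun;
  gfun_deg : forall j v, gm_hom j v -> gm_hom j (gfun v) }.

HB.instance Definition _ k m (M N : gradedMod k m) (f : ghom M N) :=
  GRing.isLinear.Build _ _ _ _ (gfun f) (gfun_lin f).

Definition gm_iso (k : fieldType) (m : nat) (M N : gradedMod k m) : Prop :=
  exists f : ghom M N, bijective f.

Section GradingLemmas.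
Variables (V : zmodType) (H : int -> V -> Prop) (HG : is_grading H).

Lemma gradN j u : H j u -> H j (- u).
Proof. by move=> Hu; rewrite -sub0r; apply: (gradB HG) => //; apply: grad0. Qed.

Lemma gradD j u v : H j u -> H j v -> H j (u + v).
Proof. by move=> Hu Hv; rewrite -(opprK v); apply: (gradB HG) => //; apply: gradN. Qed.

Lemma grad_regroup (B : V -> Prop) (s : seq V) :
  B 0 -> (forall u v, B u -> B v -> B (u + v)) ->
  (forall u, u \in s -> B u /\ exists j, H j u) ->
  exists t : seq int, exists f : int -> V,
    [/\ uniq t, forall j, H j (f j) /\ B (f j),
        forall j : int, j \notin t -> f j = 0 & \sum_(u <- s) u = \sum_(j <- t) f j].
Proof.
move=> B0 BD; elim: s => [|u s IHs] Hs.
  exists [::], (fun=> 0); split=> //; last by rewrite !big_nil.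
  by move=> j; split=> //; apply: (grad0 HG).
have [|t [f [Ut Hf f0 E]]] := IHs.
  by move=> v sv; apply: Hs; rewrite inE sv orbT.
have [Bu [j Hj]] := Hs u (mem_head _ _).
exists (if j \in t then t else j :: t), (fun i => f i + if i == j then u else 0).
have Ut' : uniq (if j \in t then t else j :: t) by case: ifPn => //= ->.
have jt' : j \in (if j \in t then t else j :: t).
  by case: ifPn => //; rewrite mem_head.
split=> //.
- move=> i; have [Hi Bi] := Hf i.
  case: eqP => [->|_]; last by rewrite addr0.
  by have [? ?] := Hf j; split; [apply: gradD | apply: BD].
- move=> i it'.
  have ij : i == j = false by apply: contraNF it' => /eqP ->.
  rewrite ij addr0 f0 //; apply: contra it'; case: ifP => // _ it.
  by rewrite inE it orbT.
rewrite big_cons big_split /= E [RHS]addrC; congr (_ + _).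
  by rewrite (bigD1_seq j) //= eqxx big1 ?addr0 // => i /negbTE ->.
by case: ifPn => // jt; rewrite big_cons f0 ?add0r.
Qed.

Lemma grad_unique (t t' : seq int) (f f' : int -> V) :
  uniq t -> uniq t' -> (forall j, H j (f j)) -> (forall j, H j (f' j)) ->
  (forall j : int, j \notin t -> f j = 0) -> (forall j : int, j \notin t' -> f' j = 0) ->
  \sum_(j <- t) f j = \sum_(j <- t') f' j -> f =1 f'.
Proof.
move=> Ut Ut' Hf Hf' f0 f'0 E.
pose T := undup (t ++ t').
have sub (s : seq int) (g : int -> V) : uniq s -> {subset s <= T} ->
    (forall j : int, j \notin s -> g j = 0) -> \sum_(j <- T) g j = \sum_(j <- s) g j.
  move=> Us sT g0; rewrite (bigID (mem s)) /= [X in _ + X]big1 // addr0.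
  rewrite -big_filter; apply: perm_big; apply: uniq_perm => //.
    by rewrite filter_uniq // undup_uniq.
  move=> j; rewrite mem_filter /=; case: (boolP (j \in s)) => //= js.
  by rewrite sT.
have tT : {subset t <= T} by move=> j jt; rewrite mem_undup mem_cat jt.
have t'T : {subset t' <= T} by move=> j jt; rewrite mem_undup mem_cat jt orbT.
have Hff' j : H j (f j - f' j) by apply: (gradB HG).
have S0 : \sum_(j <- T) (f j - f' j) = 0.
  by rewrite sumrB (sub t) // (sub t') // E subrr.
move=> j; apply/eqP; rewrite -subr_eq0; apply/eqP.
case: (boolP (j \in T)) => jT.
  exact: (grad_indep HG (undup_uniq _) Hff' S0).
rewrite f0 ?f'0 ?subrr //; apply: contra jT; first exact: t'T.
exact: tT.
Qed.

End GradingLemmas.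

Lemma gm_hom0 k m (M : gradedMod k m) j : gm_hom j (0 : M).
Proof. exact: (grad0 (gm_grading M)). Qed.

Lemma gm_homB k m (M : gradedMod k m) j (u v : M) :
  gm_hom j u -> gm_hom j v -> gm_hom j (u - v).
Proof. exact: (gradB (gm_grading M)). Qed.

Lemma gm_homD k m (M : gradedMod k m) j (u v : M) :
  gm_hom j u -> gm_hom j v -> gm_hom j (u + v).
Proof. exact: (gradD (gm_grading M)). Qed.

Lemma phomogC (k : fieldType) m (c : k) : @phomog k m 0 c%:MP.
Proof.
move=> mm; rewrite msuppC; case: ifP => // _.
by rewrite inE => /eqP ->; rewrite mdeg0.
Qed.

Lemma gm_homC k m (M : gradedMod k m) j c (v : M) :
  gm_hom j v -> gm_hom j (c%:MP *: v).
Proof. by move=> Hv; rewrite -[j]add0r; apply: gm_scale => //; apply: phomogC. Qed.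

Lemma phomog_grading (k : fieldType) m : is_grading (@phomog k m).
Proof.
split=> [j|j p q Hp Hq|p|f s Us Hf S0 j js].
- by move=> mm; rewrite msupp0.
- move=> mm /msuppB_le; rewrite mem_cat => /orP[]; [exact: Hp|exact: Hq].
- exists [seq p@_mm *: 'X_[mm] | mm <- msupp p].
    move=> u /mapP[mm _ ->]; exists (Posz (mdeg mm).*2) => m' /msuppZ_le.
    by rewrite msuppX inE => /eqP ->.
  by rewrite big_map -mpolyE.
apply/mpolyP=> mm; rewrite mcoeff0.
case: (boolP (mm \in msupp (f j))) => mj; last exact: memN_msupp_eq0.
have := congr1 (mcoeff mm) S0; rewrite mcoeff0 raddf_sum /= (big_rem j) //=.
rewrite big_seq big1 ?addr0 // => i; rewrite mem_rem_uniq // inE => /andP[ij _].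
apply: memN_msupp_eq0; apply: contra ij => mi.
by rewrite -(Hf _ _ mi) (Hf _ _ mj).
Qed.

Lemma phomogM (k : fieldType) m i j (p q : {mpoly k[m]}) :
  phomog i p -> phomog j q -> phomog (i + j) (p * q).
Proof.
move=> Hp Hq mm /msuppM_le /allpairsP[[m1 m2] /= [/Hp <- /Hq <- ->]].
by rewrite mdegD doubleD PoszD.
Qed.

Section Regular.
Variables (k : fieldType) (m : nat).

Definition greg : gradedMod k m :=
  @GradedMod k m {mpoly k[m]}^o (@phomog k m) (@phomog_grading k m)
    (@phomogM k m).

End Regular.

Section Shift.
Variables (k : fieldType) (m : nat) (M : gradedMod k m) (a : int).

Lemma shift_grading : is_grading (fun j (v : M) => gm_hom (j + a) v).
Proof.
have G := gm_grading M.
split=> [j|j u v|v|f s Us Hf S0 j js].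
- exact: (grad0 G).
- exact: (gradB G).
- have [s Hs ->] := grad_span G v; exists s => // u us.
  by have [j Hj] := Hs u us; exists (j - a); rewrite subrK.
have := @grad_indep _ _ G (fun i => f (i - a)) [seq i + a | i <- s].
rewrite (map_inj_uniq (addIr a)) => /(_ Us) Hu.
have /Hu: forall i, gm_hom i (f (i - a)) by move=> i; have:= Hf (i - a); rewrite subrK.
rewrite big_map.
under eq_bigr do rewrite addrK.
move=> /(_ S0 (j + a)); rewrite addrK; apply.
exact: map_f.
Qed.

Lemma shift_scale i j p (v : M) :
  phomog i p -> gm_hom (j + a) v -> gm_hom (i + j + a) (p *: v).
Proof. by move=> Hp Hv; rewrite -addrA; apply: gm_scale. Qed.

(* M(a), with M(a)_j = M_(j+a) *)
Definition gshift : gradedMod k m := GradedMod shift_grading shift_scale.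

End Shift.

Section Sum.
Variables (k : fieldType) (m : nat) (M N : gradedMod k m).

Lemma sum_grading :
  is_grading (fun j (v : (M * N)%type) => gm_hom j v.1 /\ gm_hom j v.2).
Proof.
have GM := gm_grading M; have GN := gm_grading N.
split=> [j|j u v [? ?] [? ?]|[v w]|f s Us Hf S0 j js].
- by split; apply: gm_hom0.
- by split; apply: gm_homB.
- have [s Hs ->] := grad_span GM v; have [t Ht ->] := grad_span GN w.
  exists ([seq (x, 0) | x <- s] ++ [seq (0, y) | y <- t]).
    move=> u; rewrite mem_cat => /orP[] /mapP[x xs ->].
      by have [j ?] := Hs x xs; exists j; split=> //; apply: gm_hom0.
    by have [j ?] := Ht x xs; exists j; split=> //; apply: gm_hom0.
  rewrite big_cat !big_map /=.
  have -> : \sum_(x <- s) (x, 0) = (\sum_(x <- s) x, 0) :> (M * N)%type.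
    by elim: s {Hs} => [|x s IH]; rewrite ?big_nil // !big_cons IH; congr pair; rewrite /= addr0.
  have -> : \sum_(x <- t) (0, x) = (0, \sum_(x <- t) x) :> (M * N)%type.
    by elim: t {Ht} => [|x t IH]; rewrite ?big_nil // !big_cons IH; congr pair; rewrite /= addr0.
  by congr pair; rewrite /= ?addr0 ?add0r.
have E1 : \sum_(i <- s) (f i).1 = 0 by rewrite -(raddf_sum fst) S0.
have E2 : \sum_(i <- s) (f i).2 = 0 by rewrite -(raddf_sum snd) S0.
rewrite [f j]surjective_pairing.
rewrite (grad_indep GM Us (fun i => proj1 (Hf i)) E1 js).
by rewrite (grad_indep GN Us (fun i => proj2 (Hf i)) E2 js).
Qed.

Lemma sum_scale i j p (v : (M * N)%type) : phomog i p ->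
  gm_hom j v.1 /\ gm_hom j v.2 ->
  gm_hom (i + j) (p *: v).1 /\ gm_hom (i + j) (p *: v).2.
Proof. by move=> Hp [? ?]; split; apply: gm_scale. Qed.

Definition gsum : gradedMod k m := GradedMod sum_grading sum_scale.

End Sum.

Section Renaming.
Variables (k : fieldType) (m m' : nat) (h : 'I_m -> 'I_m').

Definition ren (p : {mpoly k[m]}) : {mpoly k[m']} := p \mPo [tuple 'X_(h i) | i < m].

Lemma ren_is_zmod_morphism : zmod_morphism ren.
Proof. by move=> p q; apply: raddfB. Qed.

Lemma ren_is_monoid_morphism : monoid_morphism ren.
Proof. by split=> [|p q]; [apply: rmorph1 | apply: rmorphM]. Qed.

HB.instance Definition _ :=
  GRing.isZmodMorphism.Build {mpoly k[m]} {mpoly k[m']} ren ren_is_zmod_morphism.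
HB.instance Definition _ :=
  GRing.isMonoidMorphism.Build {mpoly k[m]} {mpoly k[m']} ren ren_is_monoid_morphism.

Lemma phomog_sum (I : eqType) j (s : seq I) (F : I -> {mpoly k[m']}) :
  (forall i, i \in s -> phomog j (F i)) -> phomog j (\sum_(i <- s) F i).
Proof.
move=> HF; rewrite big_seq; elim/big_ind: _ => //.
- exact: (grad0 (phomog_grading k m')).
- by move=> p q; apply: (gradD (phomog_grading k m')).
Qed.

Lemma phomog_ren j p : phomog j p -> phomog j (ren p).
Proof.
move=> Hp; rewrite /ren comp_mpolyEX; apply: phomog_sum => mm /Hp Hmm.
rewrite comp_mpolyX => m1 /msuppZ_le Hm1; rewrite -Hmm; congr (Posz _.*2).
move: m1 Hm1; rewrite mdegE; elim/big_rec2: _ => [m1|i q d _ IH m1].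
  by rewrite msupp1 inE => /eqP ->; rewrite mdeg0.
rewrite tnth_mktuple mpolyXn => /msuppM_le /allpairsP[[a b] /= [Ha Hb ->]].
move: Ha; rewrite msuppX inE => /eqP ->.
rewrite mdegD (IH b Hb); congr (_ + _)%N.
by elim: (mm i) => [|e IHe]; rewrite ?mulm0n ?mdeg0 // mulmS mdegD mdeg1 IHe.
Qed.

End Renaming.

Section Restriction.
Variables (k : fieldType) (m m' : nat) (h : 'I_m -> 'I_m').

Definition restr_car (M : lmodType {mpoly k[m']}) : Type := M.

HB.instance Definition _ (M : lmodType {mpoly k[m']}) :=
  GRing.Zmodule.on (restr_car M).

Section Scale.
Variable M : lmodType {mpoly k[m']}.

Definition restr_act (p : {mpoly k[m]}) (v : restr_car M) : restr_car M :=
  ren h p *: (v : M).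

Lemma restr_actA p q v : restr_act p (restr_act q v) = restr_act (p * q) v.
Proof. by rewrite /restr_act scalerA rmorphM. Qed.
Lemma restr_act1 : left_id 1 restr_act.
Proof. by move=> v; rewrite /restr_act rmorph1 scale1r. Qed.
Lemma restr_actDr : right_distributive restr_act +%R.
Proof. by move=> p u v; rewrite /restr_act scalerDr. Qed.
Lemma restr_actDl v : {morph restr_act^~ v : p q / p + q}.
Proof. by move=> p q; rewrite /restr_act raddfD scalerDl. Qed.

HB.instance Definition _ := GRing.Zmodule_isLmodule.Build {mpoly k[m]}
  (restr_car M) restr_actA restr_act1 restr_actDr restr_actDl.
End Scale.

Lemma restr_grading (M : gradedMod k m') :
  is_grading (fun j (v : restr_car M) => gm_hom j (v : M)).
Proof. exact: gm_grading. Qed.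

Lemma restr_scale (M : gradedMod k m') i j p (v : restr_car M) :
  phomog i p -> gm_hom j (v : M) -> gm_hom (i + j) (p *: v : M).
Proof. by move=> /(phomog_ren (h := h)) Hp; apply: gm_scale. Qed.

Definition restr (M : gradedMod k m') : gradedMod k m :=
  GradedMod (restr_grading M) (@restr_scale M).

Lemma restr_map_lin (M N : gradedMod k m') (f : ghom M N) :
  linear (f : restr M -> restr N).
Proof. by move=> p u v; apply: (gfun_lin f). Qed.

Definition restr_map (M N : gradedMod k m') (f : ghom M N) :
  ghom (restr M) (restr N) :=
  @GHom _ _ (restr M) (restr N) f (restr_map_lin f) (gfun_deg f).

End Restriction.

Section GradedHom.
Variables (k : fieldType) (m : nat) (M N : gradedMod k m).

Definition homog_map (a : int) (f : M -> N) : Prop :=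
  forall j v, gm_hom j v -> gm_hom (j + a) (f v).

Definition is_gmap (f : M -> N) : Prop :=
  exists2 s : seq (M -> N),
    (forall u, u \in s -> linear u /\ exists a, homog_map a u)
    & f = \sum_(u <- s) u.

Definition gmapP : pred (M -> N) := fun f => `[< is_gmap f >].

Lemma gmap_single a f : linear f -> homog_map a f -> is_gmap f.
Proof.
move=> lf hf; exists [:: f]; last by rewrite big_seq1.
by move=> u; rewrite inE => /eqP ->; split=> //; exists a.
Qed.

Lemma gmap_linear f : is_gmap f -> linear f.
Proof.
case=> s; elim: s f => [|g s IH] f Hs ->.
  by rewrite big_nil => a u v; rewrite /= scaler0 addr0.
rewrite big_cons => a u v /=.
have [lg _] := Hs g (mem_head _ _).
have ls := IH _ (fun u us => Hs u (mem_behead (s := g :: s) us)) erefl.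
rewrite [LHS]/GRing.add /= [X in _ = _ *: X + _]/GRing.add /= [X in _ = _ + X]/GRing.add /=.
by rewrite lg ls scalerDr addrACA.
Qed.

Lemma gmap0 : is_gmap 0.
Proof. by exists [::]; rewrite ?big_nil. Qed.

Lemma gmapD f g : is_gmap f -> is_gmap g -> is_gmap (f + g).
Proof.
case=> [s Hs ->] [t Ht ->]; exists (s ++ t); last by rewrite big_cat.
by move=> u; rewrite mem_cat => /orP[]; [apply: Hs | apply: Ht].
Qed.

Lemma gmap_sum (I : eqType) (s : seq I) (F : I -> M -> N) :
  (forall i, i \in s -> is_gmap (F i)) -> is_gmap (\sum_(i <- s) F i).
Proof.
move=> HF; rewrite big_seq; elim/big_ind: _ => //; first exact: gmap0.
exact: gmapD.
Qed.

Lemma gmapZ p f : is_gmap f -> is_gmap (p *: f).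
Proof.
case=> s Hs ->; rewrite scaler_sumr; apply: gmap_sum => u /Hs[lu [a hu]].
rewrite [p]mpolyE scaler_suml; apply: gmap_sum => mm mp.
apply: (@gmap_single (Posz (mdeg mm).*2 + a)).
  move=> q x y; set c := p@_mm *: 'X_[mm].
  change (c *: u (q *: x + y) = q *: (c *: u x) + c *: u y).
  by rewrite lu scalerDr !scalerA mulrC.
move=> j v Hv; rewrite addrCA; apply: gm_scale; last exact: hu.
by move=> m1 /msuppZ_le; rewrite msuppX inE => /eqP ->.
Qed.

Lemma gmapP_submod : submod_closed gmapP.
Proof.
split; first by apply/asboolP; apply: gmap0.
move=> p f g /asboolP Hf /asboolP Hg; apply/asboolP.
by apply: gmapD => //; apply: gmapZ.
Qed.

HB.instance Definition _ :=
  GRing.isSubmodClosed.Build {mpoly k[m]} (M -> N) gmapP gmapP_submod.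

Record gmap := Gmap { gmap_fun :> M -> N; _ : gmapP gmap_fun }.

HB.instance Definition _ := [isSub for gmap_fun].
HB.instance Definition _ := [Choice of gmap by <:].
HB.instance Definition _ := [SubChoice_isSubLmodule of gmap by <:].

Lemma gmap_val_is_gmap (f : gmap) : is_gmap f.
Proof. by case: f => f /= /asboolP. Qed.

Lemma gmap_val_linear (f : gmap) : linear f.
Proof. exact: gmap_linear (gmap_val_is_gmap f). Qed.

HB.instance Definition _ (f : gmap) :=
  GRing.isLinear.Build _ _ _ _ (gmap_fun f) (gmap_val_linear f).

Lemma gmapE (f g : gmap) : f =1 g -> f = g.
Proof. by move=> E; apply: val_inj; apply: funext. Qed.

Lemma gmap_sumE (I : Type) (s : seq I) (F : I -> gmap) v :
  (\sum_(i <- s) F i) v = \sum_(i <- s) F i v.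
Proof. by elim/big_rec2: _ => // i y f _ <-. Qed.

Definition mk_gmap (f : M -> N) (Hf : is_gmap f) : gmap := Gmap (asboolT Hf).

Lemma gmap_grading : is_grading (fun a (f : gmap) => homog_map a f).
Proof.
split=> [a|a f g Hf Hg|f|F s Us HF S0 a sa].
- by move=> j v _; apply: gm_hom0.
- by move=> j v Hv; apply: gm_homB; [apply: Hf | apply: Hg].
- have [s] := gmap_val_is_gmap f.
  elim: s f => [|u s IH] f Hs E.
    exists [::] => //; rewrite big_nil; apply: gmapE => v.
    by move/(congr1 (fun g : M -> N => g v)): E; rewrite big_nil.
  have [lu [a hu]] := Hs u (mem_head _ _).
  pose u' := mk_gmap (gmap_single lu hu).
  have [|t Ht Et] := IH (f - u') (fun x xs => Hs x (mem_behead (s := u :: s) xs)).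
    apply: funext => v; change (f v - u v = (\sum_(x <- s) x) v).
    have -> : f v = u v + (\sum_(x <- s) x) v.
      by move/(congr1 (fun g : M -> N => g v)): E; rewrite big_cons.
    by rewrite addrC addKr.
  exists (u' :: t); last by rewrite big_cons -Et addrC subrK.
  move=> x; rewrite inE => /orP[/eqP ->|/Ht //]; by exists a.
apply: gmapE => v; rewrite /=.
have [t Ht ->] := grad_span (gm_grading M) v.
rewrite linear_sum big_seq big1 // => w /Ht[j Hw].
have := @grad_indep _ _ (gm_grading N) (fun i => F (i - j) w) [seq i + j | i <- s].
rewrite (map_inj_uniq (addIr j)) => /(_ Us) Hu.
have /Hu : forall i, gm_hom i (F (i - j) w).
  by move=> i; have := HF (i - j) j w Hw; rewrite addrC subrK.
rewrite big_map; under eq_bigr do rewrite addrK.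
rewrite -gmap_sumE S0 => /(_ erefl (a + j)); rewrite addrK; apply.
exact: map_f.
Qed.

Lemma gmap_scale i a p (f : gmap) :
  phomog i p -> homog_map a f -> homog_map (i + a) (p *: f).
Proof.
move=> Hp Hf j v Hv; rewrite addrCA.
by apply: (gm_scale Hp); apply: Hf.
Qed.

Definition gHom : gradedMod k m := GradedMod gmap_grading gmap_scale.

End GradedHom.

Section GradedHomMaps.
Variables (k : fieldType) (m : nat).
Implicit Types M N L : gradedMod k m.

Lemma gmap_precomp_subproof M N L (f : ghom M N) (g : gmap N L) :
  is_gmap (fun v : M => g (f v)).
Proof.
have [s Hs E] := gmap_val_is_gmap g.
exists [seq (fun v => u (f v)) | u <- s].
  move=> w /mapP[u /Hs[lu [a hu]] ->]; split.
    by move=> p x y; rewrite (gfun_lin f) lu.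
  by exists a => j v Hv; apply: hu; apply: gfun_deg.
rewrite big_map; apply: funext => v; rewrite E.
by rewrite !fct_sumE.
Qed.

Lemma gmap_postcomp_subproof M N L (g : gmap M N) (f : ghom N L) :
  is_gmap (fun v : M => f (g v)).
Proof.
have [s Hs E] := gmap_val_is_gmap g.
exists [seq (fun v => f (u v)) | u <- s].
  move=> w /mapP[u /Hs[lu [a hu]] ->]; split.
    by move=> p x y; rewrite lu (gfun_lin f).
  by exists a => j v Hv; apply: gfun_deg; apply: hu.
rewrite big_map; apply: funext => v; rewrite E.
by rewrite !fct_sumE linear_sum.
Qed.

Definition gmap_precomp M N L (f : ghom M N) (g : gmap N L) : gmap M L :=
  mk_gmap (gmap_precomp_subproof f g).

Definition gmap_postcomp M N L (f : ghom N L) (g : gmap M N) : gmap M L :=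
  mk_gmap (gmap_postcomp_subproof g f).

End GradedHomMaps.

Section CoHom.
Variables (k : fieldType) (m m' : nat) (h : 'I_m -> 'I_m').
Variables (M : gradedMod k m') (N : gradedMod k m).

Definition cohom_car : Type := gmap (restr h M) N.
HB.instance Definition _ := GRing.Zmodule.on cohom_car.

Lemma cohom_act_subproof (q : {mpoly k[m']}) (f : cohom_car) :
  is_gmap (fun v : restr h M => (f : gmap _ _) (q *: (v : M) : M)).
Proof.
have [s Hs E] := gmap_val_is_gmap (f : gmap _ _).
have -> : (fun v : restr h M => (f : gmap _ _) (q *: (v : M) : M)) =
  \sum_(u <- s) \sum_(mm <- msupp q)
    (fun v : restr h M => u ((q@_mm *: 'X_[mm]) *: (v : M) : M)).
  apply: funext => v; rewrite E !fct_sumE; apply: eq_big_seq => u /Hs[lu _].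
  rewrite fct_sumE {1}[q]mpolyE scaler_suml.
  pose U : {linear restr h M -> N} :=
    HB.pack u (GRing.isLinear.Build _ _ _ _ u lu).
  exact: (linear_sum U).
apply: gmap_sum => u /Hs[lu [a hu]]; apply: gmap_sum => mm mq.
apply: (@gmap_single _ _ _ _ (Posz (mdeg mm).*2 + a)).
  move=> p x y; set c := q@_mm *: 'X_[mm].
  rewrite -lu; congr (u _).
  change (c *: (ren h p *: (x : M) + (y : M)) =
    ren h p *: (c *: (x : M)) + c *: (y : M)).
  by rewrite scalerDr !scalerA mulrC.
move=> j v Hv; rewrite addrA; apply: hu; rewrite addrC.
apply: (@gm_scale _ _ M) => // m1 /msuppZ_le.
by rewrite msuppX inE => /eqP ->.
Qed.

Definition cohom_act (q : {mpoly k[m']}) (f : cohom_car) : cohom_car :=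
  mk_gmap (cohom_act_subproof q f).

Lemma cohom_actA p q f : cohom_act p (cohom_act q f) = cohom_act (p * q) f.
Proof. by apply: gmapE => v /=; rewrite scalerA mulrC. Qed.
Lemma cohom_act1 : left_id 1 cohom_act.
Proof. by move=> f; apply: gmapE => v /=; rewrite scale1r. Qed.
Lemma cohom_actDr : right_distributive cohom_act +%R.
Proof. by move=> p f g; apply: gmapE. Qed.
Lemma cohom_actDl f : {morph cohom_act^~ f : p q / p + q}.
Proof.
move=> p q; apply: gmapE => v /=; rewrite scalerDl.
exact: (linearD (f : gmap (restr h M) N)).
Qed.

HB.instance Definition _ := GRing.Zmodule_isLmodule.Build {mpoly k[m']}
  cohom_car cohom_actA cohom_act1 cohom_actDr cohom_actDl.

Lemma cohom_grading :
  is_grading (fun a (f : cohom_car) => homog_map a (f : gmap (restr h M) N)).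
Proof. exact: gmap_grading. Qed.

Lemma cohom_scale i a p (f : cohom_car) :
  phomog i p -> homog_map a (f : gmap (restr h M) N) ->
  homog_map (i + a) ((p *: f : cohom_car) : gmap (restr h M) N).
Proof.
move=> Hp Hf j v Hv; rewrite addrA; apply: Hf.
by rewrite addrC; apply: (@gm_scale _ _ M).
Qed.

(* The graded Hom over k[x_1..x_m] (which acts on M through x_i |-> x_(h i))
   from M to N, with (q f)(v) = f (q v) for q in k[x_1..x_m']. *)
Definition coHom : gradedMod k m' := GradedMod cohom_grading cohom_scale.

End CoHom.

Record gsubmod (k : fieldType) (m : nat) (M : gradedMod k m) := GSubmod {
  gs_mem :> M -> Prop;
  gs_0 : gs_mem 0;
  gs_D : forall u v, gs_mem u -> gs_mem v -> gs_mem (u + v);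
  gs_Z : forall p v, gs_mem v -> gs_mem (p *: v);
  gs_graded : forall v, gs_mem v -> exists2 s : seq M,
    (forall u, u \in s -> gs_mem u /\ exists j, gm_hom j u) &
    v = \sum_(u <- s) u }.

Section SubQuot.
Variables (k : fieldType) (m : nat) (M : gradedMod k m) (S : gsubmod M).

Definition gs_pred : pred M := fun v => `[< S v >].

Lemma gs_pred_submod : submod_closed gs_pred.
Proof.
split; first by apply/asboolP; apply: gs_0.
move=> p u v /asboolP Hu /asboolP Hv; apply/asboolP.
by apply: gs_D => //; apply: gs_Z.
Qed.

HB.instance Definition _ :=
  GRing.isSubmodClosed.Build {mpoly k[m]} M gs_pred gs_pred_submod.

Lemma gs_pred_sub : {in gs_pred &, forall u v, u - v \in gs_pred}.
Proof.
move=> u v /asboolP Su /asboolP Sv; apply/asboolP.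
by apply: gs_D => //; rewrite -scaleN1r; apply: gs_Z.
Qed.

Record gsub_car := GSubCar { gsub_val :> M; _ : gs_pred gsub_val }.

HB.instance Definition _ := [isSub for gsub_val].
HB.instance Definition _ := [Choice of gsub_car by <:].
HB.instance Definition _ := [SubChoice_isSubLmodule of gsub_car by <:].

Lemma gsub_valP (u : gsub_car) : S (u : M).
Proof. by case: u => u /= /asboolP. Qed.

Definition mk_gsub (u : M) (Su : S u) : gsub_car := GSubCar (asboolT Su).

Lemma gsub_val_sum (I : Type) (s : seq I) (F : I -> gsub_car) :
  gsub_val (\sum_(i <- s) F i) = \sum_(i <- s) gsub_val (F i).
Proof. by elim/big_rec2: _ => // i y f _ <-. Qed.

Lemma gsub_grading : is_grading (fun j (u : gsub_car) => gm_hom j (u : M)).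
Proof.
split=> [j|j u v|v|f s Us Hf S0 j js].
- exact: gm_hom0.
- exact: gm_homB.
- have [s Hs E] := gs_graded (gsub_valP v).
  elim: s v Hs E => [|u s IH] v Hs E.
    by exists [::] => //; rewrite big_nil; apply: val_inj; rewrite /= E big_nil.
  have [Su Hu] := Hs u (mem_head _ _).
  have [|t Ht Et] := IH (v - mk_gsub Su) (fun x xs => Hs x (mem_behead (s := u :: s) xs)).
    by change (gsub_val v - u = \sum_(x <- s) x); rewrite E big_cons addrC addKr.
  exists (mk_gsub Su :: t); last by rewrite big_cons -Et addrC subrK.
  by move=> x; rewrite inE => /orP[/eqP ->|/Ht //].
apply: val_inj; apply: (grad_indep (gm_grading M) Us Hf _ js).
by rewrite -gsub_val_sum S0.
Qed.

Lemma gsub_scale i j p (u : gsub_car) :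
  phomog i p -> gm_hom j (u : M) -> gm_hom (i + j) ((p *: u : gsub_car) : M).
Proof. exact: gm_scale. Qed.

Definition gsub : gradedMod k m := GradedMod gsub_grading gsub_scale.

Definition gs_closed : zmodClosed M := HB.pack_for (zmodClosed M) gs_pred
  (GRing.isZmodClosed.Build M gs_pred (conj (asboolT (gs_0 S)) gs_pred_sub)).
Definition gquot_car : Type := Quotient.quot gs_closed.
HB.instance Definition _ := GRing.Zmodule.on gquot_car.

Definition gpi (u : M) : gquot_car := \pi_(Quotient.quot gs_closed) u.
Definition grepr (c : gquot_car) : M := repr (c : Quotient.quot gs_closed).

Lemma greprK c : gpi (grepr c) = c.
Proof. exact: reprK. Qed.

Lemma gpi_eq u v : gpi u = gpi v <-> S (u - v).
Proof.
rewrite /gpi; split.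
  by move/eqP; rewrite -Quotient.idealrBE => /asboolP.
by move=> H; apply/eqP; rewrite -Quotient.idealrBE; apply/asboolP.
Qed.

Lemma gpiD u v : gpi (u + v) = gpi u + gpi v.
Proof. exact: raddfD. Qed.

Lemma gpi0 : gpi 0 = 0.
Proof. exact: raddf0. Qed.

Lemma gpiB u v : gpi (u - v) = gpi u - gpi v.
Proof. exact: raddfB. Qed.

Lemma gpi_sum (I : Type) (s : seq I) (F : I -> M) :
  gpi (\sum_(i <- s) F i) = \sum_(i <- s) gpi (F i).
Proof. by elim/big_rec2: _ => [|i y f _ <-]; rewrite ?gpi0 ?gpiD. Qed.

Lemma grepr_gpi u : S (grepr (gpi u) - u).
Proof. by apply/gpi_eq; rewrite greprK. Qed.

Definition gquot_act p (c : gquot_car) : gquot_car := gpi (p *: grepr c).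

Lemma gquot_act_gpi p u : gquot_act p (gpi u) = gpi (p *: u).
Proof. by apply/gpi_eq; rewrite -scalerBr; apply: gs_Z; apply: grepr_gpi. Qed.

Lemma gquot_actA p q c : gquot_act p (gquot_act q c) = gquot_act (p * q) c.
Proof. by rewrite -[c]greprK !gquot_act_gpi scalerA. Qed.
Lemma gquot_act1 : left_id 1 gquot_act.
Proof. by move=> c; rewrite -[c]greprK !gquot_act_gpi scale1r. Qed.
Lemma gquot_actDr : right_distributive gquot_act +%R.
Proof.
move=> p c d; rewrite -[c]greprK -[d]greprK -gpiD !gquot_act_gpi scalerDr.
exact: gpiD.
Qed.
Lemma gquot_actDl c : {morph gquot_act^~ c : p q / p + q}.
Proof.
by move=> p q; rewrite -[c]greprK !gquot_act_gpi scalerDl gpiD.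
Qed.

HB.instance Definition _ := GRing.Zmodule_isLmodule.Build {mpoly k[m]}
  gquot_car gquot_actA gquot_act1 gquot_actDr gquot_actDl.

Definition gquot_hom (j : int) (c : gquot_car) : Prop :=
  exists2 u : M, gm_hom j u & c = gpi u.

Lemma gquot_grading : is_grading gquot_hom.
Proof.
split=> [j|j _ _ [u Hu ->] [v Hv ->]|c|f s Us Hf S0 j js].
- by exists 0; [apply: gm_hom0 | rewrite gpi0].
- by exists (u - v); [apply: gm_homB | rewrite gpiB].
- have [s Hs E] := grad_span (gm_grading M) (grepr c).
  exists [seq gpi u | u <- s].
    by move=> _ /mapP[u /Hs[j Hj] ->]; exists j, u.
  by rewrite big_map -gpi_sum -E greprK.
have /choice[g Hg] : forall i, exists u, gm_hom i u /\ f i = gpi u.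
  by move=> i; have [u] := Hf i; exists u.
pose g' i := if i \in s then g i else 0.
have Hg' i : gm_hom i (g' i).
  by rewrite /g'; case: ifP => _; [case: (Hg i) | apply: gm_hom0].
have Es : \sum_(i <- s) g' i = \sum_(i <- s) g i.
  by apply: eq_big_seq => i; rewrite /g' => ->.
have SS : S (\sum_(i <- s) g' i).
  rewrite -[\sum_(i <- s) _]subr0; apply/gpi_eq; rewrite Es gpi_sum gpi0.
  by apply: etrans S0; apply: eq_bigr => i _; case: (Hg i).
have [t Ht Et] := gs_graded SS.
have [w [F [Uw HF F0 EF]]] :=
  grad_regroup (gm_grading M) (gs_0 S) (@gs_D _ _ _ S) Ht.
have E := grad_unique (gm_grading M) Us Uw Hg' (fun i => proj1 (HF i)) _ F0.
have [_ ->] := Hg j; rewrite -gpi0; apply/gpi_eq; rewrite subr0.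
have -> : g j = g' j by rewrite /g' js.
rewrite E; first by case: (HF j).
- by move=> i /negbTE si; rewrite /g' si.
- by rewrite Et.
Qed.

Lemma gquot_scale i j p c :
  phomog i p -> gquot_hom j c -> gquot_hom (i + j) (p *: c).
Proof.
move=> Hp [u Hu ->]; exists (p *: u); first exact: gm_scale.
exact: gquot_act_gpi.
Qed.

Definition gquot : gradedMod k m := GradedMod gquot_grading gquot_scale.

End SubQuot.

Section KerIm.
Variables (k : fieldType) (m : nat) (M N : gradedMod k m) (f : ghom M N).

Lemma gker_graded (v : M) : f v = 0 -> exists2 s : seq M,
  (forall u, u \in s -> f u = 0 /\ exists j, gm_hom j u) & v = \sum_(u <- s) u.
Proof.
have [s Hs ->] := grad_span (gm_grading M) v.
have [t [F [Ut HF _ ->]]] := @grad_regroup _ _ (gm_grading M) (fun=> True) s I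
  (fun _ _ _ _ => I) (fun u us => conj I (Hs u us)).
rewrite linear_sum => S0.
exists [seq F j | j <- t]; last by rewrite big_map.
move=> u /mapP[j jt ->]; split; last by exists j; case: (HF j).
apply: (grad_indep (gm_grading N) Ut _ S0 jt) => i.
by apply: gfun_deg; case: (HF i).
Qed.

Lemma gker_D u v : f u = 0 -> f v = 0 -> f (u + v) = 0.
Proof. by move=> fu fv; rewrite linearD /= fu fv addr0. Qed.
Lemma gker_Z p v : f v = 0 -> f (p *: v) = 0.
Proof. by move=> fv; rewrite linearZ /= fv scaler0. Qed.

Definition gker : gsubmod M :=
  @GSubmod k m M (fun v => f v = 0) (linear0 f) gker_D gker_Z gker_graded.

Lemma gim_graded (w : N) : (exists v, f v = w) -> exists2 s : seq N,
  (forall u, u \in s -> (exists v, f v = u) /\ exists j, gm_hom j u) &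
  w = \sum_(u <- s) u.
Proof.
case=> v <-; have [s Hs ->] := grad_span (gm_grading M) v.
exists [seq f u | u <- s]; last by rewrite big_map linear_sum.
move=> _ /mapP[u /Hs[j Hu] ->]; split; first by exists u.
by exists j; apply: gfun_deg.
Qed.

Lemma gim_0 : exists v, f v = 0. Proof. by exists 0; apply: linear0. Qed.
Lemma gim_D u v :
  (exists x, f x = u) -> (exists x, f x = v) -> exists x, f x = u + v.
Proof. by move=> [x <-] [y <-]; exists (x + y); apply: linearD. Qed.
Lemma gim_Z p v : (exists x, f x = v) -> exists x, f x = p *: v.
Proof. by move=> [x <-]; exists (p *: x); apply: linearZ. Qed.

Definition gim : gsubmod N :=
  @GSubmod k m N (fun w => exists v, f v = w) gim_0 gim_D gim_Z gim_graded.

End KerIm.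

Section Maps.
Variables (k : fieldType) (m : nat).
Implicit Types M N L : gradedMod k m.

Lemma gzero_lin M N : linear (fun _ : M => 0 : N).
Proof. by move=> p u v; rewrite scaler0 addr0. Qed.

Definition gzero M N : ghom M N :=
  GHom (@gzero_lin M N) (fun j _ _ => gm_hom0 N j).

Lemma gscale_lin M N (c : k) (f : ghom M N) : linear (fun v => c%:MP *: f v).
Proof. by move=> p u v; rewrite (gfun_lin f) scalerDr !scalerA mulrC. Qed.

Definition gscale M N (c : k) (f : ghom M N) : ghom M N :=
  GHom (gscale_lin c f) (fun j v Hv => gm_homC c (gfun_deg f Hv)).

Lemma gshift_map_deg M N (f : ghom M N) a j (v : gshift M a) :
  gm_hom j v -> gm_hom j (f v : gshift N a).
Proof. exact: (@gfun_deg _ _ M N f (j + a) v). Qed.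

Definition gshift_map M N (f : ghom M N) a : ghom (gshift M a) (gshift N a) :=
  @GHom _ _ (gshift M a) (gshift N a) f (gfun_lin f) (@gshift_map_deg M N f a).

Lemma gHom_pre_lin M N L (f : ghom M N) :
  linear (gmap_precomp f : gHom N L -> gHom M L).
Proof. by move=> p u v; apply: gmapE. Qed.

Lemma gHom_pre_deg M N L (f : ghom M N) j (g : gHom N L) :
  gm_hom j g -> gm_hom j (gmap_precomp f g : gHom M L).
Proof. by move=> Hg i v Hv; apply: Hg; apply: gfun_deg. Qed.

Definition gHom_pre M N L (f : ghom M N) : ghom (gHom N L) (gHom M L) :=
  GHom (@gHom_pre_lin M N L f) (@gHom_pre_deg M N L f).

Lemma gHom_post_lin M N L (f : ghom N L) :
  linear (gmap_postcomp f : gHom M N -> gHom M L).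
Proof. by move=> p u v; apply: gmapE => x; apply: (gfun_lin f). Qed.

Lemma gHom_post_deg M N L (f : ghom N L) j (g : gHom M N) :
  gm_hom j g -> gm_hom j (gmap_postcomp f g : gHom M L).
Proof. by move=> Hg i v Hv; apply: gfun_deg; apply: Hg. Qed.

Definition gHom_post M N L (f : ghom N L) : ghom (gHom M N) (gHom M L) :=
  GHom (@gHom_post_lin M N L f) (@gHom_post_deg M N L f).

Section SubQuotMaps.
Variables (M N : gradedMod k m) (f : ghom M N) (S : gsubmod M) (T : gsubmod N).
Hypothesis ST : forall v, S v -> T (f v).

Definition gsub_map_fun (u : gsub S) : gsub T := mk_gsub (ST (gsub_valP u)).

Lemma gsub_map_lin : linear gsub_map_fun.
Proof. by move=> p u v; apply: val_inj; apply: (gfun_lin f). Qed.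

Definition gsub_map : ghom (gsub S) (gsub T) :=
  @GHom _ _ (gsub S) (gsub T) gsub_map_fun gsub_map_lin
    (fun j u Hu => gfun_deg f Hu).

Definition gquot_map_fun (c : gquot S) : gquot T := gpi T (f (grepr c)).

Lemma gquot_map_gpi u : gquot_map_fun (gpi S u) = gpi T (f u).
Proof. by apply/gpi_eq; rewrite -linearB; apply: ST; apply: grepr_gpi. Qed.

Lemma gquot_map_lin : linear gquot_map_fun.
Proof.
move=> p c d; rewrite -[c]greprK -[d]greprK.
have -> : p *: (gpi S (grepr c) : gquot S) + gpi S (grepr d) =
    gpi S (p *: grepr c + grepr d).
  by rewrite gpiD; congr (_ + _); apply: gquot_act_gpi.
rewrite !gquot_map_gpi (gfun_lin f) gpiD; congr (_ + _).
by apply/esym; apply: gquot_act_gpi.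
Qed.

Lemma gquot_map_deg j (c : gquot S) : gm_hom j c -> gm_hom j (gquot_map_fun c).
Proof.
case=> u Hu ->; exists (f u); first exact: gfun_deg.
exact: gquot_map_gpi.
Qed.

Definition gquot_map : ghom (gquot S) (gquot T) :=
  GHom gquot_map_lin gquot_map_deg.

End SubQuotMaps.

Section Corestriction.
Variables (M N : gradedMod k m) (f : ghom M N) (T : gsubmod N).
Hypothesis fT : forall v, T (f v).

Definition gcorestr_fun (v : M) : gsub T := mk_gsub (fT v).

Lemma gcorestr_lin : linear gcorestr_fun.
Proof. by move=> p u v; apply: val_inj; apply: (gfun_lin f). Qed.

Definition gcorestr : ghom M (gsub T) :=
  @GHom _ _ M (gsub T) gcorestr_fun gcorestr_lin (fun j v Hv => gfun_deg f Hv).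

End Corestriction.

End Maps.

Section CoHomMap.
Variables (k : fieldType) (m m' : nat) (h : 'I_m -> 'I_m').
Variables (M N : gradedMod k m') (L : gradedMod k m) (f : ghom M N).

Definition coHom_map_fun (g : coHom h N L) : coHom h M L :=
  gmap_precomp (restr_map h f) (g : gmap (restr h N) L).

Lemma coHom_map_lin : linear coHom_map_fun.
Proof.
move=> p u v; apply: gmapE => x.
change ((u : gmap (restr h N) L) (p *: f x) + (v : gmap (restr h N) L) (f x) =
  (u : gmap (restr h N) L) (f (p *: (x : M))) + (v : gmap (restr h N) L) (f x)).
by rewrite linearZ.
Qed.

Lemma coHom_map_deg j (g : coHom h N L) :
  gm_hom j g -> gm_hom j (coHom_map_fun g).
Proof. by move=> Hg i v Hv; apply: Hg; apply: (gfun_deg f). Qed.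

Definition coHom_map : ghom (coHom h N L) (coHom h M L) :=
  GHom coHom_map_lin coHom_map_deg.

End CoHomMap.

(* The differential is given between any two degrees, and is 0 unless it raises
   the degree by 1; this avoids transports along equalities of degrees. *)
Record gcomplex (k : fieldType) (m : nat) := GComplex {
  cx_obj :> int -> gradedMod k m;
  cx_d : forall p q : int, ghom (cx_obj p) (cx_obj q);
  cx_shape : forall p q : int, q != p + 1 -> forall v, cx_d p q v = 0;
  cx_dd : forall (p q r : int) v, cx_d q r (cx_d p q v) = 0 }.

Definition cx_bounded (k : fieldType) (m : nat) (X : gcomplex k m) : Prop :=
  exists b : nat, forall p : int, b%:Z < `|p| -> forall v : X p, v = 0.

Definition cx_iso (k : fieldType) (m : nat) (X Y : gcomplex k m) : Prop :=
  exists f : forall p : int, ghom (X p) (Y p),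
    (forall p, bijective (f p)) /\
    (forall p q v, f q (cx_d X p q v) = cx_d Y p q (f p v)).

Section Covariant.
Variables (k : fieldType) (m m' : nat) (F : gradedMod k m -> gradedMod k m').
Variable Fmap : forall M N, ghom M N -> ghom (F M) (F N).
Hypothesis Fmap0 : forall M N (f : ghom M N),
  (forall v, f v = 0) -> forall w, Fmap f w = 0.
Hypothesis Fmap00 : forall M N L (f : ghom M N) (g : ghom N L),
  (forall v, g (f v) = 0) -> forall w, Fmap g (Fmap f w) = 0.

Definition cx_map (X : gcomplex k m) : gcomplex k m' :=
  @GComplex k m' (fun p => F (X p)) (fun p q => Fmap (cx_d X p q))
    (fun p q pq => Fmap0 (@cx_shape _ _ X p q pq))
    (fun p q r => Fmap00 (@cx_dd _ _ X p q r)).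

End Covariant.

(* In degree p this is F (X^(-p)); the differential has the usual sign
   (-1)^(p+1) of the differential of a Hom complex. *)
Section Contravariant.
Variables (k : fieldType) (m m' : nat) (F : gradedMod k m -> gradedMod k m').
Variable Fmap : forall M N, ghom M N -> ghom (F N) (F M).
Hypothesis Fmap0 : forall M N (f : ghom M N),
  (forall v, f v = 0) -> forall w, Fmap f w = 0.
Hypothesis Fmap00 : forall M N L (f : ghom M N) (g : ghom N L),
  (forall v, g (f v) = 0) -> forall w, Fmap f (Fmap g w) = 0.
Variable X : gcomplex k m.

Definition cx_op_d (p q : int) : ghom (F (X (- p))) (F (X (- q))) :=
  gscale ((-1) ^ (p + 1)) (Fmap (cx_d X (- q) (- p))).

Lemma cx_op_shape (p q : int) : q != p + 1 -> forall v, cx_op_d p q v = 0.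
Proof.
move=> pq v; rewrite /= Fmap0 ?scaler0 //; apply: cx_shape.
by apply: contra pq => /eqP E; rewrite -[q]opprK -[p]opprK E opprD opprK subrK.
Qed.

Lemma cx_op_dd (p q r : int) v : cx_op_d q r (cx_op_d p q v) = 0.
Proof. by rewrite /= linearZ /= Fmap00 ?scaler0 //; apply: cx_dd. Qed.

Definition cx_op : gcomplex k m' := GComplex cx_op_shape cx_op_dd.

End Contravariant.

Section ModuleDual.
Variables (k : fieldType) (n : nat).

Definition mdual (Y : gradedMod k n) : gradedMod k n := gHom Y (greg k n).

Definition mdual_map (Y Z : gradedMod k n) (f : ghom Y Z) :
  ghom (mdual Z) (mdual Y) := gHom_pre (greg k n) f.

Lemma mdual_map0 Y Z (f : ghom Y Z) :
  (forall v, f v = 0) -> forall w, mdual_map f w = 0.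
Proof. by move=> f0 w; apply: gmapE => v /=; rewrite f0 linear0. Qed.

Lemma mdual_map00 Y Z W (f : ghom Y Z) (g : ghom Z W) :
  (forall v, g (f v) = 0) -> forall w, mdual_map f (mdual_map g w) = 0.
Proof. by move=> gf0 w; apply: gmapE => v /=; rewrite gf0 linear0. Qed.

Definition mdual_cx : gcomplex k n -> gcomplex k n :=
  cx_op mdual_map0 mdual_map00.

End ModuleDual.

(* Graded (R,R)-bimodules, R = k[x_1..x_n], on which k acts symmetrically, are
   graded modules over R (x)_k R, which is the polynomial ring on 2n variables:
   the first n of them act by the left action of the x_i and the last n of them
   by the right action. *)
Definition gbimod (k : fieldType) (n : nat) := gradedMod k (n + n).

Section Bimodules.
Variables (k : fieldType) (n : nat).
Implicit Types M N T : gbimod k n.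

Definition lact M (p : {mpoly k[n]}) (v : M) : M := ren (@lshift n n) p *: v.
Definition ract M (v : M) (p : {mpoly k[n]}) : M := ren (@rshift n n) p *: v.

Definition diagv (i : 'I_(n + n)) : 'I_n :=
  match fintype.split i with inl j => j | inr j => j end.
Definition swapv (i : 'I_(n + n)) : 'I_(n + n) :=
  match fintype.split i with inl j => rshift n j | inr j => lshift n j end.

Definition Rbim : gbimod k n := restr diagv (greg k n).

(* T, with the pairing t, is the tensor product of M and N over the subring of R
   of elements satisfying S. *)
Record is_tensor_over (S : {mpoly k[n]} -> Prop) M N T (t : M -> N -> T) : Prop := {
  tens_Dl : forall u u' v, t (u + u') v = t u v + t u' v;
  tens_Dr : forall u v v', t u (v + v') = t u v + t u v';
  tens_bal : forall p u v, S p -> t (ract u p) v = t u (lact p v);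
  tens_l : forall p u v, t (lact p u) v = lact p (t u v);
  tens_r : forall p u v, t u (ract v p) = ract (t u v) p;
  tens_deg : forall i j u v, gm_hom i u -> gm_hom j v -> gm_hom (i + j) (t u v);
  tens_univ : forall (Z : zmodType) (g : M -> N -> Z),
    (forall u u' v, g (u + u') v = g u v + g u' v) ->
    (forall u v v', g u (v + v') = g u v + g u v') ->
    (forall p u v, S p -> g (ract u p) v = g u (lact p v)) ->
    exists2 h : {additive T -> Z}, (forall u v, h (t u v) = g u v) &
      forall h' : {additive T -> Z}, (forall u v, h' (t u v) = g u v) -> h' =1 h }.

Definition tensor_over (S : {mpoly k[n]} -> Prop) M N T : Prop :=
  exists t : M -> N -> T, is_tensor_over S t.

(* polynomials symmetric in x_i, x_j *)
Definition sym2 (i j : 'I_n) (p : {mpoly k[n]}) : Prop := msym (tperm i j) p = p.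

(* Tensor products are only given up to isomorphism, and SBim is closed under
   isomorphism, by SBim_summand with N' = 0. *)
Inductive SBim : gbimod k n -> Prop :=
| SBim_R : SBim Rbim
| SBim_B (i j : 'I_n) T : j = i.+1 :> nat ->
    tensor_over (sym2 i j) Rbim Rbim T -> SBim (gshift T 1)
| SBim_sum M N : SBim M -> SBim N -> SBim (gsum M N)
| SBim_tensor M N T : SBim M -> SBim N ->
    tensor_over (fun _ => True) M N T -> SBim T
| SBim_shift M a : SBim M -> SBim (gshift M a)
| SBim_summand M N N' : SBim M -> gm_iso M (gsum N N') -> SBim N.

(* M^vee = Hom_{-R}(M, R), the right action on M being that of the last n
   variables. In coHom, q (x) 1 and 1 (x) q act on phi by precomposition with the
   left and with the right action of q. The bimodule structure
   (a phi b)(v) = a phi(b v) = phi(b v a) is obtained from this one by exchanging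
   the two groups of variables. *)
Definition bdual M : gbimod k n :=
  restr swapv (coHom (@rshift n n) M (greg k n)).

Definition bdual_map M N (f : ghom M N) : ghom (bdual N) (bdual M) :=
  restr_map swapv (coHom_map (@rshift n n) (greg k n) f).

Lemma split_lshift (i : 'I_n) : fintype.split (lshift n i) = inl i.
Proof. exact: (unsplitK (inl i)). Qed.

Lemma split_rshift (i : 'I_n) : fintype.split (rshift n i) = inr i.
Proof. exact: (unsplitK (inr i)). Qed.

Lemma ren_ext m1 m2 (h h' : 'I_m1 -> 'I_m2) (p : {mpoly k[m1]}) :
  h =1 h' -> ren h p = ren h' p.
Proof. by move=> E; rewrite (funext E). Qed.

Lemma ren_comp m1 m2 m3 (h : 'I_m1 -> 'I_m2) (h' : 'I_m2 -> 'I_m3)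
    (p : {mpoly k[m1]}) : ren h' (ren h p) = ren (h' \o h) p.
Proof.
rewrite {2 3}/ren !(comp_mpolyEX p) (raddf_sum (ren h')).
apply: eq_bigr => mm _; rewrite /= {1}/ren comp_mpolyZ; congr (_ *: _).
rewrite !comp_mpolyX -/(ren h' _) (rmorph_prod (ren h')).
apply: eq_bigr => i _; rewrite (rmorphXn (ren h')) /= !tnth_mktuple.
by rewrite /ren comp_mpolyXU -tnth_nth tnth_mktuple.
Qed.

Lemma Rbim_lact (p : {mpoly k[n]}) (r : Rbim) :
  lact p r = (p : {mpoly k[n]}) * (r : {mpoly k[n]}).
Proof.
change (ren diagv (ren (@lshift n n) p) * (r : {mpoly k[n]}) = p * (r : {mpoly k[n]})).
rewrite ren_comp (@ren_ext _ _ _ id) ?/ren ?comp_mpoly_id // => i.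
by rewrite /= /diagv split_lshift.
Qed.

Lemma Rbim_ract (p : {mpoly k[n]}) (r : Rbim) :
  ract r p = (r : {mpoly k[n]}) * (p : {mpoly k[n]}).
Proof.
rewrite mulrC.
change (ren diagv (ren (@rshift n n) p) * (r : {mpoly k[n]}) = p * (r : {mpoly k[n]})).
rewrite ren_comp (@ren_ext _ _ _ id) ?/ren ?comp_mpoly_id // => i.
by rewrite /= /diagv split_rshift.
Qed.

Definition bdual_app M (phi : bdual M) (v : M) : {mpoly k[n]} :=
  (phi : gmap (restr (@rshift n n) M) (greg k n)) v.

Lemma bdual_appE M (phi : bdual M) a b v :
  bdual_app (lact a (ract phi b)) v = a * bdual_app phi (lact b v).
Proof.
change (bdual_app phi (ren swapv (ren (@rshift n n) b) *:
  (ren swapv (ren (@lshift n n) a) *: v)) = a * bdual_app phi (lact b v)).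
rewrite !ren_comp (@ren_ext _ _ _ (@lshift n n)); last first.
  by move=> i; rewrite /= /swapv split_rshift.
rewrite (@ren_ext _ _ (swapv \o _) (@rshift n n)); last first.
  by move=> i; rewrite /= /swapv split_lshift.
have -> : ren (@lshift n n) b *: (ren (@rshift n n) a *: v) =
    ren (@rshift n n) a *: (ren (@lshift n n) b *: v) by rewrite !scalerA mulrC.
exact: (linearZ_LR (phi : gmap (restr (@rshift n n) M) (greg k n))).
Qed.

Lemma bdual_map0 M N (f : ghom M N) :
  (forall v, f v = 0) -> forall w, bdual_map f w = 0.
Proof.
move=> f0 w; apply: gmapE => v /=; rewrite f0.
exact: (linear0 (w : gmap (restr (@rshift n n) N) (greg k n))).
Qed.

Lemma bdual_map00 M N L (f : ghom M N) (g : ghom N L) :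
  (forall v, g (f v) = 0) -> forall w, bdual_map f (bdual_map g w) = 0.
Proof.
move=> gf0 w; apply: gmapE => v /=; rewrite gf0.
exact: (linear0 (w : gmap (restr (@rshift n n) L) (greg k n))).
Qed.

Definition bdual_cx : gcomplex k (n + n) -> gcomplex k (n + n) :=
  cx_op bdual_map0 bdual_map00.

End Bimodules.

Definition gprojective (k : fieldType) (m : nat) (P : gradedMod k m) : Prop :=
  forall (M N : gradedMod k m) (g : ghom M N) (f : ghom P N),
    (forall y, exists x, g x = y) ->
    exists f' : ghom P M, forall x, g (f' x) = f x.

Record gprojres (k : fieldType) (m : nat) (A : gradedMod k m) := GProjRes {
  pr_obj :> nat -> gradedMod k m;
  pr_d : forall i, ghom (pr_obj i.+1) (pr_obj i);
  pr_aug : ghom (pr_obj 0%N) A;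
  pr_proj : forall i, gprojective (pr_obj i);
  pr_surj : forall a, exists x, pr_aug x = a;
  pr_exact0 : forall x, pr_aug x = 0 <-> exists y, pr_d 0%N y = x;
  pr_exact : forall i x, pr_d i x = 0 <-> exists y, pr_d i.+1 y = x }.

Section Ext.
Variables (k : fieldType) (m : nat) (A : gradedMod k m) (P : gprojres A).
Implicit Types M N L : gradedMod k m.

Definition coch (i : nat) M : gradedMod k m := gHom (P i) M.
Definition coch_d i M : ghom (coch i M) (coch i.+1 M) := gHom_pre M (pr_d P i).
Definition coch_map i M N (f : ghom M N) : ghom (coch i M) (coch i N) :=
  gHom_post (P i) f.

Definition cocycles i M : gsubmod (coch i M) := gker (coch_d i M).

Lemma coch_dd i M c : cocycles i.+1 M (coch_d i M c).
Proof.
apply: gmapE => x /=.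
have -> : pr_d P i (pr_d P i.+1 x) = 0 by apply/pr_exact; exists x.
exact: linear0.
Qed.

Definition coboundaries i M : gsubmod (gsub (cocycles i M)) :=
  match i with
  | 0%N => gim (gzero (gsub (cocycles 0 M)) (gsub (cocycles 0 M)))
  | j.+1 => gim (gcorestr (coch_dd (i := j) (M := M)))
  end.

(* Graded Ext^i(A, M), calculated with the resolution P of A; its part of degree
   j consists of the classes of maps from P i to M of degree j. *)
Definition Ext i M : gradedMod k m := gquot (coboundaries i M).

Lemma coch_map_cocycles i M N (f : ghom M N) c :
  cocycles i M c -> cocycles i N (coch_map i f c).
Proof.
move=> dc; apply: gmapE => x /=.
have -> : (c : gmap _ _) (pr_d P i x) = 0.
  by move/(congr1 (fun g : gmap (P i.+1) M => g x)): dc.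
exact: linear0.
Qed.

Definition cocycles_map i M N (f : ghom M N) :
  ghom (gsub (cocycles i M)) (gsub (cocycles i N)) :=
  gsub_map (@coch_map_cocycles i M N f).

Lemma cocycles_map_coboundaries i M N (f : ghom M N) z :
  coboundaries i M z -> coboundaries i N (cocycles_map i f z).
Proof.
case: i z => [|i] z [y <-].
  by exists 0; apply/esym; apply: linear0.
by exists (coch_map i f y); apply: val_inj; apply: gmapE.
Qed.

Definition Ext_map i M N (f : ghom M N) : ghom (Ext i M) (Ext i N) :=
  gquot_map (@cocycles_map_coboundaries i M N f).

Lemma Ext_map0 i M N (f : ghom M N) :
  (forall v, f v = 0) -> forall w, Ext_map i f w = 0.
Proof.
move=> f0 w; rewrite -[RHS]gpi0; congr (gpi _ _).
by apply: val_inj; apply: gmapE => x; apply: f0.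
Qed.

Lemma Ext_map00 i M N L (f : ghom M N) (g : ghom N L) :
  (forall v, g (f v) = 0) -> forall w, Ext_map i g (Ext_map i f w) = 0.
Proof.
move=> gf0 w; rewrite [Ext_map i g _](gquot_map_gpi (@cocycles_map_coboundaries i N L g)).
rewrite -[RHS]gpi0; congr (gpi _ _).
by apply: val_inj; apply: gmapE => x; apply: gf0.
Qed.

End Ext.

Section Hochschild.
Variables (k : fieldType) (n : nat) (P : gprojres (Rbim k n)).

(* HH^i(M), with R acting through the left action on M *)
Definition HH (i : nat) (M : gbimod k n) : gradedMod k n :=
  restr (@lshift n n) (Ext P i M).

Definition HHt (i : nat) (M : gbimod k n) : gradedMod k n :=
  gshift (HH i M) (- (2 * i)%:Z).

Definition HHt_map i (M N : gbimod k n) (f : ghom M N) : ghom (HHt i M) (HHt i N) :=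
  gshift_map (restr_map (@lshift n n) (Ext_map P i f)) (- (2 * i)%:Z).

Lemma HHt_map0 i M N (f : ghom M N) :
  (forall v, f v = 0) -> forall w, HHt_map i f w = 0.
Proof. exact: Ext_map0. Qed.

Lemma HHt_map00 i M N L (f : ghom M N) (g : ghom N L) :
  (forall v, g (f v) = 0) -> forall w, HHt_map i g (HHt_map i f w) = 0.
Proof. exact: Ext_map00. Qed.

Definition HHt_cx (i : nat) : gcomplex k (n + n) -> gcomplex k n :=
  cx_map (@HHt_map0 i) (@HHt_map00 i).

End Hochschild.

(* Main.v *)
Require Import Defs.
From HB Require Import structures.
From mathcomp Require Import all_boot all_order all_algebra.
From mathcomp Require Import boolp perm fingroup functions.
From mathcomp Require Import mpoly zify ring.

Set Implicit Arguments.
Unset Strict Implicit.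
Unset Printing Implicit Defensive.

Import GRing.Theory.
Local Open Scope ring_scope.

(** Write R for the polynomial ring, y_i for a variable acting on the right and X_i
    for the same variable acting on the left. A bimodule M is a right R-module with
    commuting linear operators X_0, X_1, .., and the differences X_i - y_i define a
    Koszul complex K(M) of right R-modules. As these differences are a regular sequence
    in the polynomial ring on 2n variables (W_exact), K(M) computes the Hochschild
    cohomology of M from the Koszul resolution of R (Qres), and by the comparison
    theorem from any other projective resolution (chain_map_exists, kap_lam, lam_kapS).
    A Koszul complex is self-dual: the dual of K(M) as a complex of right R-modules is
    K(M^vee) with the degrees j and n - j exchanged, by the pairing beta (beta_D,
    beta_exists, beta_ext). The left and the right action of R agree on cohomology, by
    contraction (beta_left_right). So the theorem says that passing to cohomology
    commutes with the duality of R-modules.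

    This fails for most bimodules, but it holds if K(M) splits, that is, if its
    differential D satisfies D h D = D for some right-linear h: then 1 - D h maps
    any functional to one that vanishes on coboundaries, and classes of cocycles are
    paired perfectly (dual_inj, dual_surj). The heart of the proof is that
    K(M) splits for every Soergel bimodule (SBim_split).

    Splitting passes to direct sums and direct summands, so M may be replaced by a word
    in the functors F_i = B_i (x) -, up to shifts, applied to R (SBim_good). The relations
    F_i F_i = F_i + F_i, the commutation of distant functors and the braid relation,
    up to direct summands, reduce to words in which the largest letter occurs at
    most once (reduce_word), as in the construction of the Markov trace on the Hecke
    algebra. The proof is then by induction on the number of variables (split_word).
    If the letter that involves the last variable does not occur, this variable
    acts in the same way on both sides, and the complex is doubled (split_S). If it
    occurs once, in F_u F_c F_v R, then multiplication by the last difference on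
    F_c F_v R has kernel and cokernel F_v R, and the Koszul complex is
    homotopy equivalent to two copies of that of F_u F_v R (split_cone).

    The pairing is natural in M (ev2_nat). Dualising a complex twice introduces two
    signs in the differential, and the isomorphism in degree p is multiplied by (-1)^p
    to compensate for them (HHt_cx_dual). *)

(** * Sums of commuting operators *)

(** A reflexive decision procedure for equalities between sums of monomials in
    commuting additive operators. Operators are sorted in each monomial, and
    sums are compared as multisets of monomials. *)
Section AbelianSolver.
Variables (V : zmodType) (op : nat -> V -> V).
Hypothesis opD : forall i u v, op i (u + v) = op i u + op i v.
Hypothesis opN : forall i u, op i (- u) = - op i u.
Hypothesis opC : forall i j u, op i (op j u) = op j (op i u).

Inductive aterm := AVar of nat | AZero | AAdd of aterm & aterm | AOpp of aterm
  | AOp of nat & aterm.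

Variable env : nat -> V.

Fixpoint aeval t := match t with
  | AVar i => env i
  | AZero => 0
  | AAdd a b => aeval a + aeval b
  | AOpp a => - aeval a
  | AOp i a => op i (aeval a)
  end.

Definition meval (m : nat * seq nat) : V := foldr op (env m.1) m.2.

Fixpoint insert_op (i : nat) (s : seq nat) : seq nat :=
  if s is j :: s' then if (i <= j)%N then i :: s else j :: insert_op i s' else [:: i].

Definition mop i (m : nat * seq nat) := (m.1, insert_op i m.2).

(** The monomials with coefficient 1 and those with coefficient -1 are kept in two lists,
    so that coefficients are not needed. *)
Fixpoint anorm t : seq (nat * seq nat) * seq (nat * seq nat) := match t with
  | AVar i => ([:: (i, [::])], [::])
  | AZero => ([::], [::])
  | AAdd a b => let p := anorm a in let q := anorm b in (p.1 ++ q.1, p.2 ++ q.2)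
  | AOpp a => let p := anorm a in (p.2, p.1)
  | AOp i a => let p := anorm a in (map (mop i) p.1, map (mop i) p.2)
  end.

Lemma meval_op i m : meval (mop i m) = op i (meval m).
Proof.
case: m => v s; rewrite /meval /mop /=; elim: s => //= j s IHs.
by case: ifP => //= _; rewrite IHs opC.
Qed.

Lemma op0 i : op i 0 = 0.
Proof. by apply: (addrI (op i 0)); rewrite -opD !addr0. Qed.

Lemma sum_mop i s : \sum_(m <- map (mop i) s) meval m = op i (\sum_(m <- s) meval m).
Proof.
rewrite big_map; elim: s => [|m s IHs]; first by rewrite !big_nil op0.
by rewrite !big_cons opD IHs meval_op.
Qed.

Lemma anormP t :
  aeval t = \sum_(m <- (anorm t).1) meval m - \sum_(m <- (anorm t).2) meval m.
Proof.
elim: t => [i||a IHa b IHb|a IHa|i a IHa] /=.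
- by rewrite big_seq1 big_nil subr0.
- by rewrite big_nil subr0.
- by rewrite !big_cat opprD /= addrACA IHa IHb.
- by rewrite IHa opprB.
- by rewrite !sum_mop IHa opD opN.
Qed.

Lemma aterm_eq t u :
  perm_eq ((anorm t).1 ++ (anorm u).2) ((anorm u).1 ++ (anorm t).2) ->
  aeval t = aeval u.
Proof.
move=> E; rewrite !anormP; apply/eqP; rewrite subr_eq addrAC eq_sym subr_eq eq_sym.
by rewrite -!big_cat; apply/eqP/perm_big.
Qed.

End AbelianSolver.

(** * Right modules with commuting operators *)

Definition mklin (A : pzRingType) (V W : lmodType A) (f : V -> W) (fL : linear f) :
  {linear V -> W} := HB.pack f (GRing.isLinear.Build A V W _ f fL).

Section ScaleMap.
Variables (A : comPzRingType) (V : lmodType A) (a : A).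

Lemma scl_lin : linear (fun v : V => a *: v).
Proof. by move=> b u v; rewrite scalerDr !scalerA mulrC. Qed.

Definition scl : {linear V -> V} := mklin scl_lin.
End ScaleMap.

Section OpMod.
Variables (A : comPzRingType).

(** The scalars are the right action of R, and om_X i is the left action of the i-th
    variable. Indexing by all natural numbers avoids casts between numbers of variables. *)
Record opmod := OpMod {
  om_car :> lmodType A;
  om_X : nat -> {linear om_car -> om_car};
  om_C : forall i j v, om_X i (om_X j v) = om_X j (om_X i v) }.

End OpMod.
Arguments om_X {A V} i : rename.

Ltac amem x l := lazymatch l with
  | @nil _ => constr:(false) | x :: _ => constr:(true) | _ :: ?l' => amem x l' end.
Ltac aindex x l := lazymatch l with
  | x :: _ => constr:(O) | _ :: ?l' => let n := aindex x l' in constr:(S n) end.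
Ltac sindex c l := lazymatch l with
  | scl _ c :: _ => constr:(O) | _ :: ?l' => let n := sindex c l' in constr:(S n) end.
Ltac avars ops l t := lazymatch t with
  | (?a + ?b)%R => let l1 := avars ops l a in avars ops l1 b
  | (- ?a)%R => avars ops l a
  | 0%R => l
  | @GRing.scale _ _ ?c ?a => avars ops l a
  | @GRing.Linear.sort _ _ _ _ ?f ?a => avars ops l a
  | _ => lazymatch amem t l with true => l | false => constr:(t :: l) end
  end.
Ltac aquote ops l t := lazymatch t with
  | (?a + ?b)%R => let a1 := aquote ops l a in let b1 := aquote ops l b in constr:(AAdd a1 b1)
  | (- ?a)%R => let a1 := aquote ops l a in constr:(AOpp a1)
  | 0%R => constr:(AZero)
  | @GRing.scale _ _ ?c ?a =>
     let i := sindex c ops in let a1 := aquote ops l a in constr:(AOp i a1)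
  | @GRing.Linear.sort _ _ _ _ ?f ?a =>
     let i := aindex f ops in let a1 := aquote ops l a in constr:(AOp i a1)
  | _ => let i := aindex t l in constr:(AVar i)
  end.
Ltac asolve V op ops H1 H2 H3 := lazymatch goal with |- ?t = ?u =>
  let l0 := avars ops (@nil V) t in
  let l := avars ops l0 u in
  let t1 := aquote ops l t in
  let u1 := aquote ops l u in
  exact: (@aterm_eq V op H1 H2 H3 (fun i => nth (0 : V) l i) t1 u1 isT)
  end.

Definition opn (A : comPzRingType) (V : lmodType A) (ops : seq {linear V -> V}) i : {linear V -> V} :=
  nth (idfun : {linear V -> V}) ops i.

(** Proves equalities of sums built with the commuting linear operators ops of V. *)
Ltac alin V ops :=
  let H3 := fresh in
  pose proof (H3 := (ltac:(case=> [|[|[|[|?]]]]; case=> [|[|[|[|?]]]] *; rewrite /opn /= ?nth_nil /=;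
      rewrite ?linearZ_LR //=; exact: om_C) :
    forall i j (u : V), opn ops i (opn ops j u) = opn ops j (opn ops i u)));
  asolve V (fun i => opn ops i : V -> V) ops
    (fun i => linearD (opn ops i)) (fun i => linearN (opn ops i)) H3.

Lemma opX_C (A : comPzRingType) (V : opmod A) (js : seq nat) i j (u : V) :
  opn [seq om_X l | l <- js] i (opn [seq om_X l | l <- js] j u) =
  opn [seq om_X l | l <- js] j (opn [seq om_X l | l <- js] i u).
Proof.
rewrite /opn; elim: js i j => [|l js IHjs] [|i] [|j] //=.
  by elim: js j {IHjs} => [|l' js IHjs] [|j] //=; exact: om_C.
by elim: js i {IHjs} => [|l' js IHjs] [|i] //=; exact: om_C.
Qed.

(** The same, the operators being the om_X j for j in the list js. *)
Ltac alinX V js :=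
  let ops := eval cbn [map] in [seq @om_X _ V l | l <- js] in
  asolve (om_car V) (fun i => opn ops i : V -> V) ops
    (fun i => linearD (opn ops i)) (fun i => linearN (opn ops i)) (@opX_C _ V js).

(** Fi i V is R (x) V, the tensor product being over the polynomials symmetric in x_i and
    x_(i+1). Over these R is free with basis 1, x_i, and (v0, v1) stands for
    1 (x) v0 + x_i (x) v1. The formulas follow from x_i^2 = e1 x_i - e2 and
    x_(i+1) = e1 - x_i, where e1 = x_i + x_(i+1) and e2 = x_i x_(i+1) act on V. *)
Section F.
Variables (A : comPzRingType).
Local Notation opmod := (opmod A).
Variables (i : nat) (V : opmod).
Local Notation X := (@om_X _ V).

Definition FX_fun (j : nat) (w : (V * V)%type) : (V * V)%type :=
  if j == i then (- X i (X i.+1 w.2), w.1 + X i w.2 + X i.+1 w.2)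
  else if j == i.+1 then (X i w.1 + X i.+1 w.1 + X i (X i.+1 w.2), - w.1)
  else (X j w.1, X j w.2).

Lemma FX_lin j : linear (FX_fun j).
Proof.
move=> a [u0 u1] [v0 v1]; rewrite /FX_fun.
case: ifP => _; last case: ifP => _; congr (_, _); rewrite /= ?linearP //=;
 by alin (om_car V) [:: scl V a; X i; X i.+1].
Qed.
Definition FX j : {linear (V * V)%type -> (V * V)%type} := mklin (FX_lin j).

Lemma FX_C j l w : FX j (FX l w) = FX l (FX j w).
Proof.
case: w => w0 w1; rewrite /= /FX_fun.
case: (j == i); case: (j == i.+1); case: (l == i); case: (l == i.+1) => /=;
  congr (_, _);
  by alinX V [:: j; l; i; i.+1].
Qed.

Definition Fi : opmod := OpMod FX_C.

Lemma FiX1 (w : Fi) :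
  om_X i.+1 w = (X i w.1 + X i.+1 w.1 + X i (X i.+1 w.2), - w.1) :> (V * V)%type.
Proof. by rewrite /= /FX_fun gtn_eqF // eqxx. Qed.

End F.

Section PairE.
Variables (U V : zmodType).
Implicit Types u v : (U * V)%type.
Lemma addp1 u v : (u + v).1 = u.1 + v.1. Proof. by []. Qed.
Lemma addp2 u v : (u + v).2 = u.2 + v.2. Proof. by []. Qed.
Lemma oppp1 u : (- u).1 = - u.1. Proof. by []. Qed.
Lemma oppp2 u : (- u).2 = - u.2. Proof. by []. Qed.
End PairE.
Definition pairE := (addp1, addp2, oppp1, oppp2).

Section OpSum.
Variables (A : comPzRingType) (V W : opmod A).

Definition osum_fun j (w : (V * W)%type) : (V * W)%type := (om_X j w.1, om_X j w.2).

Lemma osum_lin j : linear (osum_fun j).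
Proof. by move=> a u v; congr (_, _); rewrite /= linearP. Qed.

Lemma osum_C j l w : mklin (osum_lin j) (mklin (osum_lin l) w) =
  mklin (osum_lin l) (mklin (osum_lin j) w).
Proof. by congr (_, _); rewrite /= om_C. Qed.

Definition osum : opmod A := OpMod osum_C.
End OpSum.

Definition oequiv (A : comPzRingType) (V W : opmod A) (f : V -> W) :=
  forall j v, f (om_X j v) = om_X j (f v).

Definition retr (A : comPzRingType) (V W : opmod A) :=
  exists (f : {linear V -> W}) (g : {linear W -> V}), [/\ oequiv f, oequiv g & cancel f g].

(** The closure of a class of modules under direct sums and retracts. *)
Inductive gen (A : comPzRingType) (C : opmod A -> Prop) : opmod A -> Prop :=
| gen_base V : C V -> gen C V
| gen_sum V W : gen C V -> gen C W -> gen C (osum V W)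
| gen_retr V W : retr V W -> gen C W -> gen C V.

Section Retracts.
Variable (A : comPzRingType).
Implicit Types (U V W : opmod A) (C : opmod A -> Prop).

Lemma retr_intro V W (f : V -> W) (g : W -> V) : linear f -> linear g ->
  oequiv f -> oequiv g -> cancel f g -> retr V W.
Proof. by move=> fL gL fE gE fK; exists (mklin fL), (mklin gL). Qed.

Lemma retr_refl V : retr V V.
Proof. by exists idfun, idfun. Qed.

Lemma retr_trans U V W : retr U V -> retr V W -> retr U W.
Proof.
move=> [f [g [fE gE fK]]] [f' [g' [fE' gE' fK']]].
exists (f' \o f), (g \o g'); split=> [j v|j v|v] /=; first by rewrite fE fE'.
  by rewrite gE' gE.
by rewrite fK' fK.
Qed.

Lemma retr_sum U V U' V' : retr U U' -> retr V V' -> retr (osum U V) (osum U' V').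
Proof.
move=> [f [g [fE gE fK]]] [f' [g' [fE' gE' fK']]].
apply: (@retr_intro (osum U V) (osum U' V') (fun w => (f w.1, f' w.2)) (fun w => (g w.1, g' w.2))).
- by move=> a u v; congr (_, _); rewrite /= linearP.
- by move=> a u v; congr (_, _); rewrite /= linearP.
- by move=> j v; congr (_, _); rewrite /= ?fE ?fE'.
- by move=> j v; congr (_, _); rewrite /= ?gE ?gE'.
- by case=> u v; congr (_, _); rewrite /= ?fK ?fK'.
Qed.

Lemma FX_nat i V W (f : {linear V -> W}) : oequiv f ->
  oequiv (fun w : Fi i V => (f w.1, f w.2) : Fi i W).
Proof.
move=> fE j [w0 w1]; rewrite /= /FX_fun; case: ifP => _; last case: ifP => _.
all: by congr (_, _); rewrite /= ?linearD ?linearN ?fE.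
Qed.

Lemma retr_F i V W : retr V W -> retr (Fi i V) (Fi i W).
Proof.
move=> [f [g [fE gE fK]]].
apply: (@retr_intro (Fi i V) (Fi i W) (fun w => (f w.1, f w.2)) (fun w => (g w.1, g w.2))).
- by move=> a u v; congr (_, _); rewrite /= linearP.
- by move=> a u v; congr (_, _); rewrite /= linearP.
- exact: FX_nat.
- exact: FX_nat.
- by case=> u v; congr (_, _); rewrite /= fK.
Qed.

Lemma retr_F_sum i V W : retr (Fi i (osum V W)) (osum (Fi i V) (Fi i W)).
Proof.
apply: (@retr_intro (Fi i (osum V W)) (osum (Fi i V) (Fi i W))
  (fun w => ((w.1.1, w.2.1), (w.1.2, w.2.2))) (fun w => ((w.1.1, w.2.1), (w.1.2, w.2.2)))) => //.
- move=> j [[a b] [c d]]; rewrite /= /FX_fun /osum_fun /= /FX_fun /=.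
  by case: (j == i); case: (j == i.+1).
- move=> j [[a b] [c d]]; rewrite /= /FX_fun /osum_fun /= /FX_fun /=.
  by case: (j == i); case: (j == i.+1).
- by case=> [[a b] [c d]].
Qed.

Lemma gen_mono C C' V : (forall U, C U -> gen C' U) -> gen C V -> gen C' V.
Proof.
move=> CC'; elim=> [U /CC' //|U W _ IH1 _ IH2|U W UW _ IH].
- exact: gen_sum.
- exact: gen_retr UW IH.
Qed.

Lemma gen_F i C C' V : (forall U, C U -> gen C' (Fi i U)) -> gen C V -> gen C' (Fi i V).
Proof.
move=> CC'; elim=> [U /CC' //|U W _ IH1 _ IH2|U W UW _ IH].
- exact: gen_retr (retr_F_sum _ _ _) (gen_sum IH1 IH2).
- exact: gen_retr (retr_F i UW) IH.
Qed.

End Retracts.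

(** * Relations between the functors *)

Section Relations.
Variable (A : comPzRingType).
Implicit Types (U V W : opmod A) (C : opmod A -> Prop).

(** R is free of rank 2 over the invariants of the i-th transposition, and Fi i V
    depends on V only as a module over these. *)
Lemma retr_FF i V : retr (Fi i (Fi i V)) (osum (Fi i V) (Fi i V)).
Proof.
apply: (@retr_intro _ (Fi i (Fi i V)) (osum (Fi i V) (Fi i V))
  (fun w => ((w.1.1, w.2.1), (w.1.2, w.2.2))) (fun w => ((w.1.1, w.2.1), (w.1.2, w.2.2)))) => //.
- move=> j [[a b] [c d]]; rewrite /= /FX_fun /osum_fun /= /FX_fun /=.
  rewrite ?(gtn_eqF (ltnSn i)) ?eqxx; case: (j == i); case: (j == i.+1) => //=;
  by congr (_, _); congr (_, _); rewrite ?pairE /=; alinX V [:: i; i.+1].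
- move=> j [[a b] [c d]]; rewrite /= /FX_fun /osum_fun /= /FX_fun /=.
  rewrite ?(gtn_eqF (ltnSn i)) ?eqxx; case: (j == i); case: (j == i.+1) => //=;
  by congr (_, _); congr (_, _); rewrite ?pairE /=; alinX V [:: i; i.+1].
- by case=> [[a b] [c d]].
Qed.

Lemma retr_FC i j V : j != i -> j != i.+1 -> i != j.+1 -> retr (Fi i (Fi j V)) (Fi j (Fi i V)).
Proof.
move=> ji jSi iSj.
have ij : (i == j) = false by rewrite eq_sym (negbTE ji).
have SiSj : (i.+1 == j.+1) = false by rewrite eqSS.
have Sij : (i.+1 == j) = false by rewrite eq_sym (negbTE jSi).
have Sji : (j.+1 == i) = false by rewrite eq_sym (negbTE iSj).
have SjSi : (j.+1 == i.+1) = false by rewrite eqSS (negbTE ji).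
apply: (@retr_intro _ (Fi i (Fi j V)) (Fi j (Fi i V))
  (fun w => ((w.1.1, w.2.1), (w.1.2, w.2.2))) (fun w => ((w.1.1, w.2.1), (w.1.2, w.2.2)))) => //.
- move=> l [[a b] [c d]]; rewrite /= /FX_fun /= /FX_fun /= ij SiSj Sij Sji SjSi
    (negbTE ji) (negbTE jSi) (negbTE iSj).
  case: (eqVneq l i) => [->|li]; last (case: (eqVneq l i.+1) => [->|lSi]);
  by rewrite /= ?ij ?SiSj ?Sij ?Sji ?SjSi ?(negbTE ji) ?(negbTE jSi) ?(negbTE iSj)
    ?eqxx /=; do 2?case: ifP.
- move=> l [[a b] [c d]]; rewrite /= /FX_fun /= /FX_fun /= ij SiSj Sij Sji SjSi
    (negbTE ji) (negbTE jSi) (negbTE iSj).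
  case: (eqVneq l i) => [->|li]; last (case: (eqVneq l i.+1) => [->|lSi]);
  by rewrite /= ?ij ?SiSj ?Sij ?Sji ?SjSi ?(negbTE ji) ?(negbTE jSi) ?(negbTE iSj)
    ?eqxx /=; do 2?case: ifP.
- by case=> [[a b] [c d]].
Qed.
End Relations.

(** B_(i+1) B_i B_(i+1) is a summand of B_i B_(i+1) B_i + B_(i+1): the maps below satisfy
    braid_g \o braid_f + braid_a \o braid_b = id. They are given by their coordinates in
    the bases 1, x_i and 1, x_(i+1) of the three factors. *)
Section Braid.
Variables (A : comPzRingType) (i : nat) (V : opmod A).
Local Notation S := (Fi i).
Local Notation T := (Fi i.+1).
Local Notation TST := (T (S (T V))).
Local Notation STS := (S (T (S V))).

Local Notation x := (@om_X _ V i).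
Local Notation y := (@om_X _ V i.+1).
Local Notation z := (@om_X _ V i.+2).

Definition braid_f (w : TST) : STS :=
  let: (((a, b), (c, d)), ((e, f), (g, h))) := w in
  (((a, e), (e, - d + f + g)), ((b + c - e, d), (d, h))).

Definition braid_g (w : STS) : TST :=
  let: (((a, b), (c, d)), ((e, f), (g, h))) := w in
  (((a - z b + z c, - x f), (b + e - z f + x f + z g, f)), ((b, - x h), (d + f + x h, h))).

Definition braid_a (w : T V) : TST :=
  let: (a, b) := w in (((0, a), (- a, 0)), ((0, b), (- b, 0))).

Definition braid_b (w : TST) : T V :=
  let: (((a, b), (c, d)), ((e, f), (g, h))) := w in (b + x d, f + x h).

Lemma ord_if : ((i == i.+1) = false) * ((i == i.+2) = false) * ((i.+1 == i) = false)
  * ((i.+2 == i) = false) * ((i.+1 == i.+2) = false) * ((i.+2 == i.+1) = false).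
Proof. by do !split; apply/eqP; lia. Qed.

Lemma cancel_braid w : braid_g (braid_f w) + braid_a (braid_b w) = w.
Proof.
case: w => [[[a b] [c d]] [[e f] [g h]]]; rewrite /braid_g /braid_f /braid_a /braid_b.
by do 3!apply: injective_projections; rewrite ?pairE /=;
  alinX V [:: i; i.+1; i.+2].
Qed.

Ltac coords j ji jSi jSSi :=
  have [->|ji] := eqVneq j i; last have [->|jSi] := eqVneq j i.+1;
  last have [->|jSSi] := eqVneq j i.+2;
  do 3?rewrite /FX_fun /= ?ord_if ?eqxx ?(negbTE ji) ?(negbTE jSi) ?(negbTE jSSi) /=.

Lemma braid_a_equiv : oequiv braid_a.
Proof.
move=> j [a b]; rewrite /= /braid_a; coords j ji jSi jSSi;
do 3!apply: injective_projections; rewrite ?pairE /=; alinX V [:: i; i.+1; i.+2; j].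
Qed.

Lemma braid_b_equiv : oequiv braid_b.
Proof.
move=> j [[[a b] [c d]] [[e f] [g h]]]; rewrite /= /braid_b; coords j ji jSi jSSi;
apply: injective_projections; rewrite ?pairE /=; alinX V [:: i; i.+1; i.+2; j].
Qed.

Lemma braid_f_equiv : oequiv braid_f.
Proof.
move=> j [[[a b] [c d]] [[e f] [g h]]]; rewrite /= /braid_f; coords j ji jSi jSSi;
do 3!apply: injective_projections; rewrite ?pairE /=; alinX V [:: i; i.+1; i.+2; j].
Qed.

Lemma braid_g_equiv : oequiv braid_g.
Proof.
move=> j [[[a b] [c d]] [[e f] [g h]]]; rewrite /= /braid_g; coords j ji jSi jSSi;
do 3!apply: injective_projections; rewrite ?pairE /=; alinX V [:: i; i.+1; i.+2; j].
Qed.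

Lemma braid_f_lin : linear braid_f.
Proof.
move=> k [[[a b] [c d]] [[e f] [g h]]] [[[a' b'] [c' d']] [[e' f'] [g' h']]].
rewrite /= /braid_f.
do 3!apply: injective_projections; rewrite ?pairE /=; alin (om_car V) [:: scl V k].
Qed.

Lemma braid_g_lin : linear braid_g.
Proof.
move=> k [[[a b] [c d]] [[e f] [g h]]] [[[a' b'] [c' d']] [[e' f'] [g' h']]].
rewrite /= /braid_g.
do 3!apply: injective_projections; rewrite ?pairE /=; alin (om_car V) [:: scl V k; x; z].
Qed.

Lemma braid_a_lin : linear braid_a.
Proof.
move=> k [a b] [a' b']; rewrite /= /braid_a.
do 3!apply: injective_projections; rewrite ?pairE /=; alin (om_car V) [:: scl V k].
Qed.

Lemma braid_b_lin : linear braid_b.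
Proof.
move=> k [[[a b] [c d]] [[e f] [g h]]] [[[a' b'] [c' d']] [[e' f'] [g' h']]].
rewrite /= /braid_b.
apply: injective_projections; rewrite ?pairE /=; alin (om_car V) [:: scl V k; x].
Qed.

Lemma retr_braid : retr TST (osum STS (T V)).
Proof.
apply: (@retr_intro _ TST (osum STS (T V)) (fun w => (braid_f w, braid_b w))
  (fun w => braid_g w.1 + braid_a w.2)).
- by move=> k u v; congr (_, _); [exact: braid_f_lin|exact: braid_b_lin].
- move=> k u v; rewrite -[LHS]/(braid_g (k *: u.1 + v.1) + braid_a (k *: u.2 + v.2)).
  by rewrite braid_g_lin braid_a_lin scalerDr addrACA.
- by move=> j w; congr (_, _); [exact: braid_f_equiv|exact: braid_b_equiv].
- by move=> j w; rewrite [RHS]linearD -braid_g_equiv -braid_a_equiv.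
- exact: cancel_braid.
Qed.
End Braid.

(** * Reduction of words *)

(** Compositions and sums of the functors Fi, as syntax. *)
Inductive fshape := SId | SSum of fshape & fshape | SF of nat & fshape.

Fixpoint G (A : comPzRingType) (a : fshape) (V : opmod A) : opmod A :=
  match a with
  | SId => V
  | SSum a b => osum (G a V) (G b V)
  | SF i a => Fi i (G a V)
  end.

Fixpoint Gmap (A : comPzRingType) (a : fshape) (V W : opmod A) (f : V -> W) :
  G a V -> G a W := match a return G a V -> G a W with
  | SId => f
  | SSum a b => fun w => (Gmap (a := a) f w.1, Gmap (a := b) f w.2)
  | SF i a => fun w => (Gmap (a := a) f w.1, Gmap (a := a) f w.2)
  end.
Arguments Gmap {A} a {V W} f.

Definition word (w : seq nat) : fshape := foldr SF SId w.
Notation Fw w V := (G (word w) V).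

Fixpoint scomp (a b : fshape) : fshape := match a with
  | SId => b
  | SSum a1 a2 => SSum (scomp a1 b) (scomp a2 b)
  | SF i a => SF i (scomp a b)
  end.

Section Functor.
Variable (A : comPzRingType).
Implicit Types (U V W : opmod A).

Lemma G_scomp a b V : G (scomp a b) V = G a (G b V).
Proof. by elim: a => //= [a1 -> a2 -> //|i a ->]. Qed.

Lemma Fw_cat u v V : Fw (u ++ v) V = Fw u (Fw v V).
Proof. by elim: u => //= i u ->. Qed.

Lemma Gmap_comp a U V W (f : U -> V) (g : V -> W) z :
  Gmap a g (Gmap a f z) = Gmap a (fun v => g (f v)) z.
Proof.
elim: a z => //= [a1 IH1 a2 IH2|i a IHa] z; first by rewrite IH1 IH2.
by rewrite !IHa.
Qed.

Lemma Gmap_ext a V W (f g : V -> W) : f =1 g -> Gmap a f =1 Gmap a g.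
Proof.
move=> fg; elim: a => //= [a1 IH1 a2 IH2|i a IHa] z; first by rewrite IH1 IH2.
by rewrite !IHa.
Qed.

Lemma Gmap_id a V z : Gmap a (fun v : V => v) z = z.
Proof.
elim: a z => //= [a1 IH1 a2 IH2|i a IHa] [z1 z2]; first by rewrite IH1 IH2.
by rewrite !IHa.
Qed.

Lemma GmapD a V W (f : V -> W) : {morph f : u v / u + v} -> {morph Gmap a f : u v / u + v}.
Proof.
move=> fD; elim: a => //= [a1 IH1 a2 IH2|i a IHa] u v; congr (_, _); by rewrite /= ?IH1 ?IH2 ?IHa.
Qed.

Lemma Gmap_scale a V (r : A) z : Gmap a (fun v : V => r *: v) z = r *: z.
Proof.
elim: a z => //= [a1 IH1 a2 IH2|i a IHa] [z1 z2]; first by rewrite IH1 IH2.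
by rewrite !IHa.
Qed.

Lemma Gmap_lin a V W (f : V -> W) : linear f -> linear (Gmap a f).
Proof.
move=> fL; elim: a => //= [a1 IH1 a2 IH2|i a IHa] r u v; congr (_, _);
  by rewrite /= ?IH1 ?IH2 ?IHa.
Qed.

Lemma Gmap_addf a V W (f g : V -> W) z :
  Gmap a (fun v => f v + g v) z = Gmap a f z + Gmap a g z.
Proof.
elim: a z => //= [a1 IH1 a2 IH2|i a IHa] [z1 z2]; first by rewrite IH1 IH2.
by rewrite !IHa.
Qed.

Lemma Gmap_X a V W (f : V -> W) : {morph f : u v / u + v} -> oequiv f -> oequiv (Gmap a f).
Proof.
move=> fD fE; elim: a => //= [a1 IH1 a2 IH2|i a IHa] j z.
  by congr (_, _); rewrite /= (IH1, IH2).
have GD := GmapD (a := a) fD.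
have GN u : Gmap a f (- u) = - Gmap a f u.
  by apply: (addrI (Gmap a f u)); rewrite -GD !subrr; apply: (addrI (Gmap a f 0)); rewrite -GD !addr0.
case: z => u v; rewrite /= /FX_fun /=; case: (j == i); case: (j == i.+1) => /=;
 by rewrite ?GD ?GN !IHa.
Qed.

(** X_j commutes with the functors whose letter does not involve the variable j. *)
Lemma G_X_out w j V z : all (fun i => (j != i) && (j != i.+1)) w ->
  om_X j z = Gmap (word w) (@om_X _ V j) z.
Proof.
elim: w z => //= i w IHw [z1 z2] /andP[/andP[ji jSi] Hw].
by rewrite /= /FX_fun (negbTE ji) (negbTE jSi) /= !IHw.
Qed.

Lemma retr_Fw w V W : retr V W -> retr (Fw w V) (Fw w W).
Proof. by elim: w => //= i w IHw VW; apply/retr_F/IHw. Qed.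

Lemma gen_Fw w (C C' : opmod A -> Prop) V :
  (forall U, C U -> gen C' (Fw w U)) -> gen C V -> gen C' (Fw w V).
Proof.
elim: w C' => [|i w IHw] C' CC' /=; first exact: gen_mono.
move=> HV; apply: (@gen_F _ i (fun U => exists2 T, C T & U = Fw w T)).
  by move=> _ [T CT ->]; exact: CC'.
by apply: IHw HV => U CU; apply: gen_base; exists U.
Qed.

Lemma retr_FwC c w V : all (fun i => i.+1 < c)%N w ->
  retr (Fi c (Fw w V)) (Fw w (Fi c V)) /\ retr (Fw w (Fi c V)) (Fi c (Fw w V)).
Proof.
elim: w => /= [_|i w IHw /andP[ic /IHw[IH1 IH2]]]; first by split; apply: retr_refl.
split.
  by apply: retr_trans _ (retr_F i IH1); apply: retr_FC; lia.
by apply: retr_trans (retr_F i IH2) _; apply: retr_FC; lia.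
Qed.

(** The normal form of words in the letters 0, .., c - 1: the largest letter is used at most
    once. For c = 0 the predecessor c.-1 is 0, but then only the empty word is allowed. *)
Definition few c V U := exists2 w, all (gtn c) w /\ (count_mem c.-1 w <= 1)%N & U = Fw w V.

(** By induction on c and on w. If w starts with c and its tail, in normal form, is a c b,
    then a is first brought to normal form with respect to the letter c - 1. If c - 1 does
    not occur, c can be moved through a, and c c becomes c + c. Otherwise
    a = a1 (c-1) a2, and c moves through a1 and through a2 from the other side, until
    c (c-1) c appears, to which the braid relation applies. *)
Lemma reduce_word c w V : all (gtn c) w -> gen (few c V) (Fw w V).
Proof.
elim: c w V => [|c IHc] w V; first by case: w => // _; apply: gen_base; exists [::].
elim: w => [_|i w IHw /= /andP[ic /IHw Hw]]; first by apply: gen_base; exists [::].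
apply: (gen_F _ Hw) => _ [w' [w'c nw'] ->]; rewrite /= in nw'.
have [iltc|cgei] := ltnP i c.
  apply: gen_base; exists (i :: w') => //=; split; first by rewrite ic.
  by rewrite ltn_eqF.
have {ic cgei} -> : i = c by move: ic; rewrite /= ltnS; lia.
have [cw'|cw'] := boolP (c \in w'); last first.
  apply: gen_base; exists (c :: w') => //=; split; first by rewrite ltnS leqnn.
  by rewrite eqxx (count_memPn cw').
case/splitPr: cw' w'c nw' => a b; rewrite all_cat count_cat /= eqxx ltnS leqnn /=.
move=> /andP[ac bc] nab.
have [/count_memPn ca /count_memPn cb] : count_mem c a = 0%N /\ count_mem c b = 0%N.
  by move: nab; rewrite addnCA add1n ltnS leqn0 addn_eq0 => /andP[/eqP-> /eqP->].
have {}ac : all (gtn c) a.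
  apply/allP => j ja; have := allP ac j ja; rewrite /= ltnS leq_eqVlt.
  by case/orP=> // /eqP jc; rewrite -jc ja in ca.
rewrite Fw_cat /=; set U := Fw b V.
apply: (gen_F _ (IHc a (Fi c U) ac)) => _ [a' [a'c na'] ->].
have wordP s : all (gtn c.+1) s -> (count_mem c s <= 1)%N -> gen (few c.+1 V) (Fw s V).
  by move=> s1 s2; apply: gen_base; exists s.
have le s : all (gtn c) s -> all (gtn c.+1) s /\ count_mem c s = 0%N.
  move=> sc; split; first by apply: sub_all sc => j /=; lia.
  by apply/count_memPn/negP => /(allP sc) /=; rewrite ltnn.
have nb : count_mem c b = 0%N by apply/count_memPn.
(* If c - 1 does not occur in a', then c moves through a' to the other c. *)
have [ca'|ca'] := boolP (c.-1 \in a'); last first.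
  have far : all (fun i => i.+1 < c)%N a'.
    apply/allP => j ja; have := allP a'c j ja; have : j != c.-1.
      by apply: contra ca' => /eqP <-.
    by rewrite /=; lia.
  apply: gen_retr (proj1 (retr_FwC _ far)) _.
  apply: (gen_Fw (C := eq (Fi c U))) => [_ <-|].
    have [a'1 a'2] := le _ a'c.
    rewrite /U -[Fi c _]/(Fw (c :: b) V) -Fw_cat; apply: wordP.
      by rewrite all_cat a'1 /= ltnS leqnn.
    by rewrite count_cat /= eqxx a'2 nb.
  by apply: gen_retr (retr_FF _ _) _; apply: gen_sum; apply: gen_base.
case: c => [|c] in cb bc nab wordP le nb a'c na' ca' ca ac U IHc IHw Hw *.
  by have := allP a'c _ ca'.
rewrite /= in ca' na'; case/splitPr: ca' a'c na' => a1 a2.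
rewrite all_cat count_cat /= eqxx => /and3P[a1c _ a2c] na12.
have [n1 n2] : count_mem c a1 = 0%N /\ count_mem c a2 = 0%N.
  by move: na12; rewrite addnCA add1n ltnS leqn0 addn_eq0 => /andP[/eqP-> /eqP->].
have far s : all (gtn c.+1) s -> count_mem c s = 0%N -> all (fun i => i.+1 < c.+1)%N s.
  move=> sc /count_memPn cs; apply/allP => j js; have := allP sc j js.
  have : j != c by apply: contra cs => /eqP <-.
  by rewrite /=; lia.
(* c moves through a1 to the right and through a2 to the left, up to c - 1. *)
rewrite Fw_cat /=.
apply: gen_retr (proj1 (retr_FwC _ (far _ a1c n1))) _.
have [_ R2] := retr_FwC U (far _ a2c n2).
apply: gen_retr (retr_Fw a1 (retr_F c.+1 (retr_F c R2))) _.
pose U2 := Fw a2 U.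
have [a1l a1n] := le _ a1c; have [a2l a2n] := le _ a2c.
have cc : (c == c.+1) = false by rewrite ltn_eqF.
apply: (gen_Fw (C := fun T => T = Fi c (Fi c.+1 (Fi c U2)) \/ T = Fi c.+1 U2)) => [_ [|] ->|].
- rewrite /U2 /U -Fw_cat -[Fi c (Fi _ _)]/(Fw [:: c, c.+1, c & a2 ++ b] V) -Fw_cat.
  apply: wordP; first by rewrite all_cat a1l /= all_cat a2l bc; lia.
  by rewrite !count_cat /= count_cat a1n a2n nb eqxx cc.
- rewrite /U2 /U -Fw_cat -[Fi _ _]/(Fw [:: c.+1 & a2 ++ b] V) -Fw_cat.
  apply: wordP; first by rewrite all_cat a1l /= all_cat a2l bc; lia.
  by rewrite !count_cat /= count_cat a1n a2n nb eqxx.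
apply: gen_retr (retr_braid _ _) _.
by apply: gen_sum; apply: gen_base; [left|right].
Qed.

End Functor.

(** * Koszul complexes *)

(** K V m is the sum of 2^m copies of V, graded by the number of second components that
    are taken: (a, b) is a + b xi_m, where xi_m is the last exterior generator. The
    complex of m.+1 operators is the cone of the last one on the complex of the
    others. *)
Section Koszul.
Variable (A : comPzRingType).
Implicit Types (U V W : lmodType A).

Fixpoint K V m : lmodType A := if m is m.+1 then (K V m * K V m)%type else V.

Fixpoint Kmap_fun m V W (f : V -> W) : K V m -> K W m :=
  match m return K V m -> K W m with
  | 0 => f
  | m.+1 => fun z => (Kmap_fun f z.1, Kmap_fun f z.2)
  end.

Lemma Kmap_lin m V W (f : {linear V -> W}) : linear (Kmap_fun (m := m) f).
Proof.
elim: m => [|m IHm] r u v; first exact: linearP.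
by congr (_, _); apply: IHm.
Qed.

Definition Kmap m V W (f : {linear V -> W}) : {linear K V m -> K W m} := mklin (Kmap_lin (m := m) f).

Fixpoint KD_fun m V (d : nat -> {linear V -> V}) : K V m -> K V m :=
  match m return K V m -> K V m with
  | 0 => fun _ => 0
  | m.+1 => fun z => (KD_fun d z.1, Kmap m (d m) z.1 - KD_fun d z.2)
  end.

Lemma KD_lin m V (d : nat -> {linear V -> V}) : linear (KD_fun (m := m) d).
Proof.
elim: m => [|m IHm] r u v; first by rewrite /= scaler0 addr0.
congr (_, _); first exact: IHm.
rewrite -[LHS]/(Kmap_fun (d m) (r *: u.1 + v.1) - KD_fun d (r *: u.2 + v.2)).
rewrite IHm (Kmap_lin (d m)) opprD addrACA.
by rewrite -[RHS]/(r *: (Kmap_fun (d m) u.1 - KD_fun d u.2) + _) scalerBr.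
Qed.

Definition KD m V (d : nat -> {linear V -> V}) : {linear K V m -> K V m} := mklin (KD_lin (m := m) d).

Lemma Kmap_comp m U V W (f : {linear U -> V}) (g : {linear V -> W}) (h : {linear U -> W}) z :
  (forall u, h u = g (f u)) -> Kmap m h z = Kmap m g (Kmap m f z).
Proof.
move=> E; elim: m z => [|m IHm] z /=; first exact: E.
by congr (_, _); apply: IHm.
Qed.

Lemma Kmap_swap m U V V' W (g : {linear U -> V}) (f : {linear V -> W})
    (g' : {linear U -> V'}) (f' : {linear V' -> W}) z :
  (forall u, f (g u) = f' (g' u)) -> Kmap m f (Kmap m g z) = Kmap m f' (Kmap m g' z).
Proof.
move=> E; elim: m z => [|m IHm] z /=; first exact: E.
by congr (_, _); apply: IHm.
Qed.

Lemma Kmap_ext m V W (f g : {linear V -> W}) : f =1 g -> Kmap m f =1 Kmap m g.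
Proof.
move=> E; elim: m => [|m IHm] z /=; first exact: E.
by congr (_, _); apply: IHm.
Qed.

Lemma Kmap_id m V (f : {linear V -> V}) z : f =1 id -> Kmap m f z = z.
Proof.
move=> E; elim: m z => [|m IHm] z /=; first exact: E.
by case: z => a b; congr (_, _); apply: IHm.
Qed.

Lemma Kmap_0 m V W (f : {linear V -> W}) z : f =1 (fun=> 0) -> Kmap m f z = 0.
Proof.
move=> E; elim: m z => [|m IHm] z /=; first exact: E.
by congr (_, _); apply: IHm.
Qed.

Lemma Kmap_add m V W (f g h : {linear V -> W}) z : (forall v, f v = g v + h v) ->
  Kmap m f z = Kmap m g z + Kmap m h z.
Proof.
move=> E; elim: m z => [|m IHm] z /=; first exact: E.
by congr (_, _); apply: IHm.
Qed.

Lemma Kmap_scl m V (r : A) z : Kmap m (scl V r) z = r *: z.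
Proof. by elim: m z => [|m IHm] z //=; congr (_, _); apply: IHm. Qed.

Lemma KD_nat m V W (d : nat -> {linear V -> V}) (d' : nat -> {linear W -> W})
    (f : {linear V -> W}) z : (forall i v, (i < m)%N -> f (d i v) = d' i (f v)) ->
  Kmap m f (KD m d z) = KD m d' (Kmap m f z).
Proof.
elim: m z => [|m IHm] z E; first exact: linear0.
have E' i v : (i < m)%N -> f (d i v) = d' i (f v) by move=> im; apply: E; apply: ltnW.
congr (_, _); first exact: (IHm _ E').
rewrite -[RHS]/(Kmap m (d' m) (Kmap m f z.1) - KD m d' (Kmap m f z.2)) -(IHm _ E').
rewrite -[LHS]/(Kmap m f (Kmap m (d m) z.1 - KD m d z.2)) linearB.
by congr (_ - _); apply: Kmap_swap => v; apply: E.
Qed.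

Lemma KD_sq m V (d : nat -> {linear V -> V}) z :
  (forall i j v, d i (d j v) = d j (d i v)) -> KD m d (KD m d z) = 0.
Proof.
move=> dC; elim: m z => [|m IHm] z //=.
congr (_, _); first exact: IHm.
rewrite -[LHS]/(Kmap m (d m) (KD m d z.1) - KD m d (Kmap m (d m) z.1 - KD m d z.2)).
by rewrite linearB IHm subr0 (KD_nat (d' := d)) ?subrr.
Qed.

End Koszul.

(** * Cones that split *)

Section LinearMaps.
Variables (A : pzRingType) (U V W : lmodType A).

Lemma lin_add (f g : U -> V) : linear f -> linear g -> linear (fun x => f x + g x).
Proof. by move=> fL gL r u v; rewrite fL gL scalerDr addrACA. Qed.

Lemma lin_opp (f : U -> V) : linear f -> linear (fun x => - f x).
Proof. by move=> fL r u v; rewrite fL opprD scalerN. Qed.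

Lemma lin_comp (g : {linear V -> W}) (f : U -> V) : linear f -> linear (fun x => g (f x)).
Proof. by move=> fL r u v; rewrite fL linearP. Qed.

Lemma lin_pair (f : U -> V) (g : U -> W) :
  linear f -> linear g -> linear (fun x => (f x, g x)).
Proof. by move=> fL gL r u v; congr (_, _); [apply: fL | apply: gL]. Qed.

Lemma lin_fst (f : U -> (V * W)%type) : linear f -> linear (fun x => (f x).1).
Proof. by move=> fL r u v; rewrite fL. Qed.

Lemma lin_snd (f : U -> (V * W)%type) : linear f -> linear (fun x => (f x).2).
Proof. by move=> fL r u v; rewrite fL. Qed.

Lemma lin_id : linear (fun x : U => x).
Proof. by []. Qed.

Lemma lin_0 : linear (fun x : U => 0 : V).
Proof. by move=> r u v; rewrite scaler0 addr0. Qed.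
End LinearMaps.

Ltac linsolve := repeat first [exact: lin_id | exact: lin_0 | apply: lin_fst | apply: lin_snd
  | apply: lin_add | apply: lin_opp | apply: lin_comp].

(** The endomorphism dlt of the complex M has kernel i(N) and cokernel p : M -> N, and t, j, s
    split the sequence N -> M -> M -> N as a sequence of modules. The maps i and p
    commute with the differentials, but s does not. The cone of dlt is therefore
    an extension of two copies of N, and the class of this extension vanishes as Om
    corrects s to a map into the cone. *)
Section Cone.
Variables (A : comPzRingType) (M N : lmodType A).
Variables (D dlt t : {linear M -> M}) (D' h : {linear N -> N}).
Variables (i s Om : {linear N -> M}) (p j : {linear M -> N}).
Hypotheses (DD : forall x, D (D x) = 0) (dltD : forall x, dlt (D x) = D (dlt x)).
Hypotheses (iD : forall x, i (D' x) = D (i x)) (pD : forall x, p (D x) = D' (p x)).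
Hypotheses (ji : cancel i j) (ij : forall x, i (j x) = x - t (dlt x)).
Hypotheses (ps : cancel s p) (dt : forall x, dlt (t x) = x - s (p x)).
Hypotheses (pdlt : forall x, p (dlt x) = 0) (dlti : forall x, dlt (i x) = 0).
Hypotheses (dltOm : forall x, dlt (Om x) = D (s x) - s (D' x)).
Hypotheses (DOm : forall x, D (Om x) = - Om (D' x)).
Hypothesis hP : forall x, D' (h (D' x)) = D' x.

Definition coneD_fun (x : (M * M)%type) : (M * M)%type := (D x.1, dlt x.1 - D x.2).
Definition cone_f (x : (M * M)%type) : (N * N)%type :=
  (j (x.1 - t (dlt x.1) + (t (D x.2) - D (t x.2)) - Om (p x.2)), p x.2).
Definition cone_g (z : (N * N)%type) : (M * M)%type := (i z.1 + Om z.2, s z.2).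
Definition cone_h (x : (M * M)%type) : (M * M)%type := (t x.2, 0).
Definition cone_inv (x : (M * M)%type) : (M * M)%type :=
  cone_g (h (cone_f x).1, - h (cone_f x).2) + cone_h x.

Lemma coneDD x : coneD_fun (coneD_fun x) = 0.
Proof. by congr (_, _); rewrite /= ?DD // linearB /= DD subr0 dltD subrr. Qed.

Lemma coneDB x y : coneD_fun (x - y) = coneD_fun x - coneD_fun y.
Proof.
case: x y => a b [a' b']; rewrite -[LHS]/(D (a - a'), dlt (a - a') - D (b - b')).
rewrite !linearB; congr (_, _); rewrite /= opprD opprK [LHS]addrACA.
by congr (_ + _); rewrite opprD opprK.
Qed.

Lemma cone_gf x : cone_g (cone_f x) = x - coneD_fun (cone_h x) - cone_h (coneD_fun x).
Proof.
case: x => a b; set u := a - t (dlt a) + (t (D b) - D (t b)) - Om (p b).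
have u0 : dlt u = 0.
  rewrite linearB linearD /=.
  have -> : dlt (a - t (dlt a)) = 0 by rewrite linearB /= dt pdlt linear0 subr0 subrr.
  have -> : dlt (t (D b) - D (t b)) = D (s (p b)) - s (D' (p b)).
    rewrite linearB /= dltD !dt pD linearB /= opprB addrC addrA subrK.
    by [].
  by rewrite add0r dltOm subrr.
congr (_, _).
  rewrite -[LHS]/(i (j u) + Om (p b)) ij u0 linear0 subr0 subrK.
  rewrite -[RHS]/(a - D (t b) - t (dlt a - D b)) linearB opprB.
  by rewrite [LHS]addrACA [RHS]addrACA; congr (_ + _); rewrite addrC.
rewrite -[LHS]/(s (p b)) -[RHS]/(b - (dlt (t b) - D 0) - 0).
by rewrite linear0 !subr0 dt opprB addrC subrK.
Qed.

Lemma coneD_g z : coneD_fun (cone_g z) = cone_g (D' z.1, - D' z.2).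
Proof.
case: z => z0 z1; rewrite /cone_g /coneD_fun /=; congr (_, _).
  by rewrite linearD /= DOm iD linearN.
by rewrite linearD /= dlti add0r dltOm addrAC subrr add0r linearN.
Qed.

Lemma cone_g_inj z z' : cone_g z = cone_g z' -> z = z'.
Proof.
case: z z' => [a b] [a' b'] [E1 /(congr1 p)]; rewrite !ps => E2.
by move: E1; rewrite E2 => /addIr /(congr1 j); rewrite !ji => ->.
Qed.

Lemma cone_fD x : cone_f (coneD_fun x) = (D' (cone_f x).1, - D' (cone_f x).2).
Proof.
have h0 : cone_h 0 = 0 by congr (_, _); rewrite /= linear0.
by apply: cone_g_inj; rewrite -coneD_g !cone_gf !coneDB !coneDD h0 !subr0.
Qed.

(** cone_f and cone_g are inverse homotopy equivalences between the cone of dlt and N + N,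
    with the homotopy cone_h, so that the splitting h of N can be transported. *)
Lemma cone_invP x : coneD_fun (cone_inv (coneD_fun x)) = coneD_fun x.
Proof.
have D0 : coneD_fun 0 = 0 by rewrite -[X in coneD_fun X](subrr 0) coneDB subrr.
have coneDA y z : coneD_fun (y + z) = coneD_fun y + coneD_fun z.
  by rewrite -{1}[z]opprK coneDB -[- z]sub0r coneDB D0 sub0r opprK.
rewrite /cone_inv coneDA coneD_g cone_fD; set y := cone_f x.
rewrite -[X in cone_g X]/(D' (h (D' y.1)), - D' (- h (- D' y.2))).
rewrite [h (- _)]linearN opprK !hP -coneD_g cone_gf !coneDB coneDD subr0.
exact: subrK.
Qed.

Lemma cone_inv_lin : linear cone_inv.
Proof.
have fL : linear cone_f.
  by apply: lin_pair; linsolve.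
have gL : linear (fun x => cone_g (h (cone_f x).1, - h (cone_f x).2)).
  rewrite /cone_g /=; apply: lin_pair; linsolve; exact: fL.
apply: lin_add => //; apply: lin_pair; linsolve.
Qed.
End Cone.

(** * Splitting of Koszul complexes *)

Section Split.
Variables (A : comPzRingType) (y : nat -> A).
Implicit Types (U V W : opmod A).

Definition dif V (i : nat) : {linear V -> V} := @om_X _ V i \- scl V (y i).

Lemma dif_C V i j v : dif V i (dif V j v) = dif V j (dif V i v).
Proof.
rewrite /= !linearB !linearZ /= om_C !scalerA [y i * y j]mulrC.
by rewrite -!addrA; congr (_ + _); rewrite addrCA.
Qed.

Lemma dif_nat V W (f : {linear V -> W}) i v : oequiv f -> f (dif V i v) = dif W i (f v).
Proof. by move=> fE; rewrite linearB fE linearZ. Qed.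

(** The complex is isomorphic to the sum of its cohomology and a contractible complex, so
    its cohomology commutes with additive functors such as the duality. *)
Definition ksplit m V := exists h : {linear K V m -> K V m},
  forall z, KD m (dif V) (h (KD m (dif V) z)) = KD m (dif V) z.

Lemma split_retr m V W : retr V W -> ksplit m W -> ksplit m V.
Proof.
move=> [f [g [fE gE fK]]] [h hP]; exists (Kmap m g \o (h \o Kmap m f)) => z.
rewrite -[LHS]/(KD m (dif V) (Kmap m g (h (Kmap m f (KD m (dif V) z))))).
rewrite -(KD_nat (d := dif W)) => [|i v _]; last exact: dif_nat.
rewrite (KD_nat (d' := dif W)) => [|i v _]; last exact: dif_nat.
rewrite hP (KD_nat (d' := dif V)) => [|i v _]; last exact: dif_nat.
by rewrite -(Kmap_comp (h := idfun)) ?Kmap_id // => v; rewrite /= fK.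
Qed.

Lemma split_sum m V W : ksplit m V -> ksplit m W -> ksplit m (osum V W).
Proof.
move=> [h hP] [h' hP'].
pose p1 : {linear osum V W -> V} := mklin (@lin_fst A _ _ _ _ (@lin_id A (osum V W))).
pose p2 : {linear osum V W -> W} := mklin (@lin_snd A _ _ _ _ (@lin_id A (osum V W))).
have l1 : linear (fun v => (v, 0) : osum V W).
  by apply: lin_pair; linsolve.
have l2 : linear (fun v => (0, v) : osum V W).
  by apply: lin_pair; linsolve.
pose i1 := mklin l1; pose i2 := mklin l2.
exists ((Kmap m i1 \o (h \o Kmap m p1)) \+ (Kmap m i2 \o (h' \o Kmap m p2))) => z.
have E1 x : KD m (dif (osum V W)) (Kmap m i1 x) = Kmap m i1 (KD m (dif V) x).
  rewrite (KD_nat (d' := dif (osum V W))) // => i v _; apply: dif_nat => j u.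
  by congr (_, _); rewrite /= linear0.
have E2 x : KD m (dif (osum V W)) (Kmap m i2 x) = Kmap m i2 (KD m (dif W) x).
  rewrite (KD_nat (d' := dif (osum V W))) // => i v _; apply: dif_nat => j u.
  by congr (_, _); rewrite /= linear0.
rewrite -[LHS]/(KD m (dif (osum V W)) (Kmap m i1 (h (Kmap m p1 (KD m (dif (osum V W)) z))) +
  Kmap m i2 (h' (Kmap m p2 (KD m (dif (osum V W)) z))))) linearD E1 E2.
rewrite (KD_nat (f := p1) (d' := dif V)) => [|i v _]; last exact: dif_nat.
rewrite (KD_nat (f := p2) (d' := dif W)) => [|i v _]; last exact: dif_nat.
rewrite hP hP' -E1 -E2 -linearD; congr (KD m _ _).
rewrite -(Kmap_comp (h := i1 \o p1)) // -(Kmap_comp (h := i2 \o p2)) //.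
rewrite -(Kmap_add (f := idfun)) ?Kmap_id // => -[a b].
by congr (_, _); rewrite /= ?addr0 ?add0r.
Qed.

Lemma split_gen m (C : opmod A -> Prop) V :
  (forall U, C U -> ksplit m U) -> gen C V -> ksplit m V.
Proof.
move=> HC; elim=> [U /HC //|U W _ IH1 _ IH2|U W UW _ IH].
- exact: split_sum.
- exact: split_retr UW IH.
Qed.

Lemma split_0 V : ksplit 0 V.
Proof. by exists idfun. Qed.

(** The new operator is 0, so its cone consists of two copies of the complex. *)
Lemma split_S m V : (forall v, dif V m v = 0) -> ksplit m V -> ksplit m.+1 V.
Proof.
move=> d0 [h hP].
have hL : linear (fun z : K V m.+1 => (h z.1, - h z.2) : K V m.+1).
  by apply: lin_pair; linsolve.
exists (mklin hL) => -[a b].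
have E u v : KD m.+1 (dif V) (u, v) = (KD m (dif V) u, - KD m (dif V) v).
  by rewrite -[LHS]/(KD m (dif V) u, Kmap m (dif V m) u - KD m (dif V) v) (Kmap_0 _ d0) add0r.
rewrite E -[X in KD m.+1 _ X]/(h (KD m (dif V) a), - h (- KD m (dif V) b)) E.
by rewrite [h (- _)]linearN opprK !hP.
Qed.
End Split.

(** On L the variable c + 1 acts in the same way on the left and on the right. Then the
    operator X_(c+1) - y_(c+1) on B_c L has kernel and cokernel L: the
    cokernel map B_p is the multiplication 1 (x) v0 + x_c (x) v1 |-> v0 + x_c v1, and the
    kernel is the image of B_i : v |-> x_c (x) v - 1 (x) y_(c+1) v. The maps B_s, B_t
    and B_j split this sequence over the right action. *)
Section ConeOfB.
Variables (A : comPzRingType) (y : nat -> A) (c : nat) (L : opmod A).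
Hypothesis XL : forall v : L, om_X c.+1 v = y c.+1 *: v.
Local Notation BL := (Fi c L).

Definition B_i : {linear L -> BL} := mklin (lin_pair
  (lin_opp (lin_comp (scl L (y c.+1)) (@lin_id A L))) (@lin_id A L)).
Definition B_p : {linear BL -> L} := mklin (lin_add
  (lin_fst (@lin_id A BL)) (lin_comp (@om_X _ L c) (lin_snd (@lin_id A BL)))).
Definition B_s : {linear L -> BL} := mklin (lin_pair (@lin_id A L) (@lin_0 A L L)).
Definition B_t : {linear BL -> BL} := mklin (lin_pair
  (lin_opp (lin_snd (@lin_id A BL))) (@lin_0 A BL L)).
Definition B_j : {linear BL -> L} := mklin (lin_snd (@lin_id A BL)).

Lemma B_dif (w : BL) : dif y BL c.+1 w =
  (om_X c (w.1 + y c.+1 *: w.2), - (w.1 + y c.+1 *: w.2)).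
Proof.
case: w => u v; rewrite -[LHS]/(om_X c.+1 ((u, v) : BL) - y c.+1 *: (u, v)) FiX1 /=.
by congr (_, _); rewrite ?opprD // !XL linearD addrAC addrK.
Qed.

Lemma B_ps : cancel B_s B_p. Proof. by move=> v; rewrite /= linear0 addr0. Qed.
Lemma B_ij w : B_i (B_j w) = w - B_t (dif y BL c.+1 w).
Proof.
case: w => u v; rewrite B_dif; congr (_, _); rewrite /= ?subr0 //.
by rewrite opprK opprD addrA subrr add0r.
Qed.
Lemma B_dt w : dif y BL c.+1 (B_t w) = w - B_s (B_p w).
Proof.
case: w => u v; rewrite B_dif; congr (_, _); rewrite /= scaler0 addr0 ?opprK ?subr0 //.
by rewrite linearN opprD addrA subrr add0r.
Qed.
Lemma B_pd w : B_p (dif y BL c.+1 w) = 0.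
Proof. by rewrite B_dif /= linearN subrr. Qed.
Lemma B_di v : dif y BL c.+1 (B_i v) = 0.
Proof. by rewrite B_dif; congr (_, _); rewrite /= addNr ?linear0 ?oppr0. Qed.

Lemma B_i_equiv : oequiv B_i.
Proof.
move=> j v; rewrite /= /FX_fun /=.
case: (eqVneq j c) => [->|jc]; last case: (eqVneq j c.+1) => [->|jSc].
- congr (_, _); first by rewrite !XL [om_X c (_ *: _)]linearZ.
  by rewrite !XL addrAC addNr add0r.
- congr (_, _); last by rewrite !XL opprK.
  by rewrite !XL [om_X c (- _)]linearN scalerN addrAC addNr add0r.
- by congr (_, _); rewrite [RHS]linearN [om_X j (_ *: _)]linearZ.
Qed.

Lemma B_p_equiv : oequiv B_p.
Proof.
move=> j [u v]; rewrite /= /FX_fun /=.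
case: (eqVneq j c) => [->|jc]; last case: (eqVneq j c.+1) => [->|jSc] /=.
- by rewrite !linearD addrC addrK.
- by rewrite [om_X c (- _)]linearN addrC !addrA addNr add0r linearD om_C.
- by rewrite linearD om_C.
Qed.

(** B_s : v |-> 1 (x) v does not commute with X_c and X_(c+1). Its failure to commute with X_i
    is X_(c+1) - y_(c+1) composed with om_fun i, see dif_om. These maps define an
    extension E of L by B_c L, to which B_s and X_(c+1) - y_(c+1) extend as a
    map E_phi that does commute with the X_i. *)
Definition om_fun i (v : L) : BL := (if i == c then - v else if i == c.+1 then v else 0, 0).

Lemma om_lin i : linear (om_fun i).
Proof.
apply: lin_pair; linsolve; case: (i == c); first by linsolve.
by case: (i == c.+1); linsolve.
Qed.

Definition E_fun i (w : (BL * L)%type) : (BL * L)%type :=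
  (om_X i w.1 + om_fun i w.2, om_X i w.2).

Lemma E_lin i : linear (E_fun i).
Proof.
apply: lin_pair; linsolve.
by move=> r u v; rewrite [(_ *: _ + _).2]/= om_lin.
Qed.

Lemma om_comm i j l :
  om_X i (om_fun j l) + om_fun i (om_X j l) = om_X j (om_fun i l) + om_fun j (om_X i l).
Proof.
rewrite -[om_X i (om_fun j l)]/(FX_fun c i (om_fun j l)).
rewrite -[om_X j (om_fun i l)]/(FX_fun c j (om_fun i l)).
rewrite /FX_fun /om_fun.
have cS : (c == c.+1) = false by rewrite ltn_eqF.
have Sc : (c.+1 == c) = false by rewrite gtn_eqF.
case: (eqVneq i c) => [?|ic]; last case: (eqVneq i c.+1) => [?|iSc];
(case: (eqVneq j c) => [?|jc]; last case: (eqVneq j c.+1) => [?|jSc]);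
repeat match goal with
  | H : _ = c |- _ => rewrite ?H; clear H
  | H : _ = c.+1 |- _ => rewrite ?H; clear H end;
rewrite ?eqxx ?cS ?Sc; apply: injective_projections; rewrite ?pairE /=;
alinX L [:: c; c.+1; i; j].
Qed.

Lemma E_C i j w : mklin (E_lin i) (mklin (E_lin j) w) = mklin (E_lin j) (mklin (E_lin i) w).
Proof.
case: w => b l; apply: injective_projections; last exact: om_C.
rewrite -[LHS]/(om_X i (om_X j b + om_fun j l) + om_fun i (om_X j l)).
rewrite -[RHS]/(om_X j (om_X i b + om_fun i l) + om_fun j (om_X i l)).
by rewrite !linearD om_C -!addrA om_comm.
Qed.

Definition E : opmod A := OpMod E_C.

Definition E_in : {linear BL -> E} := mklin (lin_pair (@lin_id A BL) (@lin_0 A BL L)).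
Definition E_rh : {linear E -> BL} := mklin (lin_fst (@lin_id A E)).
Definition E_sg : {linear L -> E} := mklin (lin_pair (@lin_0 A L BL) (@lin_id A L)).
Definition E_pr : {linear E -> L} := mklin (lin_snd (@lin_id A E)).
Definition E_phi : {linear E -> BL} := mklin (lin_add
  (lin_comp (dif y BL c.+1) (lin_fst (@lin_id A E))) (lin_comp B_s (lin_snd (@lin_id A E)))).

Lemma E_in_equiv : oequiv E_in.
Proof.
move=> i b; apply: injective_projections => /=; last by rewrite linear0.
by rewrite /om_fun oppr0 !if_same addr0.
Qed.

Lemma E_pr_equiv : oequiv E_pr. Proof. by []. Qed.

Lemma dif_om i l : dif y BL c.+1 (om_fun i l) = om_X i (B_s l) - B_s (om_X i l).
Proof.
rewrite B_dif /om_fun scaler0 addr0 -[om_X i (B_s l)]/(FX_fun c i (l, 0)) /FX_fun /=.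
case: (eqVneq i c) => [->|ic]; last case: (eqVneq i c.+1) => [->|iSc].
all: apply: injective_projections; rewrite ?pairE /=.
all: by rewrite ?linear0 ?oppr0 ?opprK ?subr0 ?addr0 ?add0r ?subrr ?addrK ?linearN // ?sub0r.
Qed.

Lemma E_phi_equiv : oequiv E_phi.
Proof.
move=> i [b l].
rewrite -[LHS]/(dif y BL c.+1 (om_X i b + om_fun i l) + B_s (om_X i l)).
rewrite -[RHS]/(om_X i (dif y BL c.+1 b + B_s l)) !linearD dif_om -addrA subrK.
by congr (_ + _); rewrite om_C [om_X i (- _)]linearN -[scl _ _ b]/(y c.+1 *: b) linearZ.
Qed.

(** The functor F_u, whose letters do not involve the variable c + 1, and the Koszul complex
    on the variables 0, .., c are applied to all of the above. *)
Section Word.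
Variables (u : seq nat) (uc : all (gtn c) u).
Let m := c.+1.

Definition Gl (V W : opmod A) (f : {linear V -> W}) : {linear Fw u V -> Fw u W} :=
  mklin (Gmap_lin (a := word u) (fun r x z => linearP f r x z)).
Definition Kg (V W : opmod A) (f : {linear V -> W}) : {linear K (Fw u V) m -> K (Fw u W) m} :=
  Kmap m (Gl f).

Lemma Kg_comp (U V W : opmod A) (f : {linear U -> V}) (g : {linear V -> W})
  (h : {linear U -> W}) z : (forall v, h v = g (f v)) -> Kg h z = Kg g (Kg f z).
Proof.
by move=> E; apply: Kmap_comp => v; rewrite /= Gmap_comp; apply: Gmap_ext.
Qed.

Lemma Kg_id (V : opmod A) (f : {linear V -> V}) z : f =1 id -> Kg f z = z.
Proof. by move=> E; apply: Kmap_id => v; rewrite -[RHS]Gmap_id; apply: Gmap_ext. Qed.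

Lemma Kg_add (V W : opmod A) (f g h : {linear V -> W}) z :
  (forall v, f v = g v + h v) -> Kg f z = Kg g z + Kg h z.
Proof.
by move=> E; apply: Kmap_add => v; rewrite /= -Gmap_addf; apply: Gmap_ext.
Qed.

Lemma Kg_sub (V W : opmod A) (f g h : {linear V -> W}) z :
  (forall v, f v = g v - h v) -> Kg f z = Kg g z - Kg h z.
Proof.
by move=> E; apply/(addIr (Kg h z)); rewrite subrK; apply/esym/Kg_add => v; rewrite E subrK.
Qed.

Lemma Kg_0 (V W : opmod A) (f : {linear V -> W}) z : (forall v, f v = 0) -> Kg f z = 0.
Proof.
move=> f0; apply: (addrI (Kg f z)); rewrite addr0 -(@Kg_add _ _ f f f) // => v.
by rewrite f0 addr0.
Qed.

Lemma Kg_D (V W : opmod A) (f : {linear V -> W}) z : oequiv f ->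
  Kg f (KD m (dif y (Fw u V)) z) = KD m (dif y (Fw u W)) (Kg f z).
Proof.
move=> fE; apply: KD_nat => i v _; apply: dif_nat; apply: Gmap_X => //.
exact: linearD.
Qed.

Lemma dif_G (V : opmod A) z : dif y (Fw u V) m z = Gl (dif y V m) z.
Proof.
rewrite -[LHS]/(om_X m z - y m *: z) (@G_X_out _ u); last first.
  by apply: sub_all uc => j /=; rewrite /m; lia.
rewrite -Gmap_scale; apply: (addIr (Gmap (word u) (fun v => y m *: v) z)).
by rewrite subrK -Gmap_addf; apply: Gmap_ext => v; rewrite /= subrK.
Qed.

Let D := KD m (dif y (Fw u BL)).
Let D' := KD m (dif y (Fw u L)).
Let DE := KD m (dif y (Fw u E)).
Let Om : {linear K (Fw u L) m -> K (Fw u BL) m} := Kg E_rh \o (DE \o Kg E_sg).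

(** Om is the connecting map of the extension of Koszul complexes that E defines: it is
    the component in B_c L of the differential of a lift. Hence it anticommutes with the
    differentials (D_Om), and E_phi shows that it corrects B_s (dif_Om). *)
Lemma DE_sg z : DE (Kg E_sg z) = Kg E_in (Om z) + Kg E_sg (D' z).
Proof.
have E1 x : x = Kg E_in (Kg E_rh x) + Kg E_sg (Kg E_pr x).
  rewrite -(@Kg_comp _ _ _ _ _ (E_in \o E_rh)) // -(@Kg_comp _ _ _ _ _ (E_sg \o E_pr)) //.
  rewrite -(@Kg_add _ _ idfun) ?Kg_id // => -[b l].
  by apply: injective_projections; rewrite /= ?pairE /= ?addr0 ?add0r.
rewrite [LHS]E1 (Kg_D _ E_pr_equiv).
by rewrite -(@Kg_comp _ _ _ E_sg E_pr idfun) // Kg_id.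
Qed.

Lemma dif_Om z : Kg (dif y BL m) (Om z) = D (Kg B_s z) - Kg B_s (D' z).
Proof.
have := congr1 (Kg E_phi) (DE_sg z).
rewrite (Kg_D _ E_phi_equiv).
rewrite linearD -(@Kg_comp _ _ _ E_sg E_phi B_s) => [|v]; last first.
  by rewrite /= -[X in X + _]/(dif y BL c.+1 0) linear0 add0r.
rewrite -(@Kg_comp _ _ _ E_sg E_phi B_s) => [|v]; last first.
  by rewrite /= -[X in X + _]/(dif y BL c.+1 0) linear0 add0r.
rewrite -(@Kg_comp _ _ _ E_in E_phi (dif y BL m)) => [|v]; last first.
  by rewrite -[RHS]/(dif y BL m v + 0) addr0.
by move=> E1; rewrite -/D in E1; rewrite E1 addrK.
Qed.

Lemma D_Om z : D (Om z) = - Om (D' z).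
Proof.
have := congr1 DE (DE_sg z); rewrite KD_sq; last exact: dif_C.
rewrite linearD DE_sg [D' (D' z)]KD_sq; last exact: dif_C.
rewrite [Kg _ 0]linear0 addr0 -(Kg_D _ E_in_equiv).
move/(congr1 (Kg E_rh)); rewrite linear0 linearD.
rewrite -!(@Kg_comp _ _ _ E_in E_rh idfun) // !Kg_id // => /esym/eqP.
by rewrite addr_eq0 => /eqP.
Qed.

Theorem split_cone : ksplit y m (Fw u L) -> ksplit y m.+1 (Fw u BL).
Proof.
move=> [h hP].
have := @cone_invP A _ _ D (Kg (dif y BL m)) (Kg B_t) D' h (Kg B_i) (Kg B_s) Om (Kg B_p) (Kg B_j).
have := @cone_inv_lin A _ _ D (Kg (dif y BL m)) (Kg B_t) h (Kg B_i) (Kg B_s) Om (Kg B_p) (Kg B_j).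
set H := cone_inv _ _ _ _ _ _ _ _ _ => HL HP.
have E1 z : KD m.+1 (dif y (Fw u BL)) z = coneD_fun D (Kg (dif y BL m)) z.
  congr (_, _).
  rewrite -[LHS]/(Kmap m (dif y (Fw u BL) m) z.1 - D z.2).
  by rewrite (Kmap_ext (g := Gl (dif y BL m))) // => v; apply: dif_G.
exists (mklin HL) => z; rewrite !E1; apply: HP => //.
- by move=> x; apply: KD_sq; apply: dif_C.
- move=> x; apply: KD_nat => j v _.
  by rewrite -!dif_G dif_C.
- by move=> x; apply: Kg_D; apply: B_i_equiv.
- by move=> x; apply: Kg_D; apply: B_p_equiv.
- by move=> x; rewrite -(@Kg_comp _ _ _ B_i B_j idfun) // Kg_id.
- move=> x; rewrite -(@Kg_comp _ _ _ B_j B_i (B_i \o B_j)) //.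
  rewrite -(@Kg_comp _ _ _ (dif y BL m) B_t (B_t \o dif y BL m)) //.
  rewrite -{2}[x](@Kg_id _ idfun) //; apply: Kg_sub; exact: B_ij.
- by move=> x; rewrite -(@Kg_comp _ _ _ B_s B_p idfun) ?Kg_id // => v; rewrite B_ps.
- move=> x; rewrite -(@Kg_comp _ _ _ B_p B_s (B_s \o B_p)) //.
  rewrite -(@Kg_comp _ _ _ B_t (dif y BL m) (dif y BL m \o B_t)) //.
  rewrite -{2}[x](@Kg_id _ idfun) //; apply: Kg_sub; exact: B_dt.
- move=> x; rewrite -(@Kg_comp _ _ _ (dif y BL m) B_p (B_p \o dif y BL m)) //.
  exact/Kg_0/B_pd.
- move=> x; rewrite -(@Kg_comp _ _ _ B_i (dif y BL m) (dif y BL m \o B_i)) //.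
  exact/Kg_0/B_di.
- exact: dif_Om.
- exact: D_Om.
Qed.
End Word.
End ConeOfB.

Section SplitWords.
Variables (A : comPzRingType) (y : nat -> A) (B : opmod A).
Hypothesis XB : forall i (v : B), om_X i v = y i *: v.

Lemma om_X_word w j (z : Fw w B) : all (fun i => (j != i) && (j != i.+1)) w ->
  om_X j z = y j *: z.
Proof. by move=> /G_X_out ->; rewrite -Gmap_scale; apply: Gmap_ext => v; apply: XB. Qed.

(** The letter c = m.-1 is the only one that involves the variable m. If it does not occur, X_m
    acts as y_m; otherwise the word is u c v with u and v in letters smaller than c, and
    the complex of F_u F_v B is the one of the induction hypothesis. *)
Theorem split_word m w : all (fun i => i.+1 < m)%N w -> ksplit y m (Fw w B).
Proof.
elim: m w => [|m IHm] w Hw; first exact: split_0.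
have /reduce_word Hg : all (gtn m) w by apply: sub_all Hw => i /=; lia.
apply: split_gen _ (Hg A B) => _ [w' [w'm nw'] ->].
have out (s : seq nat) : all (fun i => i.+1 < m)%N s -> forall v : Fw s B, om_X m v = y m *: v.
  by move=> sm v; apply: om_X_word; apply: sub_all sm => i /=; lia.
have [mw'|mw'] := boolP (m.-1 \in w'); last first.
  have w'm' : all (fun i => i.+1 < m)%N w'.
    apply/allP => i iw'; have := allP w'm i iw'; have : i != m.-1.
      by apply: contra mw' => /eqP <-.
    by rewrite /=; lia.
  by apply: split_S _ (IHm _ w'm') => v; rewrite -[LHS]/(om_X m v - y m *: v) out // subrr.
case: m => [|c] in IHm Hw Hg w'm nw' out mw' *; first by have := allP w'm _ mw'.
rewrite /= in mw' nw'; case/splitPr: mw' w'm nw' => u v.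
rewrite all_cat count_cat /= eqxx => /and3P[uc _ vc] nuv.
have [nu nv] : count_mem c u = 0%N /\ count_mem c v = 0%N.
  by move: nuv; rewrite addnCA add1n ltnS leqn0 addn_eq0 => /andP[/eqP-> /eqP->].
have lt s : all (gtn c.+1) s -> count_mem c s = 0%N -> all (gtn c) s.
  move=> sc /count_memPn cs; apply/allP => j js; have := allP sc j js.
  have : j != c by apply: contra cs => /eqP <-.
  by rewrite /=; lia.
rewrite Fw_cat /=; apply: split_cone.
- by apply: out; apply: sub_all (lt _ vc nv) => i /=; lia.
- exact: lt.
rewrite -Fw_cat; apply: IHm; rewrite all_cat; apply/andP; split.
  by apply: sub_all (lt _ uc nu) => i /=; lia.
by apply: sub_all (lt _ vc nv) => i /=; lia.
Qed.

Fixpoint in_range n a := match a with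
  | SId => true
  | SSum a b => in_range n a && in_range n b
  | SF i a => (i.+1 < n)%N && in_range n a
  end.

Theorem split_shape n a : in_range n a -> ksplit y n (G a B).
Proof.
move=> Ha; apply: (@split_gen _ _ _ (fun U => exists2 w, all (fun i => i.+1 < n)%N w & U = Fw w B)).
  by move=> _ [w Hw ->]; exact: split_word.
elim: a Ha => [_|a IHa b IHb /andP[/IHa Ga /IHb Gb]|i a IHa /andP[ni /IHa Ga]] /=.
- by apply: gen_base; exists [::].
- exact: gen_sum.
- apply: gen_F Ga => _ [w Hw ->]; apply: gen_base; exists (i :: w) => //=.
  by rewrite ni.
Qed.
End SplitWords.

(** * Bimodules as modules with operators *)

Lemma mpoly_gen_ind (k : fieldType) n (P : {mpoly k[n]} -> Prop) :
  (forall c, P c%:MP) -> (forall i, P 'X_i) -> (forall p q, P p -> P q -> P (p + q)) ->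
  (forall p q, P p -> P q -> P (p * q)) -> forall p, P p.
Proof.
move=> PC PX PD PM; elim/mpolyind => [|c m p _ _ Pp]; first by rewrite -mpolyC0; apply: PC.
apply: PD => //; rewrite -mul_mpolyC; apply: (PM) => //; rewrite mpolyXE_id.
elim/big_ind: _ => [||i _]; [by rewrite -mpolyC1; apply: PC|exact: PM|].
by elim: (m i) => [|e IHe]; rewrite ?expr0 -?mpolyC1 // exprS; apply: PM.
Qed.

Lemma renX (k : fieldType) n n' (h : 'I_n -> 'I_n') i : ren h ('X_i : {mpoly k[n]}) = 'X_(h i).
Proof. by rewrite /ren comp_mpolyXU -tnth_nth tnth_mktuple. Qed.

Section Opm.
Variables (k : fieldType) (n : nat).
Local Notation R := {mpoly k[n]}.
Local Notation S := {mpoly k[n + n]}.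

(** The value outside of the range is 0, so that X_i - y_i is 0 for n <= i. *)
Definition yv (i : nat) : R := if insub i is Some j then 'X_j else 0.

Lemma yv_ord (j : 'I_n) : yv j = 'X_j.
Proof. by rewrite /yv valK. Qed.

Section OpmDef.
Variable V : gbimod k n.
Local Notation rV := (restr (@rshift n n) V).

Definition opm_fun i (v : rV) : rV := ren (@lshift n n) (yv i) *: (v : V).

Lemma opm_lin i : linear (opm_fun i).
Proof.
move=> r u v; rewrite /opm_fun.
rewrite -[r *: u + v]/(ren (@rshift n n) r *: (u : V) + (v : V)) scalerDr scalerA mulrC -scalerA.
by [].
Qed.

Lemma opm_C i j v : mklin (opm_lin i) (mklin (opm_lin j) v) = mklin (opm_lin j) (mklin (opm_lin i) v).
Proof. by rewrite /= /opm_fun !scalerA mulrC. Qed.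

(** A bimodule as a right module with commuting endomorphisms. *)
Definition opm : opmod R := OpMod opm_C.
End OpmDef.

Lemma opm_XE (M : gbimod k n) i (v : opm M) : om_X i v = lact (yv i) (v : M).
Proof. by []. Qed.

Lemma opm_scaleE (M : gbimod k n) r (v : opm M) : r *: v = ract (v : M) r.
Proof. by []. Qed.

Lemma opm_sym (M : gbimod k n) : (forall p (v : M), lact p v = ract v p) ->
  forall i (v : opm M), om_X i v = yv i *: v.
Proof. by move=> H i v; rewrite opm_XE opm_scaleE H. Qed.

Lemma Rbim_sym p (v : Rbim k n) : lact p v = ract v p.
Proof. exact: (etrans (Rbim_lact p v) (etrans (mulrC p (v : {mpoly k[n]})) (esym (Rbim_ract p v)))). Qed.

Lemma opm_Rbim i (v : opm (Rbim k n)) : om_X i v = yv i *: v.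
Proof. exact: (opm_sym Rbim_sym). Qed.

(** The bimodules are direct summands of sums of words in the functors F_i applied to R. *)
Definition good (M : gbimod k n) :=
  exists2 a, in_range n a & retr (opm M) (G a (opm (Rbim k n))).

Lemma retr_bij (A : comPzRingType) (V W : opmod A) (f : V -> W) (g : W -> V) :
  linear g -> oequiv g -> cancel f g -> cancel g f -> retr V W /\ retr W V.
Proof.
move=> gL gE fK gK.
have fE : oequiv f by move=> j v; apply: (can_inj gK); rewrite fK gE fK.
have fL : linear f.
  by move=> r u v; apply: (can_inj gK); rewrite fK gL !fK.
by split; [apply: (retr_intro fL gL)|apply: (retr_intro gL fL)].
Qed.

(** The uniqueness part of the universal property. *)
Lemma tens_ext P (M N T : gbimod k n) (t : M -> N -> T) (tP : is_tensor_over P t)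
    (Z : zmodType) (f g : {additive T -> Z}) :
  (forall u v, f (t u v) = g (t u v)) -> f =1 g.
Proof.
move=> fg.
have [| | |h hP hU] := tens_univ tP (Z := Z) (g := fun u v => f (t u v)).
- by move=> u u' v; rewrite (tens_Dl tP) raddfD.
- by move=> u v v'; rewrite (tens_Dr tP) raddfD.
- by move=> p u v Pp; rewrite (tens_bal tP).
by move=> x; rewrite hU // -(hU g) // => u v; rewrite fg.
Qed.

Lemma lactD (M : gbimod k n) p (u v : M) : lact p (u + v) = lact p u + lact p v.
Proof. exact: scalerDr. Qed.
Lemma ractD (M : gbimod k n) p (u v : M) : ract (u + v) p = ract u p + ract v p.
Proof. exact: scalerDr. Qed.
Lemma lactDl (M : gbimod k n) p q (u : M) : lact (p + q) u = lact p u + lact q u.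
Proof. by rewrite /lact raddfD scalerDl. Qed.
Lemma lactM (M : gbimod k n) p q (u : M) : lact (p * q) u = lact p (lact q u).
Proof. by rewrite /lact rmorphM scalerA. Qed.

End Opm.

(** Divided differences: R is free over the polynomials symmetric in x_i and x_j, with basis
    1, x_i. Existence holds on the variables and passes to sums and products; uniqueness
    follows as the transposition maps x_i to x_j != x_i. *)
Section DividedDifferences.
Variables (k : fieldType) (n : nat) (i j : 'I_n).
Hypothesis ij : i != j.
Local Notation R := {mpoly k[n]}.
Local Notation s := (msym (tperm i j) : R -> R).

Lemma msym_X l : s 'X_l = 'X_(tperm i j l).
Proof. by rewrite /msym mmapX mmap1U. Qed.

Lemma sym2D p q : sym2 i j p -> sym2 i j q -> sym2 i j (p + q : R).
Proof. by rewrite /sym2 msymD => -> ->. Qed.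
Lemma sym2M p q : sym2 i j p -> sym2 i j q -> sym2 i j (p * q : R).
Proof. by rewrite /sym2 msymM => -> ->. Qed.
Lemma sym2C c : sym2 i j (c%:MP : R).
Proof. by rewrite /sym2 -[c%:MP]mulr1 mul_mpolyC msymZ msym1. Qed.
Lemma sym2_e1 : sym2 i j ('X_i + 'X_j : R).
Proof. by rewrite /sym2 msymD !msym_X tpermL tpermR addrC. Qed.
Lemma sym2_e2 : sym2 i j ('X_i * 'X_j : R).
Proof. by rewrite /sym2 msymM !msym_X tpermL tpermR mulrC. Qed.
Lemma sym2_X l : l != i -> l != j -> sym2 i j ('X_l : R).
Proof. by move=> li lj; rewrite /sym2 msym_X tpermD // eq_sym. Qed.

Lemma sym2_decomp (p : R) :
  exists p0 p1, [/\ sym2 i j p0, sym2 i j p1 & p = p0 + p1 * 'X_i].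
Proof.
have s0 : sym2 i j (0 : R) by rewrite -mpolyC0; apply: sym2C.
have s1 : sym2 i j (1 : R) by rewrite -mpolyC1; apply: sym2C.
elim/mpoly_gen_ind: p => [c|l|p q [p0 [p1 [Hp0 Hp1 ->]]] [q0 [q1 [Hq0 Hq1 ->]]]|
    p q [p0 [p1 [Hp0 Hp1 ->]]] [q0 [q1 [Hq0 Hq1 ->]]]].
- by exists c%:MP, 0; rewrite mul0r addr0; split=> //; apply: sym2C.
- have [->|li] := eqVneq l i; first by exists 0, 1; rewrite add0r mul1r.
  have [->|lj] := eqVneq l j.
    exists ('X_i + 'X_j), (- 1); split; first exact: sym2_e1.
      by rewrite /sym2 msymN msym1.
    by rewrite mulN1r addrAC subrr add0r.
  by exists 'X_l, 0; rewrite mul0r addr0; split=> //; apply: sym2_X.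
- exists (p0 + q0), (p1 + q1); split; try exact: sym2D.
  by rewrite mulrDl addrACA.
exists (p0 * q0 - 'X_i * 'X_j * (p1 * q1)), (p0 * q1 + p1 * q0 + ('X_i + 'X_j) * (p1 * q1)).
split; last by ring.
  apply: sym2D; first exact: sym2M.
  rewrite /sym2 msymN; congr (- _); apply: sym2M; [exact: sym2_e2|exact: sym2M].
by do 2?apply: sym2D; try exact: sym2M; apply: sym2M; [exact: sym2_e1|exact: sym2M].
Qed.

Lemma sym2_uniq (p0 p1 q0 q1 : R) : sym2 i j p0 -> sym2 i j p1 -> sym2 i j q0 -> sym2 i j q1 ->
  p0 + p1 * 'X_i = q0 + q1 * 'X_i -> p0 = q0 /\ p1 = q1.
Proof.
move=> s0 s1 s0' s1' E.
have E' := congr1 s E; rewrite !msymD !msymM s0 s1 s0' s1' msym_X tpermL in E'.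
have /eqP : (p1 - q1) * ('X_i - 'X_j) = 0 :> R.
  rewrite mulrBl !mulrBr.
  have -> : p1 * 'X_i = q0 + q1 * 'X_i - p0 by rewrite -E addrC addKr.
  have -> : p1 * 'X_j = q0 + q1 * 'X_j - p0 by rewrite -E' addrC addKr.
  by ring.
have Xij : ('X_i - 'X_j : R) != 0.
  rewrite subr_eq0; apply: contra ij => /eqP /(congr1 (mcoeff U_(i))).
  by rewrite !mcoeffXU eqxx; case: (j == i) / eqP => [-> //|_] /eqP; rewrite oner_eq0.
rewrite mulf_eq0 (negbTE Xij) orbF subr_eq0 => /eqP E1; split=> //.
by move: E; rewrite E1 => /addIr.
Qed.

Definition dd (p : R) : R * R :=
  let w := cid (sym2_decomp p) in (projT1 w, projT1 (cid (projT2 w))).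

Lemma ddP p : [/\ sym2 i j (dd p).1, sym2 i j (dd p).2 & p = (dd p).1 + (dd p).2 * 'X_i].
Proof. by rewrite /dd /=; case: cid => p0 /= H; case: cid. Qed.

Lemma ddE p p0 p1 : sym2 i j p0 -> sym2 i j p1 -> p = p0 + p1 * 'X_i -> dd p = (p0, p1).
Proof.
move=> s0 s1 E; have [t0 t1 E'] := ddP p.
have [<- <-] := sym2_uniq t0 t1 s0 s1 (etrans (esym E') E).
exact: surjective_pairing.
Qed.

Lemma ddD p q : dd (p + q) = ((dd p).1 + (dd q).1, (dd p).2 + (dd q).2).
Proof.
have [s0 s1 E] := ddP p; have [t0 t1 F] := ddP q.
by apply: ddE; [exact: sym2D|exact: sym2D|rewrite {1}E {1}F; ring].
Qed.

Lemma dd_sym r p : sym2 i j r -> dd (p * r) = ((dd p).1 * r, (dd p).2 * r).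
Proof.
move=> sr; have [s0 s1 E] := ddP p.
by apply: ddE; [exact: sym2M|exact: sym2M|rewrite {1}E; ring].
Qed.
End DividedDifferences.

Section Good.
Variables (k : fieldType) (n : nat).
Local Notation R := {mpoly k[n]}.

Lemma opm_map_lin (M N : gbimod k n) (f : ghom M N) : linear (f : opm M -> opm N).
Proof. by move=> r u v; apply: (gfun_lin f). Qed.

Lemma retr_gsum (M N : gbimod k n) : retr (opm (gsum M N)) (osum (opm M) (opm N)).
Proof. by apply: (@retr_intro _ (opm (gsum M N)) (osum (opm M) (opm N)) id id). Qed.

(** The inclusion and the projection of a summand form a retract. *)
Lemma good_summand (M N N' : gbimod k n) : gm_iso M (gsum N N') -> retr (opm N) (opm M).
Proof.
case=> f [g fK gK].
have gL (p : {mpoly k[n + n]}) (u v : gsum N N') : g (p *: u + v) = p *: g u + g v.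
  by apply: (can_inj fK); rewrite gK (gfun_lin f) !gK.
have g0 : g 0 = 0 by apply: (can_inj fK); rewrite gK linear0.
have gZ p (u : gsum N N') : g (p *: u) = p *: g u by rewrite -[p *: u]addr0 gL g0 addr0.
apply: (@retr_intro _ (opm N) (opm M) (fun v => g (v, 0)) (fun v => (f v).1)).
- move=> r u v; rewrite !opm_scaleE /ract -gL; congr (g (_, _)).
  by rewrite /= scaler0 addr0.
- by move=> r u v; rewrite !opm_scaleE /ract (gfun_lin f).
- move=> j v; rewrite !opm_XE /lact -gZ; congr (g (_, _)).
  by rewrite /= scaler0.
- by move=> j v; rewrite !opm_XE /lact [f _](linearZ_LR f).
- by move=> v; rewrite gK.
Qed.

(** B_i is F_i applied to R. Here B0 is R as a bimodule, identified with R by rb and br.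
    The inverse of B_from decomposes the left factor by divided differences. *)
Section GoodB.
Variables (B0 : gbimod k n) (rb : R -> B0) (br : B0 -> R).
Hypotheses (rbK : cancel rb br) (brK : cancel br rb).
Hypotheses (rbD : forall p q, rb (p + q) = rb p + rb q).
Hypotheses (lact_rb : forall p q, lact p (rb q) = rb (p * q)).
Hypotheses (ract_rb : forall p q, ract (rb q) p = rb (q * p)).
Variables (i j : 'I_n) (ij : j = i.+1 :> nat) (T : gbimod k n).
Variables (t : B0 -> B0 -> T) (tP : is_tensor_over (sym2 i j) t).

Let neq_ij : i != j.
Proof. by apply/eqP => E; move: ij; rewrite E; lia. Qed.

Definition B_from (w : Fi i (opm (B0))) : opm T := t (rb 1) w.1 + t (rb 'X_i) w.2.

Lemma t0r u : t u 0 = 0.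
Proof. by apply: (addrI (t u 0)); rewrite -(tens_Dr tP) !addr0. Qed.
Lemma tNr u v : t u (- v) = - t u v.
Proof. by apply/eqP; rewrite -addr_eq0 -(tens_Dr tP) addNr t0r. Qed.

Lemma B_from_lin : linear B_from.
Proof.
move=> r [u0 u1] [v0 v1].
rewrite -[LHS]/(t (rb 1) (r *: u0 + v0) + t (rb 'X_i) (r *: u1 + v1)).
by rewrite !(tens_Dr tP) !opm_scaleE !(tens_r tP) ractD addrACA.
Qed.

Lemma tbal p q v : sym2 i j p -> t (rb (q * p)) v = t (rb q) (lact p v).
Proof. by move=> sp; rewrite -ract_rb (tens_bal tP). Qed.

Lemma B_from_equiv : oequiv B_from.
Proof.
move=> l [u v].
have yi : yv k n i = 'X_i := yv_ord k i.
have yj : yv k n i.+1 = 'X_j by rewrite -ij yv_ord.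
rewrite -[om_X l ((u, v) : Fi i (opm B0))]/(FX_fun i l (u, v)) /FX_fun.
have tb p q w : sym2 i j q -> t (rb p) (lact q w) = t (rb (p * q)) w.
  by move=> sq; rewrite tbal.
have tD p q w : t (rb p) w + t (rb q) w = t (rb (p + q)) w.
  by rewrite rbD (tens_Dl tP).
have tN p w : - t (rb p) w = t (rb (- p)) w.
  apply/eqP; rewrite eq_sym -addr_eq0 tD addNr; apply/eqP.
  by apply: (addrI (t (rb 0) w)); rewrite tD !addr0.
have s1 := @sym2_e1 k n i j; have s2 := @sym2_e2 k n i j.
have [->|li] := eqVneq l i; last have [->|lj] := eqVneq l i.+1.
- rewrite /B_from !opm_XE yi yj lactD -!(tens_l tP) !lact_rb /=.
  rewrite tNr -lactM tb // -addrA -lactDl (tens_Dr tP) tb // addrCA mulr1; congr (_ + _).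
  by rewrite tN tD; congr (t (rb _) v); ring.
- rewrite /B_from !opm_XE yi yj lactD -!(tens_l tP) !lact_rb /=.
  rewrite tNr -lactM -lactDl (tens_Dr tP) !tb // addrAC tN tD; congr (_ + _).
    by congr (t (rb _) u); ring.
  by congr (t (rb _) v); ring.
have sl : sym2 i j (yv k n l).
  rewrite /yv; case: insubP => [o _ lo|_]; last by rewrite -mpolyC0; apply: sym2C.
  by apply: sym2_X; [apply: contra li|apply: contra lj] => /eqP E; apply/eqP; rewrite -lo E //=.
rewrite /B_from !opm_XE lactD -!(tens_l tP) !lact_rb /=.
by rewrite !tb // mulr1 mul1r [yv k n l * _]mulrC.
Qed.

Lemma retr_B : retr (opm T) (Fi i (opm B0)).
Proof.
pose d (p : R) := dd i j p.
pose g (p q : B0) : (B0 * B0)%type := (lact (d (br p)).1 q, lact (d (br p)).2 q).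
have brD p q : br (p + q) = br p + br q by apply: (can_inj rbK); rewrite rbD !brK.
have [| | |h hP _] := tens_univ tP (Z := (B0 * B0)%type) (g := g).
- by move=> p p' q; rewrite /g /d brD (ddD neq_ij);
    apply: injective_projections; rewrite ?pairE /= lactDl.
- by move=> p q q'; rewrite /g; apply: injective_projections; rewrite ?pairE /= lactD.
- move=> p u v sp; rewrite -[u]brK ract_rb /g !rbK /d (dd_sym neq_ij) //.
  by rewrite !lactM.
have hB : cancel B_from h.
  move=> [u v]; rewrite /B_from raddfD /= !hP /g !rbK.
  have s0 : sym2 i j (0 : R) by rewrite -mpolyC0; apply: sym2C.
  have s1 : sym2 i j (1 : R) by rewrite -mpolyC1; apply: sym2C.
  rewrite /d (@ddE _ _ _ _ neq_ij 1 1 0) ?mul0r ?addr0 //.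
  rewrite (@ddE _ _ _ _ neq_ij 'X_i 0 1) ?mul1r ?add0r //=.
  have l1 w : lact (1 : R) w = w :> B0 by rewrite -[w]brK lact_rb mul1r.
  have l0 w : lact (0 : R) w = 0 :> B0.
    by rewrite -[w]brK lact_rb mul0r; apply: (addrI (rb 0)); rewrite -rbD !addr0.
  by rewrite !l1 !l0; apply: injective_projections; rewrite ?pairE /= ?addr0 ?add0r.
have Bh : cancel h B_from.
  have BhB : zmod_morphism (fun x => B_from (h x)).
    by move=> x x'; rewrite raddfB; apply: (linearB (mklin B_from_lin)).
  move=> x; apply: (@tens_ext _ _ _ _ _ _ t tP _ (HB.pack (fun x => B_from (h x))
    (GRing.isZmodMorphism.Build T T (fun x => B_from (h x)) BhB)) idfun) => u v /=.
  rewrite -[LHS]/(B_from (h (t u v))) hP /g /d; have [S0 S1 E] := ddP i j (br u).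
  rewrite /B_from -[LHS]/(t (rb 1) (lact (dd i j (br u)).1 v) + t (rb 'X_i) (lact (dd i j (br u)).2 v)).
  rewrite -!tbal // mul1r -(tens_Dl tP) -rbD mulrC -E brK.
  by [].
exact: (proj1 (retr_bij B_from_lin B_from_equiv Bh hB)).
Qed.
End GoodB.
End Good.

(** * Tensor products of Soergel bimodules *)

Definition mkadd (U V : zmodType) (f : U -> V) (fB : zmod_morphism f) : {additive U -> V} :=
  HB.pack f (GRing.isZmodMorphism.Build U V f fB).

Lemma zmod_morphD (U V : zmodType) (f : U -> V) : {morph f : u v / u + v} -> zmod_morphism f.
Proof.
move=> fD u v; apply: (addIr (f v)); by rewrite -fD !subrK.
Qed.

Section Tensor.
Variables (k : fieldType) (n : nat).
Local Notation R := {mpoly k[n]}.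
Variables (B0 : gbimod k n) (rb : R -> B0) (br : B0 -> R).
Hypotheses (rbK : cancel rb br) (brK : cancel br rb).
Hypotheses (rbD : forall p q, rb (p + q) = rb p + rb q).
Hypotheses (lact_rb : forall p q, lact p (rb q) = rb (p * q)).
Hypotheses (ract_rb : forall p q, ract (rb q) p = rb (q * p)).
Variables (M N T : gbimod k n) (t : M -> N -> T).
Hypothesis tP : is_tensor_over (fun _ => True) t.

(** If M is a summand of G_a(R), then M (x) N is a summand of G_a(N), since G_a(R) (x) N
    is G_a(N). The map rho v : r |-> r v from R to N induces u (x) v |-> G_a(rho v)(u)
    in one direction, and ev is the map in the other direction, followed by the
    projection p of G_a(R) to M. *)
Definition rho (v : N) (w : opm B0) : opm N := lact (br w) v.

Lemma brD p q : br (p + q) = br p + br q.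
Proof. by apply: (can_inj rbK); rewrite rbD !brK. Qed.
Lemma br_lact p w : br (lact p w) = p * br w.
Proof. by rewrite -[w in LHS]brK lact_rb rbK. Qed.

Lemma lact_ract (L : gbimod k n) p q (v : L) : lact p (ract v q) = ract (lact p v) q.
Proof. by rewrite /lact /ract !scalerA mulrC. Qed.

Lemma rhoD v : {morph rho v : u w / u + w}.
Proof. by move=> u w; rewrite /rho brD lactDl. Qed.
Lemma rho_equiv v : oequiv (rho v).
Proof. by move=> j w; rewrite /rho !opm_XE br_lact lactM. Qed.

Fixpoint ev a : (G a (opm B0) -> opm M) -> G a (opm N) -> opm T :=
  match a return (G a (opm B0) -> opm M) -> G a (opm N) -> opm T with
  | SId => fun p v => t (p (rb 1)) v
  | SSum a b => fun p z => ev (fun w => p (w, 0)) z.1 + ev (fun w => p (0, w)) z.2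
  | SF i a => fun p z => ev (fun w => p (w, 0)) z.1 + ev (fun w => p (0, w)) z.2
  end.

Lemma evD a p : {morph ev (a := a) p : u w / u + w}.
Proof.
elim: a p => [|a IHa b IHb|i a IHa] p u w; first exact: (tens_Dr tP).
  by rewrite -[LHS]/(ev _ (u.1 + w.1) + ev _ (u.2 + w.2)) IHa IHb addrACA.
by rewrite -[LHS]/(ev _ (u.1 + w.1) + ev _ (u.2 + w.2)) !IHa addrACA.
Qed.

Lemma ev_rho a p z v : linear p -> ev (a := a) p (Gmap a (rho v) z) = t (p z) v.
Proof.
have l1 (U V W : lmodType R) (f : (U * V)%type -> W) : linear f -> linear (fun u => f (u, 0)).
  by move=> fL r u u'; rewrite -fL; congr (f (_, _)); rewrite /= scaler0 addr0.
have l2 (U V W : lmodType R) (f : (U * V)%type -> W) : linear f -> linear (fun u => f (0, u)).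
  by move=> fL r u u'; rewrite -fL; congr (f (_, _)); rewrite /= scaler0 addr0.
have l3 (U V W : lmodType R) (f : (U * V)%type -> W) u w : linear f ->
    f (u, w) = f (u, 0) + f (0, w).
  move=> fL; rewrite -[f (u, 0)]scale1r -fL; congr (f (_, _)).
    by rewrite /= scale1r addr0.
  by rewrite /= scaler0 add0r.
elim: a p z => [|a IHa b IHb|i a IHa] p z pL.
- rewrite /= /rho -(tens_bal tP) // -opm_scaleE.
  rewrite -(linearZ_LR (mklin pL)) /=; congr (t (p _) v).
  by rewrite opm_scaleE ract_rb mul1r brK.
- rewrite -[LHS]/(ev _ (Gmap a (rho v) z.1) + ev _ (Gmap b (rho v) z.2)).
  rewrite IHa ?IHb; [|exact: l2|exact: l1].
  by rewrite -(tens_Dl tP); case: z => u w; rewrite (l3 _ _ _ p u w).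
- rewrite -[LHS]/(ev _ (Gmap a (rho v) z.1) + ev _ (Gmap a (rho v) z.2)).
  rewrite !IHa; [|exact: l2|exact: l1].
  by rewrite -(tens_Dl tP); case: z => u w; rewrite (l3 _ _ _ p u w).
Qed.

(** An induction principle: maps on G_a(N) are compared on the image of G_a(R) (x) N. *)
Lemma G_span a (P : G a (opm N) -> Prop) :
  (forall u w, P u -> P w -> P (u + w)) -> (forall z v, P (Gmap a (rho v) z)) -> forall y, P y.
Proof.
have r0 b v : Gmap b (rho v) 0 = 0.
  by apply: (addrI (Gmap b (rho v) 0)); rewrite -(GmapD (rhoD v)) !addr0.
have pr1 (U V : zmodType) (u1 u2 : U) : (u1 + u2, 0) = (u1, 0) + (u2, 0) :> (U * V)%type.
  by apply: injective_projections; rewrite ?pairE /= ?addr0.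
have pr2 (U V : zmodType) (u1 u2 : V) : (0, u1 + u2) = (0, u1) + (0, u2) :> (U * V)%type.
  by apply: injective_projections; rewrite ?pairE /= ?addr0.
elim: a P => [|a IHa b IHb|i a IHa] P PD Prho y.
- have := Prho (rb 1) y; rewrite /= /rho rbK /lact rmorph1 scale1r.
  by [].
- case: y => u w.
  have -> : (u, w) = (u, 0) + (0, w) :> (G a (opm N) * G b (opm N))%type.
    by apply: injective_projections; rewrite ?pairE /= ?addr0 ?add0r.
  apply: (PD).
    apply: (IHa (fun u => P (u, 0))) => [u1 u2 P1 P2|z v].
      by rewrite pr1; apply: (PD).
    by have := Prho (z, 0) v; rewrite /= r0.
  apply: (IHb (fun u => P (0, u))) => [u1 u2 P1 P2|z v].
    by rewrite pr2; apply: (PD).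
  by have := Prho (0, z) v; rewrite /= r0.
- case: y => u w.
  have -> : (u, w) = (u, 0) + (0, w) :> (G a (opm N) * G a (opm N))%type.
    by apply: injective_projections; rewrite ?pairE /= ?addr0 ?add0r.
  apply: (PD).
    apply: (IHa (fun u => P (u, 0))) => [u1 u2 P1 P2|z v].
      by rewrite pr1; apply: (PD).
    by have := Prho (z, 0) v; rewrite /= r0.
  apply: (IHa (fun u => P (0, u))) => [u1 u2 P1 P2|z v].
    by rewrite pr2; apply: (PD).
  by have := Prho (0, z) v; rewrite /= r0.
Qed.

Theorem retr_tensor a : retr (opm M) (G a (opm B0)) -> retr (opm T) (G a (opm N)).
Proof.
case=> [i [p [iE pE iK]]].
have pL : linear p by move=> r u v; rewrite linearP.
have [| | |h hP _] := tens_univ tP (Z := G a (opm N)) (g := fun u v => Gmap a (rho v) (i u)).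
- by move=> u u' v; rewrite -(GmapD (rhoD v)) -linearD.
- move=> u v v'; rewrite -Gmap_addf; apply: Gmap_ext => w.
  by rewrite /rho lactD.
- move=> r u v _; rewrite -[ract u r]/(r *: (u : opm M)) linearZ_LR -Gmap_scale Gmap_comp.
  apply: Gmap_ext => w; rewrite /rho opm_scaleE -lactM -[w in LHS]brK ract_rb rbK.
  by [].
have evL : linear (ev (a := a) p).
  move=> r y y'; rewrite evD; congr (_ + _).
  move: y; apply: G_span => [u w Hu Hw|z v].
    by rewrite scalerDr !evD Hu Hw scalerDr.
  rewrite ev_rho // -Gmap_scale Gmap_comp.
  rewrite (Gmap_ext (g := rho (ract v r))) => [|w]; last first.
    by rewrite /rho opm_scaleE lact_ract.
  by rewrite ev_rho // (tens_r tP).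
have evE : oequiv (ev (a := a) p).
  move=> j; apply: G_span => [u w Hu Hw|z v].
    by rewrite linearD !evD Hu Hw linearD.
  rewrite -(Gmap_X (rhoD v) (@rho_equiv v)) !ev_rho // pE !opm_XE.
  by rewrite (tens_l tP).
have hE : oequiv (h : opm T -> G a (opm N)).
  move=> j x.
  have A1 : zmod_morphism (fun x : T => h (@om_X _ (opm T) j x)).
    by apply: zmod_morphD => u v; rewrite -raddfD; congr (h _); apply: linearD.
  have A2 : zmod_morphism (fun x : T => om_X j (h x)).
    by apply: zmod_morphD => u v; rewrite -linearD -raddfD.
  apply: (tens_ext tP (f := mkadd A1) (g := mkadd A2)) => u v /=.
  rewrite hP -[X in h X]/(lact (yv k n j) (t u v)) -(tens_l tP) hP.
  rewrite -[lact _ u]/(om_X j (u : opm M)) iE (Gmap_X (rhoD v) (@rho_equiv v)).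
  by [].
have hL : linear (h : opm T -> G a (opm N)).
  move=> r x y; rewrite raddfD; congr (_ + _).
  have A1 : zmod_morphism (fun x : T => h (r *: (x : opm T))).
    by apply: zmod_morphD => u v; rewrite -raddfD; congr (h _); apply: scalerDr.
  have A2 : zmod_morphism (fun x : T => r *: (h x)).
    by apply: zmod_morphD => u v; rewrite -scalerDr -raddfD.
  apply: (tens_ext tP (f := mkadd A1) (g := mkadd A2)) => u v /=.
  rewrite hP -[X in h X]/(ract (t u v) r) -(tens_r tP) hP -Gmap_scale Gmap_comp.
  by apply: Gmap_ext => w; rewrite /rho opm_scaleE lact_ract.
apply: (retr_intro hL evL hE evE) => x.
have A1 : zmod_morphism (fun x : T => ev p (h x)).
  by apply: zmod_morphD => u v; rewrite raddfD evD.
apply: (tens_ext tP (f := mkadd A1) (g := idfun)) => u v /=.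
by rewrite hP ev_rho // iK.
Qed.

End Tensor.

(** Finitely generated projective modules, by the existence of a dual basis. *)
Definition fgproj (A : comPzRingType) (V : lmodType A) :=
  exists (I : finType) (e : I -> V) (f : I -> {linear V -> A^o}),
    forall v, v = \sum_i (f i v : A) *: e i.

Section FGProj.
Variable A : comPzRingType.

Lemma fg_retract (V W : lmodType A) (g : {linear V -> W}) (h : {linear W -> V}) :
  cancel g h -> fgproj W -> fgproj V.
Proof.
move=> gK [I [e [f E]]]; exists I, (fun i => h (e i)), (fun i => f i \o g) => v.
by rewrite -{1}[v]gK (E (g v)) linear_sum; apply: eq_bigr => i _; rewrite linearZ_LR.
Qed.

Lemma fg_prod (V W : lmodType A) : fgproj V -> fgproj W -> fgproj (V * W)%type.
Proof.
move=> [I [e [f E]]] [J [e' [f' E']]].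
pose p1 : {linear (V * W)%type -> V} := mklin (lin_fst (@lin_id A (V * W)%type)).
pose p2 : {linear (V * W)%type -> W} := mklin (lin_snd (@lin_id A (V * W)%type)).
exists (I + J)%type, (fun x => match x with inl i => (e i, 0) | inr j => (0, e' j) end).
exists (fun x => match x return {linear (V * W)%type -> A^o} with
  inl i => (f i \o p1) : {linear _ -> _} | inr j => (f' j \o p2) : {linear _ -> _} end) => -[v w].
rewrite big_sumType /=.
have -> : (v, w) = (v, 0) + (0, w) :> (V * W)%type.
  by apply: injective_projections; rewrite ?pairE /= ?addr0 ?add0r.
congr (_ + _).
  rewrite {1}(E v); elim/big_rec2: _ => // i x y _ <-.
  by apply: injective_projections; rewrite ?pairE /= ?scaler0 ?addr0.
rewrite {1}(E' w); elim/big_rec2: _ => // i x y _ <-.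
by apply: injective_projections; rewrite ?pairE /= ?scaler0 ?addr0.
Qed.

Lemma fg_K (V : lmodType A) m : fgproj V -> fgproj (K V m).
Proof. by move=> HV; elim: m => //= m IHm; apply: fg_prod. Qed.

Lemma fg_G (a : fshape) (V : opmod A) : fgproj V -> fgproj (G a V).
Proof.
by move=> HV; elim: a => [|a IHa b IHb|i a IHa] //=; apply: fg_prod.
Qed.

Lemma retr_G a (V W : opmod A) : retr V W -> retr (G a V) (G a W).
Proof.
by move=> VW; elim: a => [|a IHa b IHb|i a IHa] //=; [apply: retr_sum|apply: retr_F].
Qed.

End FGProj.

Lemma in_range_scomp n a b : in_range n a -> in_range n b -> in_range n (scomp a b).
Proof.
move=> + Hb; elim: a => //= [a IHa a' IHa' /andP[/IHa -> /IHa' ->]|i a IHa /andP[-> /IHa]] //.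
Qed.

Section SBimGood.
Variables (k : fieldType) (n : nat).
Local Notation R := {mpoly k[n]}.

(** The identity maps between R and the bimodule R, which have the same elements. *)
Definition to_Rbim (p : R) : Rbim k n := p.
Definition of_Rbim (p : Rbim k n) : R := p.
Lemma to_RbimK : cancel to_Rbim of_Rbim. Proof. by []. Qed.
Lemma of_RbimK : cancel of_Rbim to_Rbim. Proof. by []. Qed.
Lemma to_RbimD p q : to_Rbim (p + q) = to_Rbim p + to_Rbim q. Proof. by []. Qed.
Lemma lact_Rbim p q : lact p (to_Rbim q) = to_Rbim (p * q). Proof. exact: Rbim_lact. Qed.
Lemma ract_Rbim p q : ract (to_Rbim q) p = to_Rbim (q * p). Proof. exact: Rbim_ract. Qed.

Theorem SBim_good (M : gbimod k n) : SBim M -> good M.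
Proof.
elim=> {M}.
- by exists SId => //; apply: retr_refl.
- move=> i j T ij [t tP]; exists (SF i SId).
    by rewrite /= -ij ltn_ord.
  by have := retr_B to_RbimK of_RbimK to_RbimD lact_Rbim ract_Rbim ij tP.
- move=> M N _ [a Ha RM] _ [b Hb RN]; exists (SSum a b); first by rewrite /= Ha.
  exact: retr_trans (retr_gsum M N) (retr_sum RM RN).
- move=> M N T _ [a Ha RM] _ [b Hb RN] [t tP].
  exists (scomp a b); first exact: in_range_scomp.
  rewrite G_scomp; apply: retr_trans _ (retr_G a RN).
  exact: (retr_tensor to_RbimK of_RbimK to_RbimD lact_Rbim ract_Rbim tP RM).
- by move=> M c _ [a Ha RM]; exists a.
- move=> M N N' _ [a Ha RM] /good_summand RN; exists a => //.
  exact: retr_trans RN RM.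
Qed.

Lemma fg_base (B0 : gbimod k n) (rb : R -> B0) (br : B0 -> R) :
  cancel rb br -> cancel br rb -> (forall p q, rb (p + q) = rb p + rb q) ->
  (forall p q, ract (rb q) p = rb (q * p)) -> fgproj (opm B0).
Proof.
move=> rbK brK rbD ract_rb.
have L : linear (br : opm B0 -> R^o).
  move=> r u v; rewrite opm_scaleE; apply: (can_inj rbK).
  rewrite brK -{1}[u]brK ract_rb -[X in _ + X]brK -rbD mulrC.
  by [].
exists unit, (fun=> rb 1), (fun=> mklin L) => v.
by rewrite big_const card_unit /= addr0 opm_scaleE ract_rb mul1r brK.
Qed.

Lemma fg_Rbim : fgproj (opm (Rbim k n)).
Proof. exact: (fg_base to_RbimK of_RbimK to_RbimD ract_Rbim). Qed.

Theorem SBim_split (M : gbimod k n) : SBim M -> ksplit (@yv k n) n (opm M).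
Proof.
move=> /SBim_good[a Ha RM]; apply: split_retr RM _.
exact: (split_shape (@opm_Rbim k n) Ha).
Qed.

Theorem SBim_fg (M : gbimod k n) : SBim M -> fgproj (opm M).
Proof.
move=> /SBim_good[a Ha [f [g [_ _ fK]]]]; apply: fg_retract fK _.
exact/fg_G/fg_Rbim.
Qed.
End SBimGood.

(** * Comparison of projective resolutions *)

Section GHoms.
Variables (k : fieldType) (m : nat).
Implicit Types M N L P : gradedMod k m.

Definition gcomp M N L (f : ghom M N) (g : ghom N L) : ghom M L :=
  @GHom _ _ M L (fun v => g (f v))
    (lin_comp g (gfun_lin f)) (fun j v Hv => gfun_deg g (gfun_deg f Hv)).

Lemma gsubt_lin M N (f g : ghom M N) : linear (fun v => f v - g v).
Proof. exact: (lin_add (gfun_lin f) (lin_opp (gfun_lin g))). Qed.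

Definition gsubt M N (f g : ghom M N) : ghom M N :=
  GHom (gsubt_lin f g) (fun j v Hv => gm_homB (gfun_deg f Hv) (gfun_deg g Hv)).

Definition gid M : ghom M M := @GHom _ _ M M (fun v => v) (@lin_id _ M) (fun _ _ H => H).

Lemma gincl_lin M (S : gsubmod M) : linear (fun v : gsub S => (v : M)).
Proof. by []. Qed.

Definition gincl M (S : gsubmod M) : ghom (gsub S) M :=
  @GHom _ _ (gsub S) M _ (@gincl_lin M S) (fun _ _ H => H).

Lemma gsub_inj M (S : gsubmod M) (u v : gsub S) : (u : M) = v -> u = v.
Proof. exact: val_inj. Qed.

Lemma ghom0 M N (f : ghom M N) : f 0 = 0. Proof. exact: linear0. Qed.
Lemma ghomB M N (f : ghom M N) u v : f (u - v) = f u - f v. Proof. exact: linearB. Qed.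
Lemma ghomD M N (f : ghom M N) u v : f (u + v) = f u + f v. Proof. exact: linearD. Qed.
Lemma ghomZ M N (f : ghom M N) p v : f (p *: v) = p *: f v. Proof. exact: linearZ_LR. Qed.

(** The component of degree j of any preimage of an element of degree j is a preimage. *)
Lemma hom_lift M N (g : ghom M N) x j : gm_hom j (g x) ->
  exists2 x', gm_hom j x' & g x' = g x.
Proof.
move=> Hy; have [s Hs Ex] := grad_span (gm_grading M) x.
have [t [F [Ut HF F0 EF]]] := @grad_regroup _ _ (gm_grading M) (fun=> True) s I
  (fun _ _ _ _ => I) (fun u us => conj I (Hs u us)).
exists (F j); first by case: (HF j).
pose y i := if i == j then g x else 0.
have := @grad_unique _ _ (gm_grading N) t [:: j] (fun i => g (F i)) y Ut isT.
move=> H; rewrite H; first by rewrite /y eqxx.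
- by move=> i; apply: gfun_deg; case: (HF i).
- by move=> i; rewrite /y; case: eqP => [->|_] //; apply: gm_hom0.
- by move=> i /F0 ->; rewrite ghom0.
- by move=> i; rewrite /y inE => /negbTE ->.
by rewrite big_seq1 /y eqxx Ex EF linear_sum.
Qed.

Lemma gproj_reg : gprojective (greg k m).
Proof.
move=> M N g f gS.
have [x0 E0] := gS (f (1 : {mpoly k[m]})).
have h1 : gm_hom 0 (f (1 : {mpoly k[m]})).
  by apply: gfun_deg; rewrite -mpolyC1; apply: phomogC.
rewrite -E0 in h1; have [x Hx Ex] := hom_lift h1.
have L : linear (fun p : greg k m => (p : {mpoly k[m]}) *: x).
  by move=> r u v; rewrite scalerDl scalerA.
have D j (p : greg k m) : gm_hom j p -> gm_hom j ((p : {mpoly k[m]}) *: x).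
  by move=> Hp; rewrite -[j]addr0; apply: gm_scale.
exists (GHom L D) => p; rewrite /= ghomZ Ex E0 -ghomZ; congr (f _).
exact: mulr1.
Qed.

Lemma gproj_sum P P' : gprojective P -> gprojective P' -> gprojective (gsum P P').
Proof.
move=> HP HP' M N g f gS.
pose i1 : ghom P (gsum P P') := @GHom _ _ P (gsum P P') (fun v => (v, 0))
  (lin_pair (@lin_id _ P) (@lin_0 _ P P')) (fun j v Hv => conj Hv (gm_hom0 P' j)).
pose i2 : ghom P' (gsum P P') := @GHom _ _ P' (gsum P P') (fun v => (0, v))
  (lin_pair (@lin_0 _ P' P) (@lin_id _ P')) (fun j v Hv => conj (gm_hom0 P j) Hv).
have [f1 E1] := HP M N g (gcomp i1 f) gS.
have [f2 E2] := HP' M N g (gcomp i2 f) gS.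
have L : linear (fun v : gsum P P' => f1 v.1 + f2 v.2).
  by apply: lin_add; apply: lin_comp; linsolve.
exists (@GHom _ _ (gsum P P') M _ L
  (fun j v Hv => gm_homD (gfun_deg f1 (proj1 Hv)) (gfun_deg f2 (proj2 Hv)))).
case=> u v; rewrite /= ghomD E1 E2 /= -ghomD; congr (f _).
by apply: injective_projections; rewrite ?pairE /= ?addr0 ?add0r.
Qed.

Lemma gproj_shift P a : gprojective P -> gprojective (gshift P a).
Proof.
move=> HP M N g f gS.
have D j (v : P) : gm_hom j v -> gm_hom j (f v : gshift N (- a)).
  by move=> Hv; apply: (gfun_deg f); rewrite /= subrK.
pose f1 : ghom P (gshift N (- a)) := @GHom _ _ P (gshift N (- a)) f (gfun_lin f) D.
have [f' E] := HP (gshift M (- a)) (gshift N (- a)) (gshift_map g (- a)) f1 gS.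
have D' j (v : gshift P a) : gm_hom j v -> gm_hom j (f' v : M).
  by move=> Hv; have := gfun_deg f' Hv; rewrite /= addrK.
by exists (@GHom _ _ (gshift P a) M f' (gfun_lin f') D').
Qed.

Lemma gproj_retract P P' (i : ghom P P') (p : ghom P' P) : cancel i p ->
  gprojective P' -> gprojective P.
Proof.
move=> iK HP M N g f gS; have [f' E] := HP M N g (gcomp p f) gS.
by exists (gcomp i f') => x; rewrite /= E /= iK.
Qed.

(** The map d is surjective onto its image, which contains the image of f. *)
Lemma gproj_lift P M N (d : ghom M N) (f : ghom P N) : gprojective P ->
  (forall x, exists y, d y = f x) -> exists f' : ghom P M, forall x, d (f' x) = f x.
Proof.
move=> HP fd.
have dT v : gim d (d v) by exists v.
have dS y : exists x, gcorestr (T := gim d) dT x = y.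
  by have [x E] := gsub_valP y; exists x; apply: gsub_inj.
have [f' E] := HP M (gsub (gim d)) (gcorestr (T := gim d) dT) (gcorestr (T := gim d) fd) dS.
by exists f' => x; have := congr1 (gincl (gim d)) (E x).
Qed.

Section Comparison.
Variables (A : gradedMod k m) (P Q : gprojres A).

(** Consecutive components of a chain map are constructed together, as each step depends on
    the commutation of the previous square. *)
Lemma pr_dd (i : nat) x : pr_d P i (pr_d P i.+1 x) = 0.
Proof. by apply/pr_exact; exists x. Qed.

Let stage i := {p : ghom (P i) (Q i) * ghom (P i.+1) (Q i.+1) |
  forall x, pr_d Q i (p.2 x) = p.1 (pr_d P i x)}.

Lemma chain_step i (s : stage i) :
  exists f : ghom (P i.+2) (Q i.+2), forall x, pr_d Q i.+1 (f x) = (sval s).2 (pr_d P i.+1 x).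
Proof.
apply: (gproj_lift (f := gcomp (pr_d P i.+1) (sval s).2)) => [|x]; first exact: pr_proj.
by apply/pr_exact; rewrite (svalP s) /= pr_dd ghom0.
Qed.

Definition next_stage i (s : stage i) : stage i.+1 :=
  exist _ ((sval s).2, sval (cid (chain_step s))) (svalP (cid (chain_step s))).

Lemma chain_map_exists : exists f : forall i, ghom (P i) (Q i),
  (forall x, pr_aug Q (f 0%N x) = pr_aug P x) /\
  (forall i x, pr_d Q i (f i.+1 x) = f i (pr_d P i x)).
Proof.
have [f0 E0] := @pr_proj _ _ _ P 0%N _ _ (pr_aug Q) (pr_aug P) (@pr_surj _ _ _ Q).
have [f1 E1] : exists f1 : ghom (P 1%N) (Q 1%N), forall x, pr_d Q 0 (f1 x) = f0 (pr_d P 0 x).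
  apply: (gproj_lift (f := gcomp (pr_d P 0) f0)) => [|x]; first exact: pr_proj.
  by apply/pr_exact0; rewrite /= E0; apply/pr_exact0; exists x.
pose st := fix st i : stage i := match i with
  | 0 => exist _ (f0, f1) E1 | i.+1 => next_stage (st i) end.
exists (fun i => (sval (st i)).1); split=> //= i x.
exact: (svalP (st i)).
Qed.

Variable g : forall i, ghom (P i) (Q i).
Hypothesis gd : forall i x, pr_d Q i (g i.+1 x) = g i (pr_d P i x).
Hypothesis g0 : forall x, pr_aug Q (g 0%N x) = 0.

Lemma homotopy0 : exists h : ghom (P 0%N) (Q 1%N), forall x, pr_d Q 0 (h x) = g 0%N x.
Proof.
by apply: gproj_lift => [|x]; [exact: pr_proj|apply/pr_exact0].
Qed.

(** A chain map over 0 is null-homotopic; only two consecutive components of the homotopy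
    are needed at a time. *)
Lemma homotopyS i : exists (h : ghom (P i.+1) (Q i.+2)) (h' : ghom (P i) (Q i.+1)),
  forall x, g i.+1 x = pr_d Q i.+1 (h x) + h' (pr_d P i x).
Proof.
have step j (h' : ghom (P j) (Q j.+1)) : (forall x, g j (pr_d P j x) = pr_d Q j (h' (pr_d P j x))) ->
    exists h : ghom (P j.+1) (Q j.+2), forall x, pr_d Q j.+1 (h x) = g j.+1 x - h' (pr_d P j x).
  move=> E; apply: (gproj_lift (f := gsubt (g j.+1) (gcomp (pr_d P j) h'))) => [|x].
    exact: pr_proj.
  by apply/pr_exact; rewrite ghomB gd /= E subrr.
have [h' E] : exists h' : ghom (P i) (Q i.+1),
    forall x, g i (pr_d P i x) = pr_d Q i (h' (pr_d P i x)).
  elim: i => [|i [h' IH]]; first by have [h E] := homotopy0; exists h => x; rewrite E.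
  by have [h E] := step i h' IH; exists h => x; rewrite E pr_dd ghom0 subr0.
by have [h Eh] := step i h' E; exists h, h' => x; rewrite Eh subrK.
Qed.
End Comparison.
End GHoms.

(** * The Koszul resolution *)

Section KoszulResolution.
Variables (k : fieldType) (n : nat).
Local Notation R := {mpoly k[n]}.
Local Notation S := {mpoly k[n + n]}.

Definition delta (i : nat) : S := ren (@lshift n n) (yv k n i) - ren (@rshift n n) (yv k n i).

Lemma phomog_X m (i : 'I_m) : phomog 2 ('X_i : {mpoly k[m]}).
Proof. by move=> mm; rewrite msuppX inE => /eqP ->; rewrite mdeg1. Qed.

Lemma phomog_delta i : phomog 2 (delta i).
Proof.
have Hy : phomog 2 (yv k n i).
  rewrite /yv; case: insubP => [o _ _|_]; first exact: phomog_X.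
  exact: (grad0 (phomog_grading k n)).
by apply: (gradB (phomog_grading k (n + n))); apply: phomog_ren.
Qed.

(** The Koszul complex over the polynomial ring on 2n variables, all homological degrees taken
    together. An exterior generator has degree 2, hence the shift by -2. *)
Fixpoint W m : gradedMod k (n + n) :=
  if m is m.+1 then gsum (W m) (gshift (W m) (- 2%:Z)) else greg k (n + n).

(** Contraction with the sum of the delta_i xi_i^*. *)
Fixpoint Wd_fun m : W m -> W m := match m return W m -> W m with
  | 0 => fun _ => 0
  | m.+1 => fun w => (Wd_fun (m := m) w.1 + delta m *: (w.2 : W m), - Wd_fun (m := m) w.2)
  end.

Lemma Wd_lin m : linear (@Wd_fun m).
Proof.
elim: m => [|m IHm]; first exact: lin_0.
apply: lin_pair.
  apply: lin_add; last by apply: (lin_comp (scl (W m) (delta m))); linsolve.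
  by apply: (lin_comp (mklin IHm)); linsolve.
apply: lin_opp; apply: (lin_comp (mklin IHm)); exact: (lin_snd (@lin_id _ (W m * W m)%type)).
Qed.

Lemma Wd_deg m j (v : W m) : gm_hom j v -> gm_hom j (Wd_fun v).
Proof.
elim: m j v => [|m IHm] j v; first by move=> _; apply: gm_hom0.
case: v => s t [Hs Ht]; split; last first.
  by apply: (gradN (gm_grading (W m))); apply: IHm.
apply: gm_homD; first exact: IHm.
have -> : j = 2%:Z + (j + - 2%:Z) by rewrite addrCA subrr addr0.
exact: (@gm_scale _ _ (W m) _ _ _ _ (@phomog_delta m) Ht).
Qed.

Definition Wd m : ghom (W m) (W m) := GHom (@Wd_lin m) (@Wd_deg m).

(** The projection to homological degree j. *)
Fixpoint Wpr_fun m j : W m -> W m := match m return W m -> W m with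
  | 0 => fun w => if j is 0 then w else 0
  | m.+1 => fun w => (Wpr_fun (m := m) j w.1, if j is j.+1 then Wpr_fun (m := m) j w.2 else 0)
  end.

Lemma Wpr_lin m j : linear (@Wpr_fun m j).
Proof.
elim: m j => [|m IHm] [|j]; [exact: lin_id|exact: lin_0| |].
  apply: lin_pair; last exact: lin_0.
  by apply: (lin_comp (mklin (IHm _))); linsolve.
apply: lin_pair; first by apply: (lin_comp (mklin (IHm _))); linsolve.
apply: (lin_comp (mklin (IHm _))); exact: (lin_snd (@lin_id _ (W m * W m)%type)).
Qed.

Lemma Wpr_deg m j l (v : W m) : gm_hom l v -> gm_hom l (Wpr_fun j v).
Proof.
elim: m j l v => [|m IHm] [|j] l v //=; first by move=> _; exact: (gm_hom0 (W 0)).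
  by case=> H1 H2; split; [apply: IHm|exact: (gm_hom0 (W m))].
by case=> H1 H2; split; [apply: IHm|exact: (IHm j (l + - 2%:Z))].
Qed.

Definition Wpr m j : ghom (W m) (W m) := GHom (@Wpr_lin m j) (@Wpr_deg m j).

Lemma Wpr_idem m j v : Wpr m j (Wpr m j v) = Wpr m j v.
Proof.
elim: m j v => [|m IHm] [|j] [] //= a b; congr (_, _); exact: IHm.
Qed.

Lemma Wd_pr m j v : Wd m (Wpr m j.+1 v) = Wpr m j (Wd m v).
Proof.
elim: m j v => [|m IHm] j v; first by case: j.
case: v => s t; rewrite -[LHS]/(Wd m (Wpr m j.+1 s) + delta m *: Wpr m j t, - Wd m (Wpr m j t)).
rewrite IHm -ghomZ -ghomD; case: j => [|j].
  rewrite -[RHS]/(Wpr m 0 (Wd m s + delta m *: (t : W m)), 0).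
  congr (_, _).
  suff -> : Wd m (Wpr m 0 t) = 0 by rewrite oppr0.
  elim: (m) t => [//|m' IH [a b]].
  rewrite -[LHS]/(Wd m' (Wpr m' 0 a) + delta m' *: (0 : W m'), - Wd m' 0).
  by rewrite IH scaler0 addr0 ghom0 oppr0.
by rewrite IHm -[RHS]/(Wpr m j.+1 (Wd m s + delta m *: (t : W m)), Wpr m j (- Wd m t))
  -[- Wd m t]sub0r ghomB ghom0 sub0r.
Qed.

Lemma Wd_sq m v : Wd m (Wd m v) = 0.
Proof.
elim: m v => [|m IHm] // [s t].
rewrite -[LHS]/(Wd m (Wd m s + delta m *: (t : W m)) + delta m *: (- Wd m t), - Wd m (- Wd m t)).
rewrite ghomD ghomZ IHm add0r scalerN subrr -[- Wd m t]sub0r ghomB ghom0 IHm subr0 oppr0.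
by [].
Qed.

(** The coefficient in homological degree 0, where the complex has rank 1, and its section. *)
Fixpoint Wc0 m : W m -> S := match m return W m -> S with
  | 0 => fun w => w | m.+1 => fun w => Wc0 (m := m) w.1 end.
Fixpoint We0 m (p : S) : W m := match m return W m with
  | 0 => p | m.+1 => (We0 m p, 0) end.

(** hm m replaces the right variables 0, .., m - 1 by the left ones, and sm m the right
    variable m only. *)
Definition hm (m : nat) (i : 'I_(n + n)) : 'I_(n + n) :=
  match fintype.split i with
  | inl j => lshift n j
  | inr j => if (j < m)%N then lshift n j else rshift n j
  end.

Definition sm (m : nat) (i : 'I_(n + n)) : 'I_(n + n) :=
  match fintype.split i with
  | inl j => lshift n j
  | inr j => if j == m :> nat then lshift n j else rshift n j
  end.

Lemma hmS m i : hm m.+1 i = sm m (hm m i).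
Proof.
rewrite /hm; case: (fintype.split i) => j; first by rewrite /sm split_lshift.
rewrite ltnS; case: (ltngtP j m) => jm; rewrite /sm ?split_lshift ?split_rshift //.
  by case: eqP jm => // ->; rewrite ltnn.
by rewrite jm eqxx.
Qed.

Lemma ren_hmS m (p : S) : ren (hm m.+1) p = ren (sm m) (ren (hm m) p).
Proof. by rewrite ren_comp; apply: ren_ext => i; rewrite hmS. Qed.

Lemma hm_idem m i : hm m (hm m i) = hm m i.
Proof.
rewrite /hm; case E : (fintype.split i) => [j|j]; first by rewrite split_lshift.
by case: ifP => jm; rewrite ?split_lshift // split_rshift jm.
Qed.

Lemma delta_ord (i : 'I_n) : delta i = 'X_(lshift n i) - 'X_(rshift n i).
Proof. by rewrite /delta yv_ord !renX. Qed.

Lemma ren_hm_delta m : (m < n)%N -> ren (hm m) (delta m) = delta m.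
Proof.
move=> mn; rewrite -[m in delta m]/(val (Ordinal mn)) delta_ord raddfB /= !renX /hm.
by rewrite split_lshift split_rshift /= ltnn.
Qed.

Lemma ren_sm_delta m : (m < n)%N -> ren (sm m) (delta m) = 0.
Proof.
move=> mn; rewrite -[m in delta m]/(val (Ordinal mn)) delta_ord raddfB /= !renX /sm.
by rewrite split_lshift split_rshift /= eqxx subrr.
Qed.

Lemma delta_neq0 m : (m < n)%N -> delta m != 0.
Proof.
move=> mn; rewrite -[m in delta m]/(val (Ordinal mn)) delta_ord subr_eq0.
apply/eqP => /(congr1 (mcoeff U_(lshift n (Ordinal mn)))); rewrite !mcoeffXU eqxx.
by rewrite eq_rlshift => /eqP; rewrite oner_eq0.
Qed.

Lemma ren_sm_div m (p : S) : (m < n)%N -> exists q, p - ren (sm m) p = delta m * q.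
Proof.
move=> mn; elim/mpoly_gen_ind: p => [c|i|p q [p' Hp] [q' Hq]|p q [p' Hp] [q' Hq]].
- by exists 0; rewrite /ren comp_mpolyC mulr0 subrr.
- rewrite renX /sm; case E : (fintype.split i) => [j|j].
    exists 0; rewrite mulr0; have := splitK i; rewrite E /= => <-; exact: subrr.
  have := splitK i; rewrite E /= => <-; case: eqP => jm; last by exists 0; rewrite mulr0 subrr.
  exists (- 1); rewrite mulrN1 -jm delta_ord opprB.
  by [].
- by exists (p' + q'); rewrite raddfD opprD addrACA Hp Hq mulrDr.
- exists (p' * q + ren (sm m) p * q'); rewrite rmorphM /= mulrDr mulrA -Hp mulrCA -Hq; ring.
Qed.

Lemma Wc0_d m (w : W m) : (m <= n)%N -> ren (hm m) (Wc0 (Wd m w)) = 0.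
Proof.
elim: m w => [|m IHm] w mn; first exact: raddf0.
case: w => s t; rewrite -[Wc0 _]/(Wc0 (Wd m s + delta m *: (t : W m))).
have -> : Wc0 (Wd m s + delta m *: (t : W m)) = Wc0 (Wd m s) + delta m * Wc0 (t : W m).
  move: (Wd m s) (delta m) t; elim: (m) => [//|m' IH] [a b] c [a' b'].
  exact: (IH a c a').
rewrite ren_hmS (raddfD (ren (hm m))) /= IHm ?(ltnW mn) // add0r rmorphM /=.
by rewrite ren_hm_delta // rmorphM /= ren_sm_delta // mul0r.
Qed.

Lemma Wd_We0 m (p : S) : Wd m (We0 m p) = 0.
Proof.
elim: m => // m IHm; rewrite -[LHS]/(Wd m (We0 m p) + delta m *: (0 : W m), - Wd m 0).
by rewrite IHm scaler0 addr0 ghom0 oppr0.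
Qed.

Lemma Wc0_We0 m p : Wc0 (We0 m p) = p.
Proof. by elim: m => //= m ->. Qed.

Lemma Wc0B m (u v : W m) : Wc0 (u - v) = Wc0 u - Wc0 v.
Proof. by elim: m u v => [//|m IHm] [a b] [a' b']; apply: (IHm a a'). Qed.

(** The Koszul complex is exact as delta_0, .., delta_(n-1) is a regular sequence: ren (hm m) is
    the quotient map by the ideal of the first m of them, and delta_m is not a zero divisor in
    its image. For a cycle (s, t) of the cone of delta_m, the cycle t is a boundary
    since delta_m t is, and after subtraction of a boundary s has a constant term
    divisible by delta_m modulo this ideal. *)
Lemma W_exact m (v : W m) : (m <= n)%N -> Wd m v = 0 -> ren (hm m) (Wc0 v) = 0 ->
  exists w, v = Wd m w.
Proof.
elim: m v => [|m IHm] v mn.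
  move=> _ /=; rewrite (@ren_ext _ _ _ _ id) ?/ren ?comp_mpoly_id => [->|i]; first by exists 0.
  rewrite /hm; have := splitK i; case: (fintype.split i) => j /= <- //.
case: v => s t.
rewrite -[Wd m.+1 _]/(Wd m s + delta m *: (t : W m), - Wd m t) => -[E1 E2] /= Ec.
have {}E2 : Wd m t = 0 by apply: oppr_inj; rewrite E2 oppr0.
have mn' := ltnW mn.
have [t' Et] : exists t', (t : W m) = Wd m t'.
  apply: IHm => //; have E3 : delta m *: (t : W m) = Wd m (- s).
    by rewrite -[- s]sub0r ghomB ghom0 sub0r; apply/eqP; rewrite -addr_eq0 addrC E1.
  have := Wc0_d (- s) mn'; rewrite -E3.
  have -> : Wc0 (delta m *: (t : W m)) = delta m * Wc0 (t : W m).
    by move: (delta m) t {E1 E2 E3}; elim: (m) => [//|m' IH] c [a b]; apply: (IH c a).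
  by rewrite rmorphM /= ren_hm_delta // => /eqP; rewrite mulf_eq0 (negbTE (delta_neq0 mn)) => /eqP.
have {}E1 : Wd m (s + delta m *: t') = 0 by rewrite ghomD ghomZ -Et.
set s' := s + delta m *: t' in E1 *.
have [q Eq] : exists q, ren (hm m) (Wc0 s' - delta m * q) = 0.
  have Hs' : ren (hm m.+1) (Wc0 s') = 0.
    have -> : Wc0 s' = Wc0 s + delta m * Wc0 t'.
      rewrite /s'; move: s (delta m) t' {E1 s' Ec t E2 Et}; elim: (m) => [//|m' IH] [a b] c [a' b'].
      exact: (IH a c a').
    by rewrite raddfD /= Ec add0r rmorphM /= ren_hmS ren_hm_delta // ren_sm_delta // mul0r.
  have [q Eq] := ren_sm_div (ren (hm m) (Wc0 s')) mn.
  rewrite -ren_hmS Hs' subr0 in Eq; exists q.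
  have := congr1 (ren (hm m)) Eq; rewrite ren_comp (ren_ext _ (hm_idem m)) => Eq'.
  by rewrite raddfB /= Eq' subrr.
have [s'' Es''] : exists s'', s' - delta m *: We0 m q = Wd m s''.
  apply: IHm => //; first by rewrite ghomB ghomZ Wd_We0 scaler0 subr0 E1.
  rewrite Wc0B.
  have -> // : Wc0 (delta m *: We0 m q) = delta m * q.
  by move: (delta m); elim: (m) => [//|m' IH] c; apply: IH.
exists (s'', We0 m q - t').
rewrite -[RHS]/(Wd m s'' + delta m *: (We0 m q - t'), - Wd m (We0 m q - t')).
rewrite -Es'' ghomB Wd_We0 sub0r opprK -Et scalerBr addrA subrK /s' addrK.
by [].
Qed.
End KoszulResolution.

Section KoszulRes.
Variables (k : fieldType) (n : nat).
Local Notation R := {mpoly k[n]}.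
Local Notation S := {mpoly k[n + n]}.
Local Notation W m := (W k n m).

Lemma aug0_lin : linear (fun p : greg k (n + n) => (ren (@diagv n) p : Rbim k n)).
Proof.
move=> r p q; rewrite -[X in ren _ X]/((r : S) * (p : S) + (q : S)).
exact: (etrans (raddfD (ren (@diagv n)) _ _) (congr1 (+%R^~ (ren (@diagv n) q))
  (rmorphM (ren (@diagv n)) r p))).
Qed.

Lemma aug0_deg j (p : greg k (n + n)) : gm_hom j p -> gm_hom j (ren (@diagv n) p : Rbim k n).
Proof. exact: phomog_ren. Qed.

Definition aug0 : ghom (greg k (n + n)) (Rbim k n) := GHom aug0_lin aug0_deg.

Lemma aug0_eq0 p : aug0 p = 0 -> ren (hm n) p = 0.
Proof.
move=> E; have <- : ren (@lshift n n) (ren (@diagv n) p) = ren (hm n) p.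
  rewrite ren_comp; apply: ren_ext => i; rewrite /= /diagv /hm.
  by case: (fintype.split i) => j; rewrite ?ltn_ord.
by rewrite -[ren _ p]/(aug0 p) E; apply: raddf0.
Qed.

Lemma ren_hm_eq0 p : ren (hm n) p = 0 -> aug0 p = 0.
Proof.
move=> E; rewrite -[LHS]/(ren (@diagv n) p).
have -> : ren (@diagv n) p = ren (@diagv n) (ren (hm n) p).
  rewrite ren_comp; apply: ren_ext => i; rewrite /= /diagv /hm.
  case: (fintype.split i) => j; first by rewrite split_lshift.
  by case: ifP => _; rewrite ?split_lshift ?split_rshift.
by rewrite E; apply: raddf0.
Qed.

Lemma aug0_surj a : exists p, aug0 p = a.
Proof.
exists (ren (@lshift n n) (a : R)); rewrite -[LHS]/(ren (@diagv n) (ren (@lshift n n) (a : R))).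
rewrite ren_comp (@ren_ext _ _ _ _ id) ?/ren ?comp_mpoly_id // => i.
by rewrite /= /diagv split_lshift.
Qed.

Lemma Wc0_lin m : linear (@Wc0 k n m : W m -> greg k (n + n)).
Proof.
elim: m => [|m IHm]; first exact: lin_id.
apply: (lin_comp (mklin IHm)); exact: (lin_fst (@lin_id _ (W m * W m)%type)).
Qed.

Lemma Wc0_deg m j (v : W m) : gm_hom j v -> gm_hom j (Wc0 v : greg k (n + n)).
Proof. by elim: m v => [//|m IHm] [a b] [Ha _]; apply: IHm. Qed.

Definition Wc0g m : ghom (W m) (greg k (n + n)) := GHom (@Wc0_lin m) (@Wc0_deg m).

Lemma Wproj m : gprojective (W m).
Proof.
elim: m => [|m IHm]; first exact: gproj_reg.
by apply: gproj_sum => //; apply: gproj_shift.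
Qed.

Lemma Wpr_We0 m p : Wpr k n m 0 (We0 m p) = We0 m p.
Proof. by elim: m => [//|m IHm]; congr (_, _); apply: IHm. Qed.

Lemma Wc0_prS m j u : Wc0 (Wpr k n m j.+1 u) = 0.
Proof. by elim: m u => [//|m IH [a b]]; apply: IH. Qed.

Lemma Wd_pr0 m u : Wd k n m (Wpr k n m 0 u) = 0.
Proof.
elim: m u => [//|m IH [a b]].
rewrite -[LHS]/(Wd k n m (Wpr k n m 0 a) + delta k n m *: (0 : W m), - Wd k n m 0).
by rewrite IH scaler0 addr0 ghom0 oppr0.
Qed.

(** The resolution is the direct summand of W n in each homological degree. *)
Definition Qobj j := gsub (gim (Wpr k n n j)).

Lemma Wd_gim j v : gim (Wpr k n n j.+1) v -> gim (Wpr k n n j) (Wd k n n v).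
Proof. by case=> u <-; exists (Wd k n n u); rewrite -Wd_pr. Qed.

Definition Qd j : ghom (Qobj j.+1) (Qobj j) := gsub_map (@Wd_gim j).

Definition Qaug : ghom (Qobj 0) (Rbim k n) :=
  gcomp (gincl (gim (Wpr k n n 0))) (gcomp (Wc0g n) aug0).

Lemma Qpr_mem j v : gim (Wpr k n n j) (Wpr k n n j v). Proof. by exists v. Qed.
Definition Qpr j : ghom (W n) (Qobj j) := gcorestr (@Qpr_mem j).

Lemma Qpr_val j (v : Qobj j) : Wpr k n n j (v : W n) = v.
Proof. by have [u <-] := gsub_valP v; rewrite Wpr_idem. Qed.

Lemma Qpr_id j (v : Qobj j) : Qpr j (v : W n) = v.
Proof. by apply: gsub_inj; apply: Qpr_val. Qed.

Lemma Qproj j : gprojective (Qobj j).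
Proof.
apply: (gproj_retract (i := gincl (gim (Wpr k n n j))) (p := Qpr j)) => [v|].
  exact: Qpr_id.
exact: Wproj.
Qed.

Lemma Qsurj a : exists x, Qaug x = a.
Proof.
have [p <-] := aug0_surj a; exists (Qpr 0 (We0 n p)).
rewrite -[LHS]/(aug0 (Wc0 (Wpr k n n 0 (We0 n p)))); by rewrite Wpr_We0 Wc0_We0.
Qed.

Lemma Q_of_W j (x : Qobj j) w : (x : W n) = Wd k n n w -> exists y, Qd j y = x.
Proof.
move=> E; exists (Qpr j.+1 w); apply: gsub_inj.
by rewrite -[LHS]/(Wd k n n (Wpr k n n j.+1 w)) Wd_pr -E Qpr_val.
Qed.

Lemma Qexact0 x : Qaug x = 0 <-> exists y, Qd 0 y = x.
Proof.
split=> [E|[y <-]]; last first.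
  rewrite -[LHS]/(aug0 (Wc0 (Wd k n n (gsub_val y)))); apply: ren_hm_eq0.
  exact: Wc0_d.
have [w Ew] : exists w, (x : W n) = Wd k n n w.
  apply: W_exact => //; last exact: aug0_eq0.
  have [u <-] := gsub_valP x.
  exact: Wd_pr0.
exact: Q_of_W Ew.
Qed.

Lemma Qexact j x : Qd j x = 0 <-> exists y, Qd j.+1 y = x.
Proof.
split=> [E|[y <-]]; last first.
  by apply: gsub_inj; rewrite -[LHS]/(Wd k n n (Wd k n n (gsub_val y))) Wd_sq.
have [w Ew] : exists w, (x : W n) = Wd k n n w.
  apply: W_exact => //; first exact: (congr1 (@gsub_val _ _ _ _) E).
  have [u <-] := gsub_valP x.
  by rewrite Wc0_prS; apply: raddf0.
exact: Q_of_W Ew.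
Qed.

Definition Qres : gprojres (Rbim k n) := GProjRes Qproj Qsurj Qexact0 Qexact.

(** Linear maps from W m to M, written as elements of the Koszul complex of M. *)
Section Eval.
Variable M : gbimod k n.

Fixpoint kev m : K (opm M) m -> W m -> M := match m return K (opm M) m -> W m -> M with
  | 0 => fun z v => (v : S) *: (z : M)
  | m.+1 => fun z v => kev (m := m) z.1 v.1 + kev (m := m) z.2 v.2
  end.

Fixpoint toK m : (W m -> M) -> K (opm M) m := match m return (W m -> M) -> K (opm M) m with
  | 0 => fun g => g (1 : S)
  | m.+1 => fun g => (toK (m := m) (fun s => g (s, 0)), toK (m := m) (fun t => g (0, t)))
  end.

Lemma difE i (v : opm M) : dif (@yv k n) (opm M) i v = (delta k n i *: (v : M) : M).
Proof. by rewrite /delta scalerBl. Qed.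

Lemma kev_lin m z : linear (@kev m z).
Proof.
elim: m z => [|m IHm] z; first by move=> r u v; rewrite /= scalerDl scalerA.
apply: lin_add.
  by apply: (lin_comp (mklin (IHm z.1))); linsolve.
apply: (lin_comp (mklin (IHm z.2))); exact: (lin_snd (@lin_id _ (W m * W m)%type)).
Qed.

Lemma kevD m z z' v : @kev m (z + z') v = kev z v + kev z' v.
Proof.
elim: m z z' v => [|m IHm] z z' v; first exact: scalerDr.
by rewrite -[LHS]/(kev (z.1 + z'.1) v.1 + kev (z.2 + z'.2) v.2) !IHm addrACA.
Qed.

Lemma kevN m z v : @kev m (- z) v = - kev z v.
Proof.
elim: m z v => [|m IHm] z v; first exact: scalerN.
by rewrite -[LHS]/(kev (- z.1) v.1 + kev (- z.2) v.2) !IHm opprD.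
Qed.

Lemma kev_toK m g v : linear g -> @kev m (toK g) v = g v.
Proof.
elim: m g v => [|m IHm] g v gL.
  rewrite /= -[LHS]addr0 -[0 in LHS](_ : g 0 = 0).
    by rewrite -gL; congr (g _); rewrite addr0; apply: mulr1.
  by rewrite -[LHS](addrK (g 0)) -[X in X + _ - _]scale1r -gL scaler0 addr0 subrr.
have g0 : g 0 = 0.
  by rewrite -[LHS](addrK (g 0)) -[X in X + _ - _]scale1r -gL scaler0 addr0 subrr.
case: v => s t; rewrite -[LHS]/(kev (toK (fun s => g (s, 0))) s + kev (toK (fun t => g (0, t))) t).
rewrite !IHm.
- rewrite -[g (s, 0)]scale1r -gL; congr (g _); apply: injective_projections; rewrite ?pairE /=.
    by rewrite scale1r addr0.
  by rewrite scaler0 add0r.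
- move=> r u v; rewrite -gL; congr (g _).
  by apply: injective_projections; rewrite ?pairE /= ?scaler0 ?addr0.
- move=> r u v; rewrite -gL; congr (g _).
  by apply: injective_projections; rewrite ?pairE /= ?scaler0 ?addr0.
Qed.

Lemma kev_inj m z z' : @kev m z =1 kev z' -> z = z'.
Proof.
have k0 m' (y : K (opm M) m') : kev y 0 = 0 by apply: (linear0 (mklin (kev_lin y))).
elim: m z z' => [|m IHm] z z' E.
  by have := E (1 : S); rewrite /= !scale1r.
apply: injective_projections; apply: IHm => v.
  by have := E (v, 0); rewrite /= !k0 !addr0.
by have := E (0, v); rewrite /= !k0 !add0r.
Qed.

Lemma kev_map m i z v : kev (Kmap m (dif (@yv k n) (opm M) i) z) v = delta k n i *: kev z v.
Proof.
elim: m z v => [|m IHm] z v.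
  by rewrite -[LHS]/((v : S) *: (dif (@yv k n) (opm M) i z : M)) difE !scalerA mulrC.
by rewrite -[LHS]/(kev (Kmap m _ z.1) v.1 + kev (Kmap m _ z.2) v.2) !IHm scalerDr.
Qed.

Lemma kev_D m z v : kev (KD m (dif (@yv k n) (opm M)) z) v = kev z (Wd k n m v).
Proof.
have kL m' (y : K (opm M) m') := kev_lin y.
elim: m z v => [|m IHm] z v.
  by rewrite -[LHS]/((v : S) *: (0 : M)) scaler0 -[RHS]/((0 : S) *: (z : M)) scale0r.
case: z v => a b [s t].
rewrite -[LHS]/(kev (KD m _ a) s + kev (Kmap m (dif (@yv k n) (opm M) m) a - KD m _ b) t).
rewrite -[RHS]/(kev a (Wd k n m s + delta k n m *: (t : W m)) + kev b (- Wd k n m t)).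
rewrite kevD kevN kev_map !IHm.
rewrite -[kev a (_ + _)]/(mklin (kL m a) (Wd k n m s + delta k n m *: (t : W m))) linearD linearZ_LR.
by rewrite -[kev b (- _)]/(mklin (kL m b) (- Wd k n m t)) linearN /= addrA.
Qed.
End Eval.
End KoszulRes.

(** * Linear maps from finitely generated graded modules *)

Section Components.
Variables (V : zmodType) (H : int -> V -> Prop) (HG : is_grading H).

Lemma comps_exist v : exists w : seq int * (int -> V),
  [/\ uniq w.1, forall j, H j (w.2 j), forall j : int, j \notin w.1 -> w.2 j = 0
    & v = \sum_(j <- w.1) w.2 j].
Proof.
have [s Hs ->] := grad_span HG v.
have [t [F [Ut HF F0 E]]] := @grad_regroup _ _ HG (fun=> True) s I
  (fun _ _ _ _ => I) (fun u us => conj I (Hs u us)).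
by exists (t, F); split=> // j; case: (HF j).
Qed.

Definition csupp v : seq int := (sval (cid (comps_exist v))).1.
Definition comp j v : V := (sval (cid (comps_exist v))).2 j.

Lemma compP v : [/\ uniq (csupp v), forall j, H j (comp j v),
  forall j : int, j \notin csupp v -> comp j v = 0 & v = \sum_(j <- csupp v) comp j v].
Proof. exact: (svalP (cid (comps_exist v))). Qed.

Lemma comp_hom j v : H j (comp j v). Proof. by case: (compP v). Qed.
Lemma comp_out j v : j \notin csupp v -> comp j v = 0.
Proof. by case: (compP v) => _ _ /(_ j). Qed.

Lemma comp_uniq v (t : seq int) (F : int -> V) : uniq t -> (forall j, H j (F j)) ->
  (forall j : int, j \notin t -> F j = 0) -> v = \sum_(j <- t) F j -> forall j, comp j v = F j.
Proof.
move=> Ut HF F0 E j; have [Us Hs s0 Es] := compP v.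
by apply: (grad_unique HG Us Ut) => //; rewrite -Es.
Qed.

Lemma sum_supp (U : zmodType) (t T : seq int) (F : int -> U) : uniq t -> uniq T ->
  {subset t <= T} -> (forall j : int, j \notin t -> F j = 0) ->
  \sum_(j <- T) F j = \sum_(j <- t) F j.
Proof.
move=> Ut UT tT F0; rewrite (bigID (mem t)) /= [X in _ + X]big1 // addr0.
rewrite -big_filter; apply: perm_big; apply: uniq_perm => //; first exact: filter_uniq.
by move=> j; rewrite mem_filter /=; case: (boolP (j \in t)) => //= /tT ->.
Qed.

Lemma comp_sum v T : uniq T -> {subset csupp v <= T} -> v = \sum_(j <- T) comp j v.
Proof.
move=> UT sT; have [Us _ s0 {1}->] := compP v.
by apply/esym/sum_supp.
Qed.

Lemma compD j u v : comp j (u + v) = comp j u + comp j v.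
Proof.
pose T := undup (csupp u ++ csupp v).
have UT : uniq T by apply: undup_uniq.
have uT : {subset csupp u <= T} by move=> i iu; rewrite mem_undup mem_cat iu.
have vT : {subset csupp v <= T} by move=> i iu; rewrite mem_undup mem_cat iu orbT.
apply: (comp_uniq (t := T) (F := fun j => comp j u + comp j v)) => // [i|i iT|].
- by apply: (gradD HG); apply: comp_hom.
- by rewrite !comp_out ?addr0 //; apply: contra iT; [apply: vT|apply: uT].
- by rewrite big_split /= -!comp_sum.
Qed.

Lemma comp_homog i v j : H i v -> comp j v = if j == i then v else 0.
Proof.
move=> Hv; apply: (comp_uniq (t := [:: i]) (F := fun j => if j == i then v else 0)) => //.
- by move=> l; case: eqP => [->|_] //; apply: grad0.
- by move=> l; rewrite inE => /negbTE ->.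
- by rewrite big_seq1 eqxx.
Qed.
End Components.

Lemma comp_scale (k : fieldType) (m : nat) (M : gradedMod k m) i j (p : {mpoly k[m]})
    (v : M) : phomog i p ->
  comp (gm_grading M) (i + j) (p *: v) = p *: comp (gm_grading M) j v.
Proof.
move=> Hp; have [Us Hs s0 Es] := compP (gm_grading M) v.
have := @comp_uniq _ _ (gm_grading M) (p *: v) [seq i + l | l <- csupp (gm_grading M) v]
  (fun l => p *: comp (gm_grading M) (l - i) v).
move=> ->; first by rewrite addrAC subrr add0r.
- by rewrite map_inj_uniq //; apply: addrI.
- by move=> l; have := gm_scale Hp (Hs (l - i)); rewrite addrCA subrr addr0.
- move=> l Hl; rewrite s0 ?scaler0 //; apply: contra Hl => Hl.
  by apply/mapP; exists (l - i) => //; rewrite addrCA subrr addr0.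
- rewrite big_map {1}Es scaler_sumr; apply: eq_bigr => l _.
  by rewrite addrAC subrr add0r.
Qed.

Section FgGmap.
Variables (k : fieldType) (m : nat) (M N : gradedMod k m).
Local Notation R := {mpoly k[m]}.

Local Notation cM := (comp (gm_grading M)).
Local Notation cN := (comp (gm_grading N)).
Local Notation sM := (csupp (gm_grading M)).
Local Notation sN := (csupp (gm_grading N)).

Variables (f : M -> N) (fL : linear f).
Let F : {linear M -> N} := mklin fL.

(** The part of degree l of a linear map. *)
Definition fcomp l (v : M) : N := \sum_(a <- sM v) cN (a + l) (F (cM a v)).

Lemma cN0 j : cN j 0 = 0.
Proof. by apply: (addrI (cN j 0)); rewrite -compD !addr0. Qed.

Lemma fcompE l v T : uniq T -> {subset sM v <= T} ->
  fcomp l v = \sum_(a <- T) cN (a + l) (F (cM a v)).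
Proof.
move=> UT sT; have [Us _ s0 _] := compP (gm_grading M) v.
by apply/esym/sum_supp => // j /s0 ->; rewrite (linear0 F) cN0.
Qed.

Lemma fcompD l u v : fcomp l (u + v) = fcomp l u + fcomp l v.
Proof.
pose T := undup (sM u ++ sM v ++ sM (u + v)).
have UT : uniq T by apply: undup_uniq.
rewrite !(@fcompE _ _ T) // => [|i iu|i iu|i iu]; rewrite ?mem_undup ?mem_cat ?iu ?orbT //.
rewrite -big_split; apply: eq_bigr => a _.
by rewrite (compD (gm_grading M)) (linearD F) (compD (gm_grading N)).
Qed.

Lemma fcomp_hom l j v : gm_hom j v -> fcomp l v = cN (j + l) (F v).
Proof.
move=> Hv; pose T := undup (j :: sM v).
have UT : uniq T by apply: undup_uniq.
rewrite (@fcompE _ _ T) // => [|i iv]; last by rewrite mem_undup inE iv orbT.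
rewrite (bigD1_seq j) ?mem_undup ?mem_head // -[RHS]addr0; congr (_ + _).
  by rewrite (comp_homog _ _ Hv) eqxx.
rewrite big1 // => i /negbTE ij.
by rewrite (comp_homog _ _ Hv) ij (linear0 F) cN0.
Qed.

Lemma fcomp_sum l (I : Type) (s : seq I) (G : I -> M) :
  fcomp l (\sum_(i <- s) G i) = \sum_(i <- s) fcomp l (G i).
Proof.
elim: s => [|i s IHs]; last by rewrite !big_cons fcompD IHs.
by rewrite !big_nil; apply: (addrI (fcomp l 0)); rewrite -fcompD !addr0.
Qed.

Lemma fcomp_scale l p v : fcomp l (p *: v) = p *: fcomp l v.
Proof.
have hs i q u : phomog i q -> fcomp l (q *: u) = q *: fcomp l u.
  move=> Hq; have [_ Hs _ ->] := compP (gm_grading M) u.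
  rewrite scaler_sumr !fcomp_sum scaler_sumr; apply: eq_bigr => j _.
  rewrite (fcomp_hom _ (Hs j)) (fcomp_hom _ (gm_scale Hq (Hs j))) (linearZ_LR F) -(comp_scale _ _ Hq).
  by rewrite addrA.
elim/mpoly_gen_ind: p v => [c|i|p q IHp IHq|p q IHp IHq] v.
- by apply: (hs 0); apply: phomogC.
- by apply: (hs 2%:Z); apply: phomog_X.
- by rewrite scalerDl fcompD IHp IHq scalerDl.
- by rewrite -scalerA IHp IHq scalerA.
Qed.

Lemma fcomp_lin l : linear (fcomp l).
Proof. by move=> p u v; rewrite fcompD fcomp_scale. Qed.

Lemma fcomp_deg l : homog_map l (fcomp l).
Proof. by move=> j v Hv; rewrite (fcomp_hom _ Hv); apply: comp_hom. Qed.

(** A linear map has only finitely many homogeneous components on finitely many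
    generators, and is their sum. *)
Theorem fg_gmap (I : finType) (e : I -> M) :
  (forall v, exists c : I -> R, v = \sum_i c i *: e i) -> is_gmap f.
Proof.
move=> eS.
pose gens := flatten [seq [seq (a, cM a (e i)) | a <- sM (e i)] | i <- enum I].
pose L := undup (flatten [seq [seq b - p.1 | b <- sN (F p.2)] | p <- gens]).
have UL : uniq L by apply: undup_uniq.
have E : f = \sum_(l <- L) fcomp l.
  apply: funext => v; rewrite fct_sumE.
  pose D (u : M) : N := F u - \sum_(l <- L) fcomp l u.
  have DD u u' : D (u + u') = D u + D u'.
    rewrite /D (linearD F) (eq_bigr (fun l => fcomp l u + fcomp l u')) => [|l _]; last exact: fcompD.
    by rewrite big_split opprD addrACA.
  have DZ p u : D (p *: u) = p *: D u.
    rewrite /D (linearZ_LR F) scalerBr scaler_sumr; congr (_ - _).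
    by apply: eq_bigr => l _; apply: fcomp_scale.
  have Dsum (J : Type) (s : seq J) (G : J -> M) : (forall j, D (G j) = 0) ->
      D (\sum_(j <- s) G j) = 0.
    move=> D0; elim: s => [|j s IHs]; last by rewrite big_cons DD IHs addr0 D0.
    by rewrite big_nil; apply: (addrI (D 0)); rewrite -DD !addr0.
  suff De i : D (e i) = 0.
    apply/eqP; rewrite -subr_eq0; apply/eqP; have [c ->] := eS v.
    by apply: Dsum => i; rewrite DZ De scaler0.
  have [_ Hs _ {1}->] := compP (gm_grading M) (e i).
  rewrite big_seq; elim/big_ind: _ => [|u u' Du Du'|a ai].
  - by apply: (addrI (D 0)); rewrite -DD !addr0.
  - by rewrite DD Du Du' addr0.
  rewrite /D; set y := cM a (e i); have Hy : gm_hom a y by apply: Hs.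
  have yL b : b \in sN (F y) -> b - a \in L.
    move=> bF; rewrite mem_undup; apply/flattenP; exists [seq b' - a | b' <- sN (F y)].
      apply/mapP; exists (a, y) => //; apply/flattenP.
      exists [seq (a', cM a' (e i)) | a' <- sM (e i)]; last by apply: map_f.
      by apply/mapP; exists i => //; rewrite mem_enum.
    exact: map_f.
  rewrite {1}(@comp_sum _ _ (gm_grading N) (F y) [seq a + l | l <- L]).
  - rewrite big_map; apply/eqP; rewrite subr_eq0; apply/eqP.
    by apply: eq_bigr => l _; rewrite (fcomp_hom _ Hy).
  - by rewrite map_inj_uniq //; apply: addrI.
  - by move=> b /yL bL; apply/mapP; exists (b - a) => //; rewrite addrCA subrr addr0.
exists [seq fcomp l | l <- L]; last by rewrite big_map.
by move=> u /mapP[l _ ->]; split; [apply: fcomp_lin|exists l; apply: fcomp_deg].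
Qed.
End FgGmap.

(** * Degrees and contraction in Koszul complexes *)

Section KoszulMore.
Variables (A : comPzRingType) (V : lmodType A).

(** The sign involution, (-1)^j in degree j. *)
Fixpoint ksig_fun m : K V m -> K V m := match m return K V m -> K V m with
  | 0 => fun z => z
  | m.+1 => fun z => (ksig_fun (m := m) z.1, - ksig_fun (m := m) z.2)
  end.

Lemma ksig_lin m : linear (@ksig_fun m).
Proof.
elim: m => [|m IHm]; first exact: lin_id.
apply: lin_pair; first by apply: (lin_comp (mklin IHm)); linsolve.
apply: lin_opp; apply: (lin_comp (mklin IHm)); linsolve.
Qed.

Definition ksig m : {linear K V m -> K V m} := mklin (@ksig_lin m).

Lemma ksigK m z : ksig m (ksig m z) = z.
Proof.
elim: m z => [//|m IHm] [a b].
rewrite -[LHS]/(ksig m (ksig m a), - ksig m (- ksig m b)) IHm.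
by rewrite [ksig m (- _)]linearN opprK IHm.
Qed.

Lemma ksig_map m (f : {linear V -> V}) z : ksig m (Kmap m f z) = Kmap m f (ksig m z).
Proof.
elim: m z => [//|m IHm] [a b].
rewrite -[LHS]/(ksig m (Kmap m f a), - ksig m (Kmap m f b)) !IHm.
by rewrite -[RHS]/(Kmap m f (ksig m a), Kmap m f (- ksig m b)) [Kmap m f (- _)]linearN.
Qed.

Section Diff.
Variable d : nat -> {linear V -> V}.

Lemma ksig_D m z : ksig m (KD m d z) = - KD m d (ksig m z).
Proof.
elim: m z => [|m IHm] z; first by rewrite [RHS]oppr0.
case: z => a b.
rewrite -[LHS]/(ksig m (KD m d a), - ksig m (Kmap m (d m) a - KD m d b)).
rewrite -[RHS]/(- KD m d (ksig m a), - (Kmap m (d m) (ksig m a) - KD m d (- ksig m b))).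
rewrite linearB !IHm ksig_map [KD m d (- _)]linearN ?opprK.
by rewrite ?opprK.
Qed.

(** The projection to degree j. *)
Fixpoint kpr_fun m j : K V m -> K V m := match m return K V m -> K V m with
  | 0 => fun z => if j is 0 then z else 0
  | m.+1 => fun z => (kpr_fun (m := m) j z.1, if j is j.+1 then kpr_fun (m := m) j z.2 else 0)
  end.

Lemma kpr_lin m j : linear (@kpr_fun m j).
Proof.
elim: m j => [|m IHm] [|j]; [exact: lin_id|exact: lin_0| |].
  by apply: lin_pair; [apply: (lin_comp (mklin (IHm 0%N))); linsolve|linsolve].
apply: lin_pair; first by apply: (lin_comp (mklin (IHm _))); linsolve.
apply: (lin_comp (mklin (IHm _))); linsolve.
Qed.

Definition kpr m j : {linear K V m -> K V m} := mklin (@kpr_lin m j).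

Lemma kpr_idem m j z : kpr m j (kpr m j z) = kpr m j z.
Proof.
by elim: m j z => [|m IHm] [|j] // [a b]; congr (_, _); apply: IHm.
Qed.

Lemma kpr_big m j z : (m < j)%N -> kpr m j z = 0.
Proof.
elim: m j z => [|m IHm] [|j] // [a b] mj; congr (_, _); apply: IHm => //.
exact: ltnW.
Qed.

Lemma kpr_map m j (f : {linear V -> V}) z : kpr m j (Kmap m f z) = Kmap m f (kpr m j z).
Proof.
elim: m j z => [|m IHm] [|j] z //; first by rewrite [RHS]linear0.
  by congr (_, _); [exact: IHm|exact: (esym (linear0 (Kmap m f)))].
by congr (_, _); apply: IHm.
Qed.

Lemma ksig_pr m j z : ksig m (kpr m j z) = kpr m j (ksig m z).
Proof.
elim: m j z => [|m IHm] [|j] z //.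
  by congr (_, _); [exact: IHm|exact: (etrans (congr1 -%R (linear0 (ksig m))) (oppr0 _))].
case: z => a b; rewrite -[RHS]/(kpr m j.+1 (ksig m a), kpr m j (- ksig m b)).
by rewrite [kpr m j (- _)]linearN -!IHm.
Qed.

Lemma kpr0_D m z : kpr m 0 (KD m d z) = 0.
Proof. by elim: m z => [//|m IHm] z; congr (_, _); apply: IHm. Qed.

Lemma kprS_D m j z : kpr m j.+1 (KD m d z) = KD m d (kpr m j z).
Proof.
elim: m j z => [|m IHm] j z; first by [].
case: z => a b.
rewrite -[LHS]/(kpr m j.+1 (KD m d a), kpr m j (Kmap m (d m) a - KD m d b)) IHm linearB kpr_map.
case: j => [|j]; last by rewrite IHm.
by rewrite kpr0_D -[RHS]/(KD m d (kpr m 0 a), Kmap m (d m) (kpr m 0 a) - KD m d 0) linear0.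
Qed.

(** Contraction with the i-th generator: a homotopy from d i to 0. *)
Fixpoint kio m i : K V m -> K V m := match m return K V m -> K V m with
  | 0 => fun => 0
  | m.+1 => fun z => if i == m then (z.2, 0) else (kio (m := m) i z.1, - kio (m := m) i z.2)
  end.

Lemma kio_N m i z : @kio m i (- z) = - kio i z.
Proof.
elim: m z => [|m IHm] z; first by rewrite /= oppr0.
rewrite /=; case: (i == m); first by congr (_, _); rewrite oppr0.
by congr (_, _); rewrite /= IHm.
Qed.

Lemma kio_D_add m i u v : @kio m i (u + v) = kio i u + kio i v.
Proof.
elim: m u v => [|m IHm] u v; first by rewrite /= addr0.
rewrite /=; case: (i == m); first by congr (_, _); rewrite addr0.
by congr (_, _); rewrite /= IHm ?opprD.
Qed.

Lemma kio_map m i (f : {linear V -> V}) z : kio i (Kmap m f z) = Kmap m f (kio i z).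
Proof.
elim: m z => [|m IHm] z; first by rewrite [RHS]linear0.
rewrite /=; case: (i == m); first by congr (_, _); rewrite [RHS](linear0 (Kmap m f)).
congr (_, _); first exact: IHm.
by rewrite [RHS](linearN (Kmap m f)) -IHm.
Qed.

Lemma kio_last m z : @kio m.+1 m z = (z.2, 0).
Proof. by rewrite /= eqxx. Qed.

Lemma kio_lt m i z : (i < m)%N -> @kio m.+1 i z = (kio i z.1, - kio i z.2).
Proof. by move=> im; rewrite /= ltn_eqF. Qed.

Lemma KDE m z : KD m.+1 d z = (KD m d z.1, Kmap m (d m) z.1 - KD m d z.2).
Proof. by []. Qed.

Lemma kio_homotopy m i z : (i < m)%N -> KD m d (kio i z) + kio i (KD m d z) = Kmap m (d i) z.
Proof.
elim: m z => [//|m IHm] z; rewrite ltnS leq_eqVlt => /orP[/eqP ->|im].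
  rewrite !kio_last !KDE linear0 subr0; apply: injective_projections; rewrite ?pairE /= ?addr0 //.
  exact: (etrans (addrC _ _) (subrK _ _)).
rewrite !kio_lt // !KDE.
apply: injective_projections; first exact: (IHm _ im).
rewrite -[LHS]/(Kmap m (d m) (kio i z.1) - KD m d (- kio i z.2)
  - kio i (Kmap m (d m) z.1 - KD m d z.2)).
rewrite linearN opprK kio_D_add kio_N kio_map opprD opprK.
by rewrite addrACA subrr add0r IHm.
Qed.
End Diff.
End KoszulMore.

(** * Duality of Koszul complexes *)

Section Pairing.
Variables (k : fieldType) (n : nat) (M : gbimod k n).
Local Notation R := {mpoly k[n]}.
Local Notation V := (opm M).
Local Notation V' := (opm (bdual M)).
Implicit Types (f g : bdual M) (v : M).

Lemma appD f g v : bdual_app (f + g) v = bdual_app f v + bdual_app g v.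
Proof. by []. Qed.

Lemma app_lin f : linear (bdual_app f : V -> R^o).
Proof. by move=> r u v; apply: (gmap_val_linear (f : gmap (restr (@rshift n n) M) (greg k n))). Qed.

Definition appl f : {linear V -> R^o} := mklin (app_lin f).

Lemma lact1 (N : gbimod k n) (v : N) : lact (1 : R) v = v.
Proof. by rewrite /lact rmorph1 scale1r. Qed.
Lemma ract1 (N : gbimod k n) (v : N) : ract v (1 : R) = v.
Proof. by rewrite /ract rmorph1 scale1r. Qed.

Lemma app_lact p f v : bdual_app (lact p f) v = p * bdual_app f v.
Proof. by have := bdual_appE f p 1 v; rewrite ract1 lact1. Qed.

Lemma app_ract p f v : bdual_app (ract f p) v = bdual_app f (lact p v).
Proof. by have := bdual_appE f 1 p v; rewrite lact1 mul1r. Qed.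

Lemma app_ext f g : (forall v, bdual_app f v = bdual_app g v) -> f = g.
Proof. by move=> E; apply: (@gmapE _ _ (restr (@rshift n n) M) (greg k n) f g) => v; apply: E. Qed.

Lemma app_hom f v a j : gm_hom a f -> gm_hom j v -> phomog (j + a) (bdual_app f v).
Proof. by move=> Hf; apply: Hf. Qed.

Lemma app_exists (fgV : fgproj V) (l : {linear V -> R^o}) : exists f, forall v, bdual_app f v = l v.
Proof.
have [I [e [c E]]] := fgV.
have lL : linear (l : restr (@rshift n n) M -> greg k n) by move=> r u v; apply: linearP.
have H : is_gmap (l : restr (@rshift n n) M -> greg k n).
  by apply: (fg_gmap lL (e := e)) => v; exists (fun i => c i v); apply: E.
by exists (mk_gmap H).
Qed.

(** The exterior product followed by the coefficient of the top exterior monomial; it is nonzero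
    only between degrees j and m - j. The sign involution makes the differentials adjoint
    up to sign. *)
Fixpoint beta m : K V' m -> K V m -> R := match m return K V' m -> K V m -> R with
  | 0 => fun a z => bdual_app a z
  | m.+1 => fun a z => beta (m := m) a.1 z.2 + beta (m := m) a.2 (ksig _ m z.1)
  end.

Lemma betaE m (f : K V' m.+1) (z : K V m.+1) :
  beta f z = beta f.1 z.2 + beta f.2 (ksig _ m z.1).
Proof. by []. Qed.

Lemma betaD m (f g : K V' m) z : beta (f + g) z = beta f z + beta g z.
Proof.
elim: m f g z => [|m IHm] f g z; first exact: appD.
by rewrite betaE !betaE -[(f + g).1]/(f.1 + g.1) -[(f + g).2]/(f.2 + g.2) !IHm addrACA.
Qed.

Lemma beta0 m z : beta (0 : K V' m) z = 0.
Proof. by apply: (addrI (beta 0 z)); rewrite -betaD !addr0. Qed.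

Lemma betaN m (f : K V' m) z : beta (- f) z = - beta f z.
Proof. by apply/eqP; rewrite -addr_eq0 -betaD addNr beta0. Qed.

Lemma beta_lin m (f : K V' m) : linear (beta f : K V m -> R^o).
Proof.
elim: m f => [|m IHm] f; first exact: app_lin.
apply: lin_add; first by apply: (lin_comp (mklin (IHm _))); linsolve.
by apply: (lin_comp (mklin (IHm _))); apply: lin_comp; linsolve.
Qed.

Definition betal m (f : K V' m) : {linear K V m -> R^o} := mklin (beta_lin f).

Lemma betaBr m (f : K V' m) z w : beta f (z - w) = beta f z - beta f w.
Proof. exact: (linearB (betal f)). Qed.
Lemma betaDr m (f : K V' m) z w : beta f (z + w) = beta f z + beta f w.
Proof. exact: (linearD (betal f)). Qed.
Lemma betaNr m (f : K V' m) z : beta f (- z) = - beta f z.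
Proof. exact: (linearN (betal f)). Qed.
Lemma beta0r m (f : K V' m) : beta f 0 = 0.
Proof. exact: (linear0 (betal f)). Qed.
Lemma betaZr m (f : K V' m) r z : beta f (r *: z) = r * beta f z.
Proof. exact: (linearZ_LR (betal f)). Qed.

Local Notation d := (dif (@yv k n) V).
Local Notation d' := (dif (@yv k n) V').

(** The duality exchanges the left and the right action, hence the sign. *)
Lemma app_dif i f v : bdual_app (d' i f) v = - bdual_app f (d i v).
Proof.
have E : d i v = lact (yv k n i) v - ract v (yv k n i) :> M by [].
have appB (h h' : bdual M) (w : M) : bdual_app (h - h') w = bdual_app h w - bdual_app h' w by [].
have appBr (h : bdual M) (w w' : M) : bdual_app h (w - w') = bdual_app h w - bdual_app h w'.
  exact: (linearB (appl h)).
have appZ (h : bdual M) (w : M) p : bdual_app h (ract w p) = p * bdual_app h w.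
  exact: (linearZ_LR (appl h)).
have E' : d' i f = lact (yv k n i) f - ract f (yv k n i) :> bdual M by [].
rewrite E' appB app_lact app_ract.
by rewrite E appBr appZ opprB.
Qed.

Lemma beta_map m i (f : K V' m) z : beta (Kmap m (d' i) f) z = - beta f (Kmap m (d i) z).
Proof.
elim: m f z => [|m IHm] f z; first exact: app_dif.
rewrite -[LHS]/(beta (Kmap m (d' i) f.1) z.2 + beta (Kmap m (d' i) f.2) (ksig _ m z.1)).
rewrite !IHm -ksig_map -opprD.
by [].
Qed.

(** X_i - y_i on M^vee is adjoint to y_i - X_i on M, and the recursion for the two differentials
    is compared componentwise. *)
Lemma beta_D m (f : K V' m) z : beta (KD m d' f) z = beta f (ksig _ m (KD m d z)).
Proof.
elim: m f z => [|m IHm] f z; first by rewrite [RHS](beta0r f); apply: (@beta0 0).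
rewrite -[LHS]/(beta (KD m d' f.1) z.2 + beta (Kmap m (d' m) f.1 - KD m d' f.2) (ksig _ m z.1)).
rewrite -[RHS]/(beta f.1 (- ksig _ m (Kmap m (d m) z.1 - KD m d z.2)) +
  beta f.2 (ksig _ m (ksig _ m (KD m d z.1)))).
rewrite betaD betaN beta_map !IHm linearB ksig_map opprB betaBr ksigK.
rewrite (ksig_D d (ksig _ m z.1)) ksigK betaNr opprK addrA.
by [].
Qed.

(** Together with beta_ext, the pairing is perfect on the side of the dual bimodule. *)
Lemma beta_exists m (fgV : fgproj V) (l : {linear K V m -> R^o}) :
  exists f : K V' m, forall z, beta f z = l z.
Proof.
elim: m l => [|m IHm] l; first exact: app_exists.
have l2 : linear (fun z : K V m => l (0, z)).
  by apply: (lin_comp l); apply: lin_pair; linsolve.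
have l1 : linear (fun z : K V m => l (ksig _ m z, 0)).
  by apply: (lin_comp l); apply: lin_pair; [apply: lin_comp|]; linsolve.
have [f1 E1] := IHm (mklin l2); have [f2 E2] := IHm (mklin l1).
exists (f1, f2) => z; rewrite betaE E1 E2 -[mklin l2 z.2]/(l (0, z.2)).
rewrite -[mklin l1 _]/(l (ksig _ m (ksig _ m z.1), 0)) ksigK -linearD; congr (l _).
by case: z => a b; apply: injective_projections; rewrite ?pairE /= ?addr0 ?add0r.
Qed.

Lemma beta_ext m (f : K V' m) : (forall z, beta f z = 0) -> f = 0.
Proof.
elim: m f => [|m IHm] f E; first by apply: app_ext => v; apply: (E v).
apply: injective_projections; apply: IHm => z.
  have := E (0, z); rewrite -[LHS]/(beta f.1 z + beta f.2 (ksig V m 0)).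
  by rewrite linear0 beta0r addr0.
have := E (ksig _ m z, 0); rewrite -[LHS]/(beta f.1 0 + beta f.2 (ksig V m (ksig V m z))).
by rewrite beta0r add0r ksigK.
Qed.

Lemma beta_pr m j (f : K V' m) z : (j <= m)%N ->
  beta (kpr _ m j f) z = beta f (kpr _ m (m - j) z).
Proof.
elim: m j f z => [|m IHm] j f z; first by case: j.
case: f z => f g [a b]; case: j => [_|j jm].
  rewrite subn0 -[LHS]/(beta (kpr _ m 0 f) b + beta 0 (ksig _ m a)).
  rewrite -[RHS]/(beta f (kpr _ m m b) + beta g (ksig _ m (kpr _ m m.+1 a))).
  by rewrite beta0 (kpr_big _ (ltnSn m)) linear0 beta0r !addr0 IHm // subn0.
rewrite subSS -[LHS]/(beta (kpr _ m j.+1 f) b + beta (kpr _ m j g) (ksig _ m a)).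
rewrite ltnS in jm; rewrite (IHm j) // -ksig_pr betaE; congr (_ + _).
case: (ltnP j m) => jm'; last first.
  have -> : j = m by lia.
  by rewrite subnn (kpr_big _ (ltnSn m)) beta0 [X in beta _ X](_ : _ = 0) ?beta0r.
by rewrite (IHm j.+1) //; have -> : (m - j = (m - j.+1).+1)%N by lia.
Qed.

End Pairing.

Section Duality.
Variables (k : fieldType) (n : nat) (M : gbimod k n).
Local Notation R := {mpoly k[n]}.
Local Notation V := (opm M).
Local Notation V' := (opm (bdual M)).
Local Notation D := (KD n (dif (@yv k n) V)).
Local Notation D' := (KD n (dif (@yv k n) V')).

Lemma beta_cocycle (f : K V' n) w : D' f = 0 -> beta f (D w) = 0.
Proof.
move=> f0; have -> : D w = ksig _ n (- D (ksig _ n w)).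
  by rewrite -ksig_D ksigK.
by rewrite -linearN -beta_D f0 beta0.
Qed.

Lemma beta_coboundary (f : K V' n) z : D z = 0 -> beta (D' f) z = 0.
Proof. by move=> z0; rewrite beta_D z0 linear0 beta0r. Qed.

Lemma lact_lin (N : gbimod k n) p : linear (fun v : opm N => lact p v : opm N).
Proof. by move=> r u v; rewrite !opm_scaleE lactD lact_ract. Qed.

Definition lactl (N : gbimod k n) p : {linear opm N -> opm N} := mklin (@lact_lin N p).

Lemma beta_lactl m p (f : K V' m) z : beta (Kmap m (lactl (bdual M) p) f) z = p * beta f z.
Proof.
elim: m f z => [|m IHm] f z; first exact: app_lact.
by rewrite -[LHS]/(beta (Kmap m (lactl _ p) f.1) z.2 + beta (Kmap m (lactl _ p) f.2) (ksig _ m z.1))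
  !IHm -mulrDr.
Qed.

Lemma D_lactl (N : gbimod k n) m p z :
  Kmap m (lactl N p) (KD m (dif (@yv k n) (opm N)) z) =
  KD m (dif (@yv k n) (opm N)) (Kmap m (lactl N p) z).
Proof.
apply: KD_nat => i v _; rewrite !difE.
by rewrite /= /lact !scalerA mulrC.
Qed.

(** X_i - y_i acts by 0 on cohomology, contraction with the i-th generator being a homotopy, so
    the left action of R on it agrees with the right one. *)
Lemma beta_left_right (f : K V' n) z p : D' f = 0 -> D z = 0 ->
  beta f (Kmap n (lactl M p) z) = beta f (p *: z).
Proof.
move=> f0; elim/mpoly_gen_ind: p z => [c|i|p q IHp IHq|p q IHp IHq] z z0.
- congr (beta f _); rewrite -[RHS]Kmap_scl; apply: Kmap_ext => v.
  rewrite /= opm_scaleE /lact /ract /ren !comp_mpolyC.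
  by [].
- have <- : Kmap n (dif (@yv k n) V i) z + 'X_i *: z = Kmap n (lactl M 'X_i) z.
    rewrite -[X in _ + X]Kmap_scl -(Kmap_add (f := lactl M 'X_i)) // => v.
    by rewrite -[dif _ _ _ v]/(om_X i v - yv k n i *: v) yv_ord subrK opm_XE yv_ord.
  rewrite betaDr -(kio_homotopy _ _ (ltn_ord i)) z0.
  have -> : kio i (0 : K V n) = 0 by apply: (addrI (kio i 0)); rewrite -kio_D_add !addr0.
  by rewrite addr0 beta_cocycle // add0r.
- rewrite (Kmap_add (f := lactl M (p + q)) (g := lactl M p) (h := lactl M q)) => [|v].
    by rewrite betaDr IHp // IHq // scalerDl betaDr.
  exact: lactDl.
- rewrite (Kmap_comp (g := lactl M p) (f := lactl M q)) => [|v]; last exact: lactM.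
  by rewrite IHp ?betaZr ?IHq ?betaZr ?mulrA // -D_lactl z0 linear0.
Qed.

Hypotheses (MS : ksplit (@yv k n) n V) (Mfg : fgproj V).

Lemma beta_nondeg (z : K V n) : (forall f, beta f z = 0) -> z = 0.
Proof.
move=> z0; have [I [e [c E]]] := fg_K n Mfg.
rewrite (E z) big1 // => i _; have [f Ef] := beta_exists Mfg (c i).
by rewrite -Ef z0 scale0r.
Qed.

Section Degree.
Variables (i : nat) (i_le_n : (i <= n)%N).

(** For every f the functional beta f \o (1 - D h) vanishes on coboundaries, so that it
    is the pairing with a cocycle g, of which only the part of degree n - i sees z. Hence
    beta f (z - D (h z)) = beta g z = 0 for all f, and z = D (h z). *)
Theorem dual_inj (z : K V n) : kpr _ n i z = z -> D z = 0 ->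
  (forall f, kpr _ n (n - i) f = f -> D' f = 0 -> beta f z = 0) -> exists w, z = D w.
Proof.
move=> zi z0 H; have [h hP] := MS; exists (h z).
apply/eqP; rewrite -subr_eq0; apply/eqP; apply: beta_nondeg => f.
pose l : {linear K V n -> R^o} := betal f \o (idfun \- (D \o h)).
have [g Eg] := beta_exists Mfg l.
have lD w : l (D w) = 0 by rewrite -[l _]/(beta f (D w - D (h (D w)))) hP subrr beta0r.
have g0 : D' g = 0.
  by apply: beta_ext => w; rewrite beta_D Eg ksig_D -linearN lD.
rewrite -[beta f _]/(l z) -Eg -zi.
have -> : beta g (kpr _ n i z) = beta (kpr _ n (n - i) g) z.
  by rewrite beta_pr ?leq_subr // subKn.
by apply: H; rewrite ?kpr_idem // -kprS_D g0 linear0.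
Qed.

(** Let e, c be a dual basis of K(M). The functionals c_a \o (1 - D h) are the pairings with
    cocycles g_a, and every cocycle is f = sum_a beta(f, e_a) g_a, as f does not see the
    coboundary D (h z). So L f = sum_a beta(f, e_a) L(g_a) = beta(f, z) for
    z = sum_a L(g_a) e_a. This z is a cocycle since L vanishes on coboundaries. *)
Theorem dual_surj (L : K V' n -> R) :
  (forall f g, kpr _ n (n - i) f = f -> D' f = 0 -> kpr _ n (n - i) g = g -> D' g = 0 ->
     L (f + g) = L f + L g) ->
  (forall f p, kpr _ n (n - i) f = f -> D' f = 0 -> L (Kmap n (lactl (bdual M) p) f) = p * L f) ->
  (forall g, kpr _ n (n - i) (D' g) = D' g -> L (D' g) = 0) ->
  exists z, [/\ kpr _ n i z = z, D z = 0 &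
    forall f, kpr _ n (n - i) f = f -> D' f = 0 -> L f = beta f z].
Proof.
move=> LD LZ LB; have [h hP] := MS; have [I [e [c E]]] := fg_K n Mfg.
pose l a : {linear K V n -> R^o} := c a \o (idfun \- (D \o h)).
have /choice[g Eg] : forall a, exists g : K V' n, forall z, beta g z = l a z.
  by move=> a; apply: beta_exists.
have g0 a : D' (g a) = 0.
  apply: beta_ext => w; rewrite beta_D Eg ksig_D -linearN.
  by rewrite -[l a _]/(c a (D _ - D (h (D _)))) hP subrr linear0.
pose j := (n - i)%N; pose gj a := kpr _ n j (g a).
have gjj a : kpr _ n j (gj a) = gj a by apply: kpr_idem.
have gj0 a : D' (gj a) = 0 by rewrite -kprS_D g0 linear0.
pose z0 := \sum_a L (gj a) *: e a.
have L0 : L 0 = 0.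
  have E0 := LB 0; rewrite linear0 linear0 in E0; exact: E0.
have prlact a p f : kpr _ n a (Kmap n (lactl (bdual M) p) f) =
    Kmap n (lactl (bdual M) p) (kpr _ n a f) by apply: kpr_map.
have Lsum f : kpr _ n j f = f -> D' f = 0 -> L f = beta f z0.
  move=> fj f0.
  pose S s := \sum_(a <- s) Kmap n (lactl (bdual M) (beta f (e a))) (gj a).
  have Sj s : kpr _ n j (S s) = S s.
    by rewrite linear_sum; apply: eq_bigr => a _; rewrite prlact gjj.
  have S0 s : D' (S s) = 0.
    by rewrite linear_sum big1 // => a _; rewrite -D_lactl gj0 linear0.
  have LS s : L (S s) = \sum_(a <- s) beta f (e a) * L (gj a).
    elim: s => [|a s IHs]; first by rewrite /S !big_nil.
    rewrite /S !big_cons LD -/(S s) ?IHs ?LZ //.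
    - by rewrite prlact gjj.
    - by rewrite -D_lactl gj0 linear0.
  have fS : f = S (index_enum I).
    apply/eqP; rewrite -subr_eq0; apply/eqP.
    pose S' := \sum_a Kmap n (lactl (bdual M) (beta f (e a))) (g a).
    have -> : S (index_enum I) = kpr _ n j S'.
      by rewrite linear_sum; apply: eq_bigr => a _; rewrite prlact.
    rewrite -{1}fj -linearB; suff -> : f - S' = 0 by rewrite linear0.
    apply: beta_ext => z; rewrite betaD betaN; apply/eqP; rewrite subr_eq0; apply/eqP.
    have -> : beta S' z = \sum_a beta f (e a) * beta (g a) z.
      rewrite /S'; elim/big_rec2: _ => [|a x y _ <-]; first exact: beta0.
      by rewrite betaD beta_lactl.
    have -> : beta f z = beta f (z - D (h z)) by rewrite betaBr beta_cocycle // subr0.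
    rewrite {1}(E (z - D (h z))).
    transitivity (\sum_a beta f ((c a (z - D (h z)) : R) *: e a)).
      exact: (linear_sum (betal f)).
    by apply: eq_bigr => a _; rewrite betaZr mulrC Eg.
  rewrite {1}fS LS /z0.
  transitivity (\sum_a beta f (L (gj a) *: e a)); last exact/esym/(linear_sum (betal f)).
  by apply: eq_bigr => a _; rewrite betaZr mulrC.
have prz f : beta f (kpr _ n i z0) = beta (kpr _ n j f) z0.
  by rewrite beta_pr ?leq_subr // /j subKn.
exists (kpr _ n i z0); split; first exact: kpr_idem.
  apply: (can_inj (@ksigK _ V n)); rewrite linear0; apply: beta_nondeg => f.
  rewrite -beta_D prz; have Dj : D' (kpr _ n j (D' f)) = 0.
    by rewrite -kprS_D (KD_sq f (@dif_C _ (@yv k n) V')) linear0.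
  rewrite -Lsum ?kpr_idem //.
  case Ej : j => [|j']; first by rewrite kpr0_D.
  rewrite kprS_D LB // -/j Ej kprS_D kpr_idem.
  by [].
by move=> f fj f0; rewrite prz fj; apply: Lsum.
Qed.
End Degree.
End Duality.

(** * Koszul cohomology and Ext *)

Section EvalMore.
Variables (k : fieldType) (n : nat).
Local Notation R := {mpoly k[n]}.
Local Notation S := {mpoly k[n + n]}.
Local Notation W m := (W k n m).
Implicit Types M N : gbimod k n.

Lemma kev0 M m z : @kev k n M m z 0 = 0.
Proof. exact: (linear0 (mklin (@kev_lin k n M m z))). Qed.

Lemma kevDr M m z u v : @kev k n M m z (u + v) = kev z u + kev z v.
Proof. exact: (linearD (mklin (@kev_lin k n M m z))). Qed.

Lemma kev_zero M m v : @kev k n M m 0 v = 0.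
Proof. by apply: (addrI (kev 0 v)); rewrite -kevD !addr0. Qed.

Lemma kev_kpr M m j z v : kev (kpr (opm M) m j z) v = kev z (Wpr k n m j v).
Proof.
elim: m j z v => [|m IHm] [|j] z v //.
- by rewrite -[kpr _ 0 _ _]/(0 : K (opm M) 0) kev_zero -[Wpr _ _ _ _ _]/(0 : W 0) kev0.
- rewrite -[LHS]/(kev (kpr _ m 0 z.1) v.1 + kev 0 v.2) kev_zero.
  rewrite -[RHS]/(kev z.1 (Wpr k n m 0 v.1) + kev z.2 0) kev0.
  by rewrite IHm.
- rewrite -[LHS]/(kev (kpr _ m j.+1 z.1) v.1 + kev (kpr _ m j z.2) v.2) !IHm.
  by [].
Qed.

Definition opml M N (g : ghom M N) : {linear opm M -> opm N} := mklin (opm_map_lin g).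

Lemma kev_opml M N (g : ghom M N) m z v : kev (Kmap m (opml g) z) v = g (kev z v).
Proof.
elim: m z v => [|m IHm] z v; first by rewrite /= ghomZ.
by rewrite -[LHS]/(kev (Kmap m _ z.1) v.1 + kev (Kmap m _ z.2) v.2) !IHm ghomD.
Qed.

Lemma kev_lactl M p m z v : kev (Kmap m (lactl M p) z) v = lact p (kev z v).
Proof.
elim: m z v => [|m IHm] z v; first by rewrite /= /lact !scalerA mulrC.
by rewrite -[LHS]/(kev (Kmap m _ z.1) v.1 + kev (Kmap m _ z.2) v.2) !IHm lactD.
Qed.

Lemma W_fg m : exists (I : finType) (e : I -> W m),
  forall v, exists c : I -> S, v = \sum_i c i *: e i.
Proof.
elim: m => [|m [I [e He]]].
  exists unit, (fun=> (1 : S)) => v; exists (fun=> (v : S)).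
  by rewrite big_const card_unit /= addr0; apply/esym/mulr1.
exists (I + I)%type, (fun x => match x with inl i => (e i, 0) | inr i => (0, e i) end) => -[v w].
have [c ->] := He v; have [c' ->] := He w.
exists (fun x => match x with inl i => c i | inr i => c' i end); rewrite big_sumType /=.
have E1 : \sum_i (c i *: (e i, 0)) = (\sum_i c i *: e i, 0) :> (W m * W m)%type.
  elim/big_rec2: _ => [//|i x y _ ->].
  by apply: injective_projections; rewrite ?pairE /= ?scaler0 ?addr0.
have E2 : \sum_i (c' i *: (0, e i)) = (0, \sum_i c' i *: e i) :> (W m * W m)%type.
  elim/big_rec2: _ => [//|i x y _ ->].
  by apply: injective_projections; rewrite ?pairE /= ?scaler0 ?addr0.
rewrite -[RHS]/((\sum_i (c i *: (e i, 0)) + \sum_i (c' i *: (0, e i))) : (W m * W m)%type) E1 E2.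
by apply: injective_projections; rewrite ?pairE /= ?add0r ?addr0.
Qed.

Lemma kev_gmap M m (z : K (opm M) m) : is_gmap (kev z : W m -> M).
Proof. by have [I [e He]] := W_fg m; apply: (fg_gmap (@kev_lin k n M m z) He). Qed.

(** The exterior generators count as having degree 0 here. A map of degree a on the part of
    homological degree i of the resolution has its values on generators, which have
    degree 2i there, in degree a + 2i: this is the shift of HHt. *)
Fixpoint khom M m (j : int) : K (opm M) m -> Prop := match m return K (opm M) m -> Prop with
  | 0 => fun z => @gm_hom _ _ M j z
  | m.+1 => fun z => khom (m := m) j z.1 /\ khom (m := m) j z.2
  end.

Lemma toK_hom M m i (g : W m -> M) a : linear g ->
  (forall l v, gm_hom l v -> gm_hom (l + a) (g v)) -> (forall v, g (Wpr k n m i v) = g v) ->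
  khom (a + (2 * i)%:Z) (toK g).
Proof.
elim: m i g a => [|m IHm] i g a gL gH gi.
  have Hg : gm_hom a (g (1 : S)).
    by rewrite -[a]add0r; apply: gH; rewrite -mpolyC1; apply: phomogC.
  case: i gi => [|i] gi; first by rewrite muln0 addr0.
  have E0 : g (1 : S) = 0 by rewrite -gi; apply: (linear0 (mklin gL)).
  by rewrite -[khom _ _]/(@gm_hom _ _ M (a + (2 * i.+1)%:Z) (g (1 : S))) E0; apply: gm_hom0.
have lin1 : linear (fun s : W m => g (s, 0)).
  by apply: (lin_comp (mklin gL)); apply: (lin_pair (@lin_id _ (W m)) (@lin_0 _ (W m) (W m))).
have lin2 : linear (fun t : W m => g (0, t)).
  by apply: (lin_comp (mklin gL)); apply: (lin_pair (@lin_0 _ (W m) (W m)) (@lin_id _ (W m))).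
split.
  apply: IHm => // [l v Hv|v]; first by apply: gH; split=> //; apply: (gm_hom0 (W m)).
  rewrite -[RHS]gi -[LHS]/(g (Wpr k n m i v, 0)); congr (g (_, _)).
  by case: i {gi} => //= i; apply/esym/(ghom0 (Wpr k n m i)).
have H2 l (v : W m) : gm_hom l v -> gm_hom (l + (a + 2%:Z)) (g (0, v)).
  move=> Hv; rewrite [a + _]addrC addrA; apply: gH; split; first exact: (gm_hom0 (W m)).
  by rewrite /= addrK.
case: i gi => [|i] gi.
  rewrite muln0 addr0.
  have g0 v : g (0, v) = 0.
    rewrite -gi -[Wpr _ _ _ _ _]/(Wpr k n m 0 0, 0) ghom0; exact: (linear0 (mklin gL)).
  rewrite -[khom _ _]/(khom a (toK (fun t : W m => g (0, t)))).
  have -> : toK (fun t : W m => g (0, t)) = 0.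
    by apply: kev_inj => v; rewrite kev_toK ?kev_zero.
  by elim: (m) => [|m' IH]; [exact: gm_hom0|split].
have -> : a + (2 * i.+1)%:Z = (a + 2%:Z) + (2 * i)%:Z by rewrite -addrA; congr (_ + _); lia.
apply: IHm => // v; rewrite -[RHS]gi; congr (g (_, _)).
exact/esym/(ghom0 (Wpr k n m i.+1)).
Qed.

Lemma khom_sig M m j z : @khom M m j z -> khom j (ksig (opm M) m z).
Proof.
elim: m z => [//|m IHm] [a b] [Ha Hb]; split; first exact: IHm.
have N m' y : @khom M m' j y -> khom j (- y).
  elim: m' y => [y Hy|m' IH y [H1 H2]]; last by split; apply: IH.
  exact: (gradN (gm_grading M)).
exact/N/IHm.
Qed.

Lemma beta_hom M m a b f z : @khom (bdual M) m b f -> @khom M m a z -> phomog (a + b) (beta f z).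
Proof.
elim: m f z => [|m IHm] f z.
  by move=> Hf Hz; apply: app_hom.
case=> H1 H2 [H3 H4]; rewrite betaE; apply: (gradD (phomog_grading k n)).
  exact: IHm.
by apply: IHm => //; apply: khom_sig.
Qed.

Lemma ksig_opml M N (g : ghom M N) m z :
  ksig _ m (Kmap m (opml g) z) = Kmap m (opml g) (ksig _ m z).
Proof.
elim: m z => [//|m IHm] z.
rewrite -[LHS]/(ksig _ m (Kmap m (opml g) z.1), - ksig _ m (Kmap m (opml g) z.2)) !IHm.
by rewrite -[RHS]/(Kmap m (opml g) (ksig _ m z.1), Kmap m (opml g) (- ksig _ m z.2)) linearN.
Qed.

Lemma beta_nat M N (g : ghom M N) (g' : ghom (bdual N) (bdual M)) (c : R) :
  (forall f v, bdual_app (g' f) v = c * bdual_app f (g v)) ->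
  forall m f z, beta (Kmap m (opml g') f) z = c * beta f (Kmap m (opml g) z).
Proof.
move=> E; elim=> [|m IHm] f z; first exact: E.
rewrite -[LHS]/(beta (Kmap m (opml g') f.1) z.2 + beta (Kmap m (opml g') f.2) (ksig _ m z.1)).
by rewrite !IHm -ksig_opml -mulrDr.
Qed.
End EvalMore.

(** kap and lam are the maps on cochains that the chain maps th and ps between the Koszul
    resolution and P induce. They are inverse to each other on cohomology, as
    th \o ps and ps \o th are homotopic to the identity. *)
Section Comparison.
Variables (k : fieldType) (n : nat) (P : gprojres (Rbim k n)).
Local Notation R := {mpoly k[n]}.
Local Notation S := {mpoly k[n + n]}.
Local Notation W m := (W k n m).
Local Notation Q := (Qres k n).
Local Notation D M := (KD n (dif (@yv k n) (opm M))).
Implicit Types M N : gbimod k n.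
Variables (th : forall i, ghom (Q i) (P i)) (ps : forall i, ghom (P i) (Q i)).
Hypothesis th_aug : forall x, pr_aug P (th 0%N x) = pr_aug Q x.
Hypothesis th_d : forall i x, pr_d P i (th i.+1 x) = th i (pr_d Q i x).
Hypothesis ps_aug : forall x, pr_aug Q (ps 0%N x) = pr_aug P x.
Hypothesis ps_d : forall i x, pr_d Q i (ps i.+1 x) = ps i (pr_d P i x).

Definition Qin i : ghom (Q i) (W n) := gincl (gim (Wpr k n n i)).

Lemma Qpr_Wd i v : Qpr k n i (Wd k n n v) = pr_d Q i (Qpr k n i.+1 v).
Proof. by apply: gsub_inj; apply/esym/Wd_pr. Qed.

Lemma Qin_d i (x : Q i.+1) : Qin i (pr_d Q i x) = Wd k n n (Qin i.+1 x).
Proof. by []. Qed.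

Definition kap M i (c : gmap (P i) M) : K (opm M) n :=
  toK (fun v : W n => c (th i (Qpr k n i v))).

Lemma kap_lin M i (c : gmap (P i) M) : linear (fun v : W n => c (th i (Qpr k n i v))).
Proof.
move=> r u v; rewrite (gfun_lin (Qpr k n i)) (gfun_lin (th i)).
exact: (gmap_val_linear c).
Qed.

Lemma kev_kap M i (c : gmap (P i) M) v : kev (kap c) v = c (th i (Qpr k n i v)).
Proof. exact: (kev_toK v (@kap_lin M i c)). Qed.

Lemma kap_pr M i (c : gmap (P i) M) : kpr _ n i (kap c) = kap c.
Proof.
apply: kev_inj => v; rewrite kev_kpr !kev_kap; congr (c (th i _)).
by apply: gsub_inj; apply: Wpr_idem.
Qed.

Lemma kap_D M i (c : gmap (P i) M) : (forall x, c (pr_d P i x) = 0) -> D M (kap c) = 0.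
Proof.
move=> c0; apply: kev_inj => v; rewrite kev_D kev_zero kev_kap Qpr_Wd -th_d.
exact: c0.
Qed.

Lemma kap_B M i (c' : gmap (P i) M) (c : gmap (P i.+1) M) :
  (forall x, c x = c' (pr_d P i x)) -> kap c = D M (kap c').
Proof.
by move=> E; apply: kev_inj => v; rewrite kev_D !kev_kap E th_d -Qpr_Wd.
Qed.

Lemma kap_add M i (c c' : gmap (P i) M) : kap (c + c') = kap c + kap c'.
Proof. by apply: kev_inj => v; rewrite kevD !kev_kap. Qed.

Lemma kap_opp M i (c : gmap (P i) M) : kap (- c) = - kap c.
Proof. by apply: kev_inj => v; rewrite kevN !kev_kap. Qed.

Lemma kap_lact M i p (c c' : gmap (P i) M) :
  (forall x, c' x = lact p (c x)) -> kap c' = Kmap n (lactl M p) (kap c).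
Proof. by move=> E; apply: kev_inj => v; rewrite kev_lactl !kev_kap E. Qed.

Lemma kap_nat M N i (g : ghom M N) (c : gmap (P i) M) (c' : gmap (P i) N) :
  (forall x, c' x = g (c x)) -> kap c' = Kmap n (opml g) (kap c).
Proof. by move=> E; apply: kev_inj => v; rewrite kev_opml !kev_kap E. Qed.

Lemma kap_hom M i (c : gmap (P i) M) a : homog_map a c -> khom (a + (2 * i)%:Z) (kap c).
Proof.
move=> Hc; apply: toK_hom; first exact: kap_lin.
  by move=> l v Hv; apply: Hc; do 2!apply: gfun_deg.
by move=> v; congr (c (th i _)); apply: gsub_inj; apply: Wpr_idem.
Qed.

Definition lam M i (z : K (opm M) n) : gmap (P i) M :=
  gmap_precomp (gcomp (ps i) (Qin i)) (mk_gmap (@kev_gmap k n M n z)).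

Lemma lamE M i z x : lam i z x = @kev k n M n z (Qin i (ps i x)).
Proof. by []. Qed.

Lemma lam_cocycle M i (z : K (opm M) n) x : D M z = 0 -> lam i z (pr_d P i x) = 0.
Proof. by move=> z0; rewrite lamE -ps_d Qin_d -kev_D z0 kev_zero. Qed.

Lemma lam_coboundary M i (w : K (opm M) n) x : lam i.+1 (D M w) x = lam i w (pr_d P i x).
Proof. by rewrite !lamE kev_D -Qin_d ps_d. Qed.

Lemma kap_lam M i (z : K (opm M) n) : kpr _ n i z = z -> D M z = 0 ->
  exists w, kap (lam i z) = z + D M w.
Proof.
move=> zi z0.
have kz v : kev z (Wpr k n n i v) = kev z v by rewrite -kev_kpr zi.
pose g j := gsubt (gcomp (th j) (ps j)) (gid (Q j)).
have gd j x : pr_d Q j (g j.+1 x) = g j (pr_d Q j x).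
  apply: etrans (ghomB (pr_d Q j) (ps j.+1 (th j.+1 x)) x) _.
  by rewrite ps_d th_d.
have g0 x : pr_aug Q (g 0%N x) = 0.
  apply: etrans (ghomB (pr_aug Q) (ps 0%N (th 0%N x)) x) _.
  by rewrite ps_aug th_aug subrr.
have E v : kev (kap (lam i z)) v = kev z v + kev z (Qin i (g i (Qpr k n i v))).
  rewrite kev_kap lamE -(kz v) -[Wpr _ _ _ _ v]/(Qin i (Qpr k n i v)).
  rewrite -kevDr -ghomD.
  by congr (kev z (Qin i _)); rewrite addrC subrK.
case: i zi kz g gd g0 E => [|i] zi kz g gd g0 E.
  exists 0; rewrite linear0 addr0; apply: kev_inj => v; rewrite E.
  have [h Eh] := homotopy0 g0.
  by rewrite -Eh Qin_d -kev_D z0 kev_zero addr0.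
have [h [h' Eh]] := homotopyS gd g0 i.
exists (toK (fun v : W n => kev z (Qin i.+1 (h' (Qpr k n i v))))).
apply: kev_inj => v; rewrite E kevD kev_D; congr (_ + _).
rewrite kev_toK; last first.
  move=> r u w; rewrite (gfun_lin (Qpr k n i)) (gfun_lin h') (gfun_lin (Qin i.+1)).
  exact: kev_lin.
rewrite Eh ghomD kevDr Qpr_Wd.
by rewrite -[X in X + _]/(kev z (Wd k n n (Qin i.+2 (h (Qpr k n i.+1 v))))) -kev_D z0 kev_zero add0r.
Qed.

Lemma lam_kap0 M (c : gmap (P 0) M) : (forall x, c (pr_d P 0 x) = 0) -> lam 0 (kap c) = c.
Proof.
move=> c0; apply: gmapE => x; rewrite lamE kev_kap.
have -> : Qpr k n 0 (Qin 0 (ps 0 x)) = ps 0 x by apply: Qpr_id.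
pose g j := gsubt (gcomp (ps j) (th j)) (gid (P j)).
have gd j y : pr_d P j (g j.+1 y) = g j (pr_d P j y) by rewrite ghomB /= th_d ps_d.
have g0 y : pr_aug P (g 0%N y) = 0 by rewrite ghomB /= th_aug ps_aug subrr.
have [h Eh] := homotopy0 g0.
apply/eqP; rewrite -subr_eq0 -(linearB c) -[th 0 (ps 0 x) - x]/(g 0%N x) -Eh.
exact/eqP/c0.
Qed.

Lemma lam_kapS M i (c : gmap (P i.+1) M) : (forall x, c (pr_d P i.+1 x) = 0) ->
  exists c' : gmap (P i) M, forall x, lam i.+1 (kap c) x - c x = c' (pr_d P i x).
Proof.
move=> c0.
pose g j := gsubt (gcomp (ps j) (th j)) (gid (P j)).
have gd j y : pr_d P j (g j.+1 y) = g j (pr_d P j y) by rewrite ghomB /= th_d ps_d.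
have g0 y : pr_aug P (g 0%N y) = 0 by rewrite ghomB /= th_aug ps_aug subrr.
have [h [h' Eh]] := homotopyS gd g0 i.
exists (gmap_precomp h' c) => x; rewrite lamE kev_kap.
have -> : Qpr k n i.+1 (Qin i.+1 (ps i.+1 x)) = ps i.+1 x by apply: Qpr_id.
rewrite -(linearB c) -[th _ _ - x]/(g i.+1 x) Eh (linearD c).
by apply: etrans (add0r _); congr (_ + _); apply: c0.
Qed.
End Comparison.

(** * The isomorphism in one degree *)

Section Classes.
Variables (k : fieldType) (n : nat) (P : gprojres (Rbim k n)).
Local Notation R := {mpoly k[n]}.
Local Notation S := {mpoly k[n + n]}.
Local Notation Q := (Qres k n).
Local Notation D M := (KD n (dif (@yv k n) (opm M))).
Implicit Types M N : gbimod k n.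
Variables (th : forall i, ghom (Q i) (P i)) (ps : forall i, ghom (P i) (Q i)).
Hypothesis th_aug : forall x, pr_aug P (th 0%N x) = pr_aug Q x.
Hypothesis th_d : forall i x, pr_d P i (th i.+1 x) = th i (pr_d Q i x).
Hypothesis ps_aug : forall x, pr_aug Q (ps 0%N x) = pr_aug P x.
Hypothesis ps_d : forall i x, pr_d Q i (ps i.+1 x) = ps i (pr_d P i x).

Local Notation kap := (kap th).

Definition cval M i (u : gsub (cocycles P i M)) : gmap (P i) M := gsub_val u.

Lemma cocycleP M i (u : gsub (cocycles P i M)) x : cval u (pr_d P i x) = 0.
Proof.
by have /(congr1 (fun g : gmap (P i.+1) M => g x)) := gsub_valP u.
Qed.

Lemma mk_cocycle M i (c : gmap (P i) M) : (forall x, c (pr_d P i x) = 0) -> cocycles P i M c.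
Proof. by move=> H; apply: gmapE. Qed.

Lemma coboundary_kap M i (u : gsub (cocycles P i M)) : coboundaries P i M u ->
  exists w, kap (cval u) = D M w.
Proof.
case: i u => [|i] u [y E].
  exists 0; rewrite linear0; apply: kev_inj => v; rewrite kev_zero kev_kap.
  by rewrite -E.
exists (kap (y : gmap (P i) M)); apply: kap_B => // x; rewrite -E.
by [].
Qed.

Lemma kap_coboundary M i (u : gsub (cocycles P i M)) w : kap (cval u) = D M w ->
  coboundaries P i M u.
Proof.
case: i u => [|i] u E.
  exists u; apply: gsub_inj; apply/esym.
  have u0 : kap (cval u) = 0 by rewrite -kap_pr E kpr0_D.
  rewrite -[LHS]/(cval u) -(lam_kap0 th_aug th_d ps_aug ps_d (cocycleP u)) u0.
  by apply: gmapE => x; rewrite lamE kev_zero.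
have [c' Ec] := lam_kapS th_aug th_d ps_aug ps_d (cocycleP u).
exists ((lam ps i w - c' : gmap (P i) M) : coch P i M); apply: gsub_inj; apply: gmapE => x.
rewrite -[RHS]/(cval u x) -[LHS]/(lam ps i w (pr_d P i x) - c' (pr_d P i x)).
by rewrite -Ec -lam_coboundary // -E opprB addrC subrK.
Qed.

(** A Koszul cocycle that represents a class. *)
Definition ech M i (e : HHt P i M) : K (opm M) n :=
  kap (cval (grepr (e : gquot_car (coboundaries P i M)))).

Lemma ech_pr M i (e : HHt P i M) : kpr _ n i (ech e) = ech e.
Proof. exact: kap_pr. Qed.

Lemma ech_D M i (e : HHt P i M) : D M (ech e) = 0.
Proof. by apply: kap_D => // x; apply: cocycleP. Qed.

Lemma ech_gpi M i (u : gsub (cocycles P i M)) :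
  exists w, ech (gpi (coboundaries P i M) u : HHt P i M) = kap (cval u) + D M w.
Proof.
have [w Ew] := coboundary_kap (@grepr_gpi _ _ _ (coboundaries P i M) u).
exists w; rewrite -Ew addrC; apply/eqP; rewrite -subr_eq; apply/eqP.
by rewrite -kap_opp -kap_add.
Qed.

Lemma ech_eq M i (e : HHt P i M) (u : gsub (cocycles P i M)) :
  e = gpi (coboundaries P i M) u -> exists w, ech e = kap (cval u) + D M w.
Proof. by move=> ->; apply: ech_gpi. Qed.

Lemma rep_eq M i (e : HHt P i M) :
  e = gpi (coboundaries P i M) (grepr (e : gquot_car (coboundaries P i M))).
Proof. by rewrite greprK. Qed.

Lemma ech_add M i (e e' : HHt P i M) : exists w, ech (e + e') = ech e + ech e' + D M w.
Proof.
have [|w ->] := @ech_eq M i (e + e')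
  (grepr (e : gquot_car (coboundaries P i M)) + grepr (e' : gquot_car (coboundaries P i M))).
  by rewrite gpiD {1}(rep_eq e) {1}(rep_eq e').
by exists w; rewrite -kap_add.
Qed.

Lemma ech_lact M i p (e : HHt P i M) : exists w, ech (p *: e) = Kmap n (lactl M p) (ech e) + D M w.
Proof.
have [|w ->] := @ech_eq M i (p *: e)
  (ren (@lshift n n) p *: grepr (e : gquot_car (coboundaries P i M))) => //.
by exists w; congr (_ + _); apply: kap_lact.
Qed.

Lemma ech_nat M N i (g : ghom M N) (e : HHt P i M) :
  exists w, ech (HHt_map P i g e) = Kmap n (opml g) (ech e) + D N w.
Proof.
have [|w ->] := @ech_eq N i (HHt_map P i g e)
  (@cocycles_map _ _ _ P i M N g (grepr (e : gquot_car (coboundaries P i M)))) => //.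
by exists w; congr (_ + _); apply: kap_nat.
Qed.

Lemma ech_hom M i a (e : HHt P i M) : gm_hom a e ->
  exists z w, [/\ ech e = z + D M w, khom a z & D M z = 0].
Proof.
case=> u Hu /ech_eq[w Ew]; exists (kap (cval u)), w; split=> //.
  have -> : a = a + - (2 * i)%:Z + (2 * i)%:Z by rewrite subrK.
  exact: (kap_hom th Hu).
by apply: kap_D => // x; apply: cocycleP.
Qed.

Lemma ech_inj M i (e : HHt P i M) w : ech e = D M w -> e = 0.
Proof.
move=> /kap_coboundary H; rewrite (rep_eq e) -[RHS](gpi0 (coboundaries P i M)).
by apply/gpi_eq; rewrite subr0.
Qed.

Lemma ech_surj M i z : kpr (opm M) n i z = z -> D M z = 0 ->
  exists (e : HHt P i M) w, ech e = z + D M w.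
Proof.
move=> zi z0.
have Hc : cocycles P i M (lam ps i z) by apply: mk_cocycle => x; apply: lam_cocycle.
exists (gpi (coboundaries P i M) (mk_gsub Hc)).
have [w ->] := ech_gpi (mk_gsub Hc).
have [w' Ew'] := kap_lam th_aug th_d ps_aug ps_d zi z0.
by exists (w' + w); rewrite linearD addrA -Ew'.
Qed.

Section Pairing.
Variables (M : gbimod k n) (i : nat).
Local Notation H := (HHt P i M).
Local Notation H' := (HHt P (n - i) (bdual M)).

Definition ev2 (e' : H') (e : H) : R := beta (ech e') (ech e).

Lemma ev2_rep (e' : H') (e : H) f z w' w : D (bdual M) f = 0 -> D M z = 0 ->
  ech e' = f + D (bdual M) w' -> ech e = z + D M w -> ev2 e' e = beta f z.
Proof.
move=> f0 z0 E' E; rewrite /ev2 E' betaD (beta_coboundary _ (ech_D e)) addr0.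
by rewrite E betaDr beta_cocycle // addr0.
Qed.

Lemma ev2Dl e' e'' e : ev2 (e' + e'') e = ev2 e' e + ev2 e'' e.
Proof.
have [w E] := ech_add e' e''.
by rewrite /ev2 E !betaD (beta_coboundary _ (ech_D e)) addr0.
Qed.

Lemma ev2Dr e' e1 e2 : ev2 e' (e1 + e2) = ev2 e' e1 + ev2 e' e2.
Proof.
have [w E] := ech_add e1 e2.
by rewrite /ev2 E !betaDr (beta_cocycle _ (ech_D e')) addr0.
Qed.

Lemma ev2Zl p e' e : ev2 (p *: e') e = p * ev2 e' e.
Proof.
have [w E] := ech_lact p e'.
by rewrite /ev2 E betaD (beta_coboundary _ (ech_D e)) addr0 beta_lactl.
Qed.

Lemma ev2Zr p e' e : ev2 e' (p *: e) = p * ev2 e' e.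
Proof.
have [w E] := ech_lact p e.
rewrite /ev2 E betaDr (beta_cocycle _ (ech_D e')) addr0.
by rewrite (beta_left_right _ (ech_D e') (ech_D e)) betaZr.
Qed.

Lemma ev2_hom a b e' e : gm_hom b e' -> gm_hom a e -> phomog (b + a) (ev2 e' e).
Proof.
move=> /ech_hom[f [w' [E' Hf f0]]] /ech_hom[z [w [E Hz z0]]].
by rewrite (ev2_rep f0 z0 E' E) addrC; apply: beta_hom.
Qed.

Lemma ev2_lin e : linear ((fun e' => ev2 e' e) : H' -> greg k n).
Proof. by move=> p e' e''; rewrite ev2Dl ev2Zl. Qed.

Lemma ev2_gmap e : is_gmap ((fun e' => ev2 e' e) : H' -> greg k n).
Proof.
have [s Hs ->] := grad_span (gm_grading H) e.
elim: s Hs => [|u s IHs] Hs.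
  rewrite big_nil; suff -> : (fun e' => ev2 e' 0) = 0 by apply: gmap0.
  by apply: funext => e'; apply: (addrI (ev2 e' 0)); rewrite -ev2Dr !addr0.
have -> : (fun e' => ev2 e' (\sum_(j <- u :: s) j)) =
    (fun e' => ev2 e' u) + (fun e' => ev2 e' (\sum_(j <- s) j)) :> (H' -> greg k n).
  by apply: funext => e'; rewrite big_cons ev2Dr.
apply: gmapD; last by apply: IHs => v vs; apply: Hs; rewrite inE vs orbT.
have [a Ha] := Hs u (mem_head _ _).
by apply: (gmap_single (a := a)); [exact: ev2_lin|move=> j v Hv; apply: ev2_hom].
Qed.

Definition Phi_fun (e : H) : mdual H' := mk_gmap (ev2_gmap e).

Lemma Phi_lin : linear Phi_fun.
Proof.
move=> p e1 e2; apply: gmapE => e'.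
rewrite -[LHS]/(ev2 e' (p *: e1 + e2)) -[RHS]/(p * ev2 e' e1 + ev2 e' e2).
by rewrite ev2Dr ev2Zr.
Qed.

Lemma Phi_deg a (e : H) : gm_hom a e -> gm_hom a (Phi_fun e).
Proof. by move=> Ha j v Hv; apply: ev2_hom. Qed.

Definition Phi : ghom H (mdual H') := GHom Phi_lin Phi_deg.

Lemma PhiE e e' : (Phi e : gmap H' (greg k n)) e' = ev2 e' e.
Proof. by []. Qed.

(** For surjectivity, a functional L on Ext becomes one on Koszul cocycles through a choice of
    class cl f for each cocycle f, to which dual_surj applies. *)
Theorem Phi_bij : SBim M -> (i <= n)%N -> bijective Phi.
Proof.
move=> MS i_le_n; have Hs := SBim_split MS; have Hf := SBim_fg MS.
have inj0 e : (forall e', ev2 e' e = 0) -> e = 0.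
  move=> e0; have [|w Ew] := dual_inj Hs Hf i_le_n (ech_pr e) (ech_D e).
    move=> f fi f0; have [e' [w' E']] := ech_surj fi f0.
    rewrite -(e0 e'); apply/esym; apply: (ev2_rep (w := 0) f0 (ech_D e) E').
    by rewrite linear0 addr0.
  exact: ech_inj Ew.
have inj : injective Phi.
  move=> e1 e2 E; apply/eqP; rewrite -subr_eq0; apply/eqP; apply: inj0 => e'.
  have := congr1 (fun g : gmap H' (greg k n) => g e') E; rewrite !PhiE => E'.
  by apply: (addIr (ev2 e' e2)); rewrite -ev2Dr subrK E' add0r.
have surj L : exists e, Phi e = L.
  pose T := K (opm (bdual M)) n; pose j := (n - i)%N; pose D' := D (bdual M).
  pose rel (e' : H') (f : T) := exists w, ech e' = f + D' w.
  have rel_uniq e1 e2 f : rel e1 f -> rel e2 f -> e1 = e2.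
    case=> w1 E1 [w2 E2]; apply/eqP; rewrite -subr_eq0; apply/eqP.
    have [w E] := ech_add (e1 - e2) e2; rewrite subrK E1 E2 in E.
    apply: (@ech_inj _ _ _ (w1 - w2 - w)).
    have E1' : D' w1 = ech (e1 - e2) + D' w2 + D' w.
      by apply: (addrI f); rewrite E addrCA -!addrA.
    by rewrite !linearB -/D' E1' addrAC addrK addrK.
  have /choice[cl Hcl] : forall f : T, exists e', kpr _ n j f = f -> D' f = 0 -> rel e' f.
    move=> f; case: (pselect (kpr _ n j f = f /\ D' f = 0)) => [[fj f0]|nf].
      by have [e' [w E]] := ech_surj fj f0; exists e' => _ _; exists w.
    by exists 0 => fj f0; case: nf.
  pose Lf f := (L : gmap H' (greg k n)) (cl f).
  have [||g gj|z [zi z0 Lz]] := @dual_surj _ _ _ Hs Hf i i_le_n Lf.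
  - move=> f g fj f0 gj g0; rewrite /Lf.
    have -> : cl (f + g) = cl f + cl g.
      apply: (@rel_uniq _ _ (f + g)).
        apply: Hcl; first by rewrite linearD fj gj.
        by rewrite linearD -/D' f0 g0 addr0.
      have [w1 E1] := Hcl f fj f0; have [w2 E2] := Hcl g gj g0.
      have [w E] := ech_add (cl f) (cl g).
      exists (w1 + w2 + w).
      by rewrite E E1 E2 !linearD -/D' [f + _ + (_ + _)]addrACA !addrA.
    exact: (linearD (L : gmap H' (greg k n))).
  - move=> f p fj f0; rewrite /Lf.
    have -> : cl (Kmap n (lactl (bdual M) p) f) = p *: cl f.
      apply: (@rel_uniq _ _ (Kmap n (lactl (bdual M) p) f)).
        apply: Hcl; first by rewrite kpr_map fj.
        by rewrite /D' -D_lactl f0 linear0.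
      have [w1 E1] := Hcl f fj f0; have [w E] := ech_lact p (cl f).
      exists (Kmap n (lactl (bdual M) p) w1 + w).
      by rewrite E E1 linearD D_lactl /D' linearD addrA.
    exact: (linearZ_LR (L : gmap H' (greg k n))).
  - have [w E] := Hcl (D' g) gj (KD_sq g (@dif_C _ (@yv k n) (opm (bdual M)))).
    rewrite /Lf; have -> : cl (D' g) = 0.
      by apply: (@ech_inj _ _ _ (g + w)); rewrite E /D' linearD.
    exact: (linear0 (L : gmap H' (greg k n))).
  have [e [w E]] := ech_surj zi z0; exists e; apply: gmapE => e'; rewrite PhiE.
  rewrite (ev2_rep (w' := 0) (ech_D e') z0 _ E) ?linear0 ?addr0 //.
  rewrite -Lz ?ech_D ?ech_pr // /Lf; congr (L _).
  apply: (@rel_uniq _ _ (ech e')); first by apply: Hcl; [exact: ech_pr|exact: ech_D].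
  by exists 0; rewrite /D' linear0 addr0.
have /choice[g Eg] := surj.
by exists g => // e; apply: inj; rewrite Eg.
Qed.
End Pairing.

Lemma ev2_nat M N i (g : ghom M N) (g' : ghom (bdual N) (bdual M)) (c : R)
    (e : HHt P i M) (e' : HHt P (n - i) (bdual N)) :
  (forall f v, bdual_app (g' f) v = c * bdual_app f (g v)) ->
  ev2 (HHt_map P (n - i) g' e') e = c * ev2 e' (HHt_map P i g e).
Proof.
move=> /beta_nat E; rewrite /ev2; have [w ->] := ech_nat g e; have [w' ->] := ech_nat g' e'.
rewrite betaD (beta_coboundary _ (ech_D e)) addr0 E.
by rewrite betaDr (beta_cocycle _ (ech_D e')) addr0.
Qed.
End Classes.

(** * The isomorphism of complexes *)

Section Complexes.
Variables (k : fieldType) (n : nat) (P : gprojres (Rbim k n)).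
Local Notation Q := (Qres k n).
Variables (th : forall i, ghom (Q i) (P i)) (ps : forall i, ghom (P i) (Q i)).
Hypothesis th_aug : forall x, pr_aug P (th 0%N x) = pr_aug Q x.
Hypothesis th_d : forall i x, pr_d P i (th i.+1 x) = th i (pr_d Q i x).
Hypothesis ps_aug : forall x, pr_aug Q (ps 0%N x) = pr_aug P x.
Hypothesis ps_d : forall i x, pr_d Q i (ps i.+1 x) = ps i (pr_d P i x).
Variables (X : gcomplex k (n + n)) (i : nat).

Local Notation H p := (HHt P i (X p)).
Local Notation H' p := (HHt P (n - i) (bdual (X p))).

(** In degree p the double dual complex involves X in degree - - p, which is equal to p
    but not convertible to it. *)
Definition Phi_tr (p p' : int) (E : p = p') : ghom (H p) (mdual (H' p')) :=
  eq_rect p (fun q => ghom (H p) (mdual (H' q))) (Phi th_d (X p) i) p' E.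

Lemma Phi_tr_nat p q p' q' (Ep : p = p') (Eq : q = q') s v (e : H' q') :
  (Phi_tr Ep v : gmap (H' p') (greg k n))
    (HHt_map P (n - i) (gscale s (bdual_map (cx_d X p' q'))) e) =
  s%:MP * (Phi_tr Eq (HHt_map P i (cx_d X p q) v) : gmap (H' q') (greg k n)) e.
Proof.
case: q' / Eq e => e; case: p' / Ep.
apply: (ev2_nat th_d (g := cx_d X p q)) => f w.
have E : lact s%:MP (bdual_map (cx_d X p q) f) = s%:MP *: bdual_map (cx_d X p q) f.
  by rewrite /lact /ren comp_mpolyC.
by rewrite -[RHS]/(s%:MP * bdual_app (bdual_map (cx_d X p q) f) w) -app_lact E.
Qed.

Lemma Phi_tr_bij p p' (E : p = p') : SBim (X p) -> (i <= n)%N -> bijective (Phi_tr E).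
Proof. by case: p' / E => XS i_le_n; apply: (Phi_bij th_aug th_d ps_aug ps_d). Qed.

Lemma gscale_bij (m : nat) (M N : gradedMod k m) (c : k) (f : ghom M N) : c != 0 ->
  bijective f -> bijective (gscale c f).
Proof.
move=> c0 [g fg gf]; exists (fun v => g (c^-1%:MP *: v)) => v /=.
  by rewrite scalerA -mpolyCM mulVf // scale1r.
by rewrite gf scalerA -mpolyCM mulfV // scale1r.
Qed.

Lemma gscale_app (Y Z : gradedMod k n) (c : k) (f : ghom Y (mdual Z)) v e :
  (gscale c f v : gmap Z (greg k n)) e = c%:MP * (f v : gmap Z (greg k n)) e.
Proof. by []. Qed.

Lemma gscale_square (Y Y' Z Z' : gradedMod k n) (d : ghom Y Y') (d' : ghom Z' Z)
    (F : ghom Y (mdual Z)) (F' : ghom Y' (mdual Z')) (a b b' c : k) :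
  (forall v e, (F v : gmap Z (greg k n)) (d' e) =
     c%:MP * (F' (d v) : gmap Z' (greg k n)) e) ->
  a * (b * c) = b' ->
  forall v, gscale b' F' (d v) = gscale a (mdual_map d') (gscale b F v).
Proof.
move=> E <- v; apply: gmapE => e.
rewrite (gscale_app (a * (b * c)) F' (d v) e) !mpolyCM -!mulrA -E.
rewrite -(gscale_app b F v (d' e)).
by [].
Qed.

Lemma HHt_cx_dual : (forall p, SBim (X p)) -> (i <= n)%N ->
  cx_iso (HHt_cx P i X) (mdual_cx (HHt_cx P (n - i) (bdual_cx X))).
Proof.
move=> XS i_le_n.
exists (fun p => gscale ((-1) ^ p) (Phi_tr (esym (opprK p)))); split=> [p|p q v].
  by apply: gscale_bij; [rewrite expfz_neq0 // oppr_eq0 oner_eq0|apply: Phi_tr_bij].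
have [->|pq] := eqVneq q (p + 1); last first.
  by rewrite (@cx_shape _ _ (HHt_cx P i X)) // linear0 cx_shape.
(* The two duals contribute the signs (-1)^(p + 1) and (-1)^(- (p + 1) + 1). *)
apply: (gscale_square (d := HHt_map P i (cx_d X p (p + 1)))
  (d' := HHt_map P (n - i) (gscale ((-1) ^ (- (p + 1) + 1)) (bdual_map (cx_d X (- - p) (- - (p + 1))))))
  (c := (-1) ^ (- (p + 1) + 1)) _ _ v) => [w e|].
  exact: (Phi_tr_nat (esym (opprK p)) (esym (opprK (p + 1)))).
rewrite -expfzDr ?oppr_eq0 ?oner_eq0 //.
by rewrite opprD subrK subrr expr0z mulr1.
Qed.
End Complexes.

(* P is an arbitrary projective resolution of R, with which Ext is calculated. *)
Theorem theorem1p11 (k : fieldType) (k_infinite : forall s : seq k, exists x, x \notin s)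
    (k_char : (2%:R : k) != 0) (n : nat) (P : gprojres (Rbim k n))
    (X : gcomplex k (n + n)) (X_SBim : forall p, SBim (X p)) (X_bounded : cx_bounded X)
    (i : nat) (i_le_n : (i <= n)%N) :
  cx_iso (HHt_cx P i X) (mdual_cx (HHt_cx P (n - i) (bdual_cx X))).
Proof.
have [th [th_aug th_d]] := chain_map_exists (Qres k n) P.
have [ps [ps_aug ps_d]] := chain_map_exists P (Qres k n).
exact: (HHt_cx_dual th_aug th_d ps_aug ps_d).
Qed.
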